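(* Let $G$ be a discrete group and let $w\in M_{cb}A(G)$ be a norm 1 element such that the multiplier $M_w:A(G)\to A(G)$, $g\mapsto w\cdot g$, is injective with dense range. The deformed Fourier algebra $A_w(G)$ is completely representable as an operator algebra if and only if $w\in\ell^2(G)$.
   Context: $A(G)$ is the Fourier algebra of $G$ with its natural operator space structure as the predual of the group von Neumann algebra $VN(G)$; $M_{cb}A(G)$ is the algebra of functions $w$ on $G$ with $w\cdot A(G)\subseteq A(G)$ for which $M_w$ is completely bounded, normed by $\|w\|_{M_{cb}A(G)}=\|M_w\|_{cb}$. Deformed Fourier algebra: $A_w(G)=w\cdot A(G)$ with norm $\|w\cdot g\|_w=\|g\|_{A(G)}$, with the operator space structure making $A(G)\to A_w(G)$, $g\mapsto w\cdot g$, a complete isometry, and with pointwise multiplication as product. This is a completely contractive Banach algebra. Complete representability: a completely contractive Banach algebra $\mathcal{A}$ is completely representable as an operator algebra if there are an operator algebra $\mathcal{B}$ (a closed subalgebra of $B(H)$ for some Hilbert space $H$) and a bijective algebra isomorphism $T:\mathcal{A}\to\mathcal{B}$ with $T$ and $T^{-1}$ completely bounded. *)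

(* Defs.v *)
(* Complex numbers are [R[i]] with [R : realType]; a discrete group is a
   [groupType]. *)
From HB Require Import structures.
From mathcomp Require Import all_boot all_order all_algebra.
From mathcomp Require Import sesquilinear complex.
From mathcomp Require Import all_classical all_reals ereal esum numfun.
From mathcomp Require Import ring.

Set Implicit Arguments.
Unset Strict Implicit.
Unset Printing Implicit Defensive.

Import Order.TTheory GRing.Theory Num.Theory Normc.

Local Open Scope classical_set_scope.
Local Open Scope ring_scope.
Local Open Scope complex_scope.

Section UnorderedSums.
Context {R : realType} {I : choiceType}.

(* Unordered sums; only meaningful for absolutely summable families. *)
Definition rsum (f : I -> R) : R :=
  fine (\esum_(i in [set: I]) (EFin \o f)^\+%E i) -
  fine (\esum_(i in [set: I]) (EFin \o f)^\-%E i).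

Definition csum (f : I -> R[i]) : R[i] :=
  rsum (fun i => complex.Re (f i)) +i* rsum (fun i => complex.Im (f i)).

Definition l2 (f : I -> R[i]) : Prop :=
  (\esum_(i in [set: I]) ((normc (f i)) ^+ 2)%:E < +oo)%E.

End UnorderedSums.

Lemma l2D (R : realType) (I : choiceType) (f g : I -> R[i]) :
  l2 f -> l2 g -> l2 (f + g).
Proof.
move=> fl gl; rewrite /l2.
pose F i := ((normc (f i)) ^+ 2)%:E; pose H i := ((normc (g i)) ^+ 2)%:E.
have F0 i : (0 <= F i)%E by rewrite lee_fin sqr_ge0.
have H0 i : (0 <= H i)%E by rewrite lee_fin sqr_ge0.
have S : (\esum_(i in [set: I]) (F i + F i + (H i + H i)) < +oo)%E.
  by rewrite !esumD//; [rewrite !lte_add_pinfty | move=> *; exact: adde_ge0..].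
apply: le_lt_trans S; apply: le_esum => i _.
rewrite -!EFinD lee_fin.
have n0 (z : R[i]) : 0 <= normc z by case: z => a b; rewrite sqrtr_ge0.
apply: (@le_trans _ _ ((normc (f i) + normc (g i)) ^+ 2)).
  by rewrite lerXn2r ?nnegrE ?addr_ge0// le_normcD.
have := sqr_ge0 (normc (f i) - normc (g i)).
rewrite sqrrB sqrrD; set a := normc (f i); set b := normc (g i).
rewrite -subr_ge0; set x := a * b *+ 2 => h; rewrite -subr_ge0.
by apply: le_trans h _; rewrite le_eqVlt; apply/orP; left; apply/eqP; ring.
Qed.

Lemma l2Z (R : realType) (I : choiceType) (a : R[i]) (f : I -> R[i]) :
  l2 f -> l2 (a *: f).
Proof.
rewrite /l2 => fl; set F := fun i => (((normc (f i)) ^+ 2)%:E)%E in fl *.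
have F0 i : (0 <= F i)%E by rewrite lee_fin sqr_ge0.
apply: (@le_lt_trans _ _ (((normc a) ^+ 2)%:E * \esum_(i in [set: I]) F i)%E).
  apply: ub_ereal_sup => _ [A [Afin _] <-].
  under eq_fsbigr do rewrite [normc _]normcM exprMn EFinM.
  rewrite -ge0_mule_fsumr// lee_wpmul2l ?lee_fin ?sqr_ge0//.
  by apply: esum_ge; exists A.
by rewrite lte_mul_pinfty// ?lee_fin ?sqr_ge0.
Qed.

Section L2Space.
Variables (R : realType) (I : choiceType).

Definition l2_pred : {pred I -> R[i]} := fun f => `[< l2 f >].

Lemma l2_submod : submod_closed l2_pred.
Proof.
split.
  by apply/asboolP; rewrite /l2 esum1 ?ltry// => i _; rewrite normc0 expr0n.
by move=> a f g /asboolP fl /asboolP gl; apply/asboolP/l2D => //; exact: l2Z.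
Qed.

HB.instance Definition _ := GRing.isSubmodClosed.Build R[i] (I -> R[i]) l2_pred
  l2_submod.

Record l2space := L2Space { l2val :> I -> R[i]; l2valP : l2val \in l2_pred }.

HB.instance Definition _ := [isSub for l2val].
HB.instance Definition _ := [Choice of l2space by <:].
HB.instance Definition _ := [SubChoice_isSubLmodule of l2space by <:].

Definition l2norm (f : l2space) : R :=
  Num.sqrt (fine (\esum_(i in [set: I]) ((normc (f i)) ^+ 2)%:E)).

Definition l2dot (f g : l2space) : R[i] := csum (fun i => f i * Num.conj (g i)).

End L2Space.

(* [N : V -> R] is the norm of the space [V] on which the operators act. *)
Section Operators.
Context {R : realType} {V : lmodType R[i]}.
Variable N : V -> R.

Definition bounded_op (T : V -> V) : Prop :=
  linear T /\ exists M : R, forall x, N (T x) <= M * N x.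

(* Norm of the operator matrix [T i j] on the Hilbertian direct sum of copies
   of [V] indexed by [I]. *)
Definition opnorm (I : finType) (T : I -> I -> V -> V) : \bar R :=
  ereal_sup [set (Num.sqrt (\sum_i N (\sum_j T i j (x j)) ^+ 2))%:E
            | x in [set x : I -> V | \sum_j N (x j) ^+ 2 <= 1]].

Definition op_mxnorm n (T : 'M[V -> V]_n) : \bar R := opnorm (fun i j => T i j).

Definition commutant (S : set (V -> V)) : set (V -> V) :=
  [set T | bounded_op T /\ forall U, S U -> T \o U = U \o T].

Definition closed_subalgebra (B : set (V -> V)) : Prop :=
  [/\ B `<=` bounded_op,
      B 0,
      forall (a : R[i]) S T, B S -> B T -> B (a *: S + T),
      forall S T, B S -> B T -> B (S \o T) &
      forall T, bounded_op T ->
        (forall e : R, 0 < e -> exists2 S, B S &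
           (opnorm (fun _ _ : 'I_1 => (T - S)%R) <= e%:E)%E) ->
        B T].

End Operators.

Record hilbert (R : realType) := Hilbert {
  hcarrier :> lmodType R[i];
  hdot : {dot hcarrier for Num.conj};
  hnorm := fun x : hcarrier => Num.sqrt (complex.Re (hdot x x));
  hcomplete : forall u : nat -> hcarrier,
    (forall e : R, 0 < e -> exists k, forall m n,
       (k <= m)%N -> (k <= n)%N -> hnorm (u m - u n) < e) ->
    exists l, forall e : R, 0 < e -> exists k, forall n,
       (k <= n)%N -> hnorm (u n - l) < e }.

Definition scalar_opnorm (R : realType) (I : finType) (a : I -> I -> R[i]) :
  \bar R := opnorm (@normc R) (fun i j z => a i j * z).

Section CompleteBoundedness.
Context {R : realType}.

(* An operator space is given by an ambient type, the set of its elements and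
   the norms of the square matrices with entries in that set. *)
Definition mxnorms (V : Type) := forall n, 'M[V]_n -> \bar R.

Definition cb_norm (V W : Type) (A : set V) (NV : mxnorms V) (NW : mxnorms W)
    (T : V -> W) : \bar R :=
  ereal_sup [set z | exists n, exists v : 'M[V]_n,
    [/\ forall i j, A (v i j), (NV n v <= 1)%E & z = NW n (map_mx T v)]].

Definition completely_bounded (V W : Type) (A : set V) (NV : mxnorms V)
    (NW : mxnorms W) (T : V -> W) : Prop :=
  (cb_norm A NV NW T < +oo)%E.

Definition completely_representable (V : lmodType R[i]) (mul : V -> V -> V)
    (A : set V) (NA : mxnorms V) : Prop :=
  exists H : hilbert R,
  let NB : mxnorms (H -> H) := fun n => @op_mxnorm R H (@hnorm R H) n in
  exists (B : set (H -> H)) (T : V -> H -> H) (T' : (H -> H) -> V),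
  [/\ closed_subalgebra (@hnorm R H) B,
      [/\ forall f, A f -> B (T f) /\ T' (T f) = f &
          forall S, B S -> A (T' S) /\ T (T' S) = S],
      [/\ forall (a : R[i]) f g, A f -> A g -> T (a *: f + g) = a *: T f + T g &
          forall f g, A f -> A g -> T (mul f g) = T f \o T g],
      completely_bounded A NA NB T &
      completely_bounded B NB NA T'].

End CompleteBoundedness.

Section Fourier.
Context {R : realType} {G : groupType}.

Notation L2 := (l2space R G).
Notation l2norm := (@l2norm R G).

Lemma lreg_subproof (s : G) (f : L2) :
  (fun t => f (s^-1 * t)%g) \in @l2_pred R G.
Proof.
have /asboolP fl := l2valP f; apply/asboolP; move: fl; rewrite /l2.
rewrite (@reindex_esum R G G [set: G] [set: G] (fun t => s^-1 * t)%g) //.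
split => //.
- by move=> x y _ _; exact: mulgI.
- by move=> y _; exists (s * y)%g => //; rewrite mulKg.
Qed.

Definition lreg (s : G) (f : L2) : L2 := L2Space (lreg_subproof s f).

Definition VN : set (L2 -> L2) :=
  commutant l2norm (commutant l2norm (range lreg)).

(* Normal (ultraweakly continuous) functionals. *)
Definition normal (phi : (L2 -> L2) -> R[i]) : Prop :=
  exists xi eta : nat -> L2,
  [/\ (\esum_(n in [set: nat]) ((l2norm (xi n)) ^+ 2)%:E < +oo)%E,
      (\esum_(n in [set: nat]) ((l2norm (eta n)) ^+ 2)%:E < +oo)%E &
      phi = fun T => csum (fun n => l2dot (T (xi n)) (eta n))].

(* The predual of [VN], realised as functions on [G]: the normal functional
   [phi] is identified with [s |-> phi (lreg s)]. *)
Definition fourier : set (G -> R[i]) :=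
  [set u | exists2 phi, normal phi & u = phi \o lreg].

(* The duality between [fourier] and [VN].  The restriction to [VN] of the
   functional [phi] chosen here is unique, the span of [range lreg] being
   ultraweakly dense in [VN]. *)
Definition fourier_pairing (u : G -> R[i]) : (L2 -> L2) -> R[i] :=
  xget (fun=> 0) [set phi | normal phi /\ u = phi \o lreg].

(* The predual operator space structure: [u] in [M_n(fourier)] is normed as the
   completely bounded map [T |-> <u, T>] from [VN] to [M_n(C)]. *)
Definition fourier_mxnorm n (u : 'M[G -> R[i]]_n) : \bar R :=
  cb_norm VN (@op_mxnorm R L2 l2norm) (fun m (a : 'M['M[R[i]]_n]_m) =>
      scalar_opnorm (fun p q : 'I_m * 'I_n => a p.1 q.1 p.2 q.2))
    (fun T => \matrix_(i, j) fourier_pairing (u i j) T).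

Definition fourier_norm (u : G -> R[i]) : \bar R :=
  fourier_mxnorm (const_mx u : 'M_1).

Definition multiplier (w : G -> R[i]) : (G -> R[i]) -> (G -> R[i]) :=
  fun g => w * g.

Definition mcb_norm (w : G -> R[i]) : \bar R :=
  cb_norm fourier fourier_mxnorm fourier_mxnorm (multiplier w).

Definition mcb (w : G -> R[i]) : Prop :=
  (forall g, fourier g -> fourier (multiplier w g)) /\
  completely_bounded fourier fourier_mxnorm fourier_mxnorm (multiplier w).

Definition dense_range (w : G -> R[i]) : Prop :=
  forall u, fourier u -> forall e : R, 0 < e ->
    exists2 g, fourier g & (fourier_norm (u - multiplier w g)%R < e%:E)%E.

Definition deformed (w : G -> R[i]) : set (G -> R[i]) :=
  multiplier w @` fourier.

(* When [multiplier w] is injective on [fourier], the infimum is over exactly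
   one matrix [u]. *)
Definition deformed_mxnorm (w : G -> R[i]) n (v : 'M[G -> R[i]]_n) : \bar R :=
  ereal_inf [set fourier_mxnorm u | u in [set u : 'M[G -> R[i]]_n |
    (forall i j, fourier (u i j)) /\ map_mx (multiplier w) u = v]].

End Fourier.

(* Main.v *)
(** Transported to [A(G)], the product of [A_w(G)] is [(f, g) |-> w f g].

    If [w] is in [l2], then for [X] in the unit ball of [M_n(VN(G))] the upper
    triangular operator [[0, row(w f), <f, X>], [0, diag(w f), col(f X)],
    [0, 0, 0]], where [X s = (X delta_1) s], is multiplicative in [f] for this
    product, since [<w f g, X> = sum_s w(s) f(s) g(s) (X s)]. The row and the
    column are bounded by the norms of [w] and [X delta_1] in [l2], and the
    corners, over all [X], recover the matrix norms of [A(G)]; the direct sum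
    over [X] is thus a complete isomorphism onto an operator algebra, closed
    because [A(G)] is complete.

    Conversely, the row [(a_s delta_s)] with [|a_s| <= 1] and the column
    [(delta_s)] are contractive over [A(G)]. Multiplying their images under a
    representation bounds [sum_s a_s w(s) delta_s] in [A(G)], uniformly in the
    signs [a] and the finite range of [s]. A noncommutative Khintchine argument
    chooses the signs, and an operator of [VN(G)] tested against this sum bounds
    [sum_s |w(s)|^2]. *)
Require Import Defs.
From HB Require Import structures.
From mathcomp Require Import all_boot all_order all_algebra sesquilinear complex finmap.
From mathcomp Require Import all_classical all_reals ereal esum numfun.
From mathcomp Require Import ring lra.

Set Implicit Arguments.
Unset Strict Implicit.
Unset Printing Implicit Defensive.

Import Order.TTheory GRing.Theory Num.Theory Normc.

Local Open Scope ring_scope.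
Local Open Scope classical_set_scope.
Local Open Scope complex_scope.

(** Completeness of [A(G)] is the analytic obstacle to sufficiency: [fourier_norm] is a supremum
    over [VN(G)] and gives no hold on limits. The detour is the quotient trace norm [trnorm], which
    measures a function by the vectors representing it; such sequences can be concatenated, so
    absolutely convergent series converge. The two norms are equivalent: a Hahn-Banach functional
    for [trnorm] is an operator of [VN(G)], with a factor 2 from real and imaginary parts. That the
    pairing does not depend on the representing vectors is a double commutant argument.

    In the converse, put [S = sum |w(s)|^2] over a finite set, [y = sum conj(c_s) lambda(s)] with
    [c_s = a_s w(s)], and let [D] be the uniform bound. The polar part of [y] would be the natural
    test operator; [y (1 + t y^* y)^-1] needs no functional calculus, has norm at most [t^(-1/2)]
    and loses only [t ||y^* y delta_1||^2], which suitable signs keep below [3 t S^2]. With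
    [t = 1/(6 S)] this gives [S/2 <= D sqrt(6 S)], that is [S <= 24 D^2]. *)

Lemma le_of_eq d (T : porderType d) (x y : T) : x = y -> (x <= y)%O.
Proof. by move=> ->. Qed.

(** * Functions whose linearity is a hypothesis *)

Section LinearMaps.
Context {K : pzRingType} {V W : lmodType K} {f : V -> W}.
Hypothesis f_lin : forall a x y, f (a *: x + y) = a *: f x + f y.

Lemma linear_map0 : f 0 = 0.
Proof. by have := f_lin (-1) 0 0; rewrite scaler0 addr0 scaleN1r addNr. Qed.

Lemma linear_mapZ a x : f (a *: x) = a *: f x.
Proof. by have := f_lin a x 0; rewrite linear_map0 !addr0. Qed.

Lemma linear_mapD x y : f (x + y) = f x + f y.
Proof. by have := f_lin 1 x y; rewrite !scale1r. Qed.

Lemma linear_map_sum (J : Type) (r : seq J) (F : J -> V) :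
  f (\sum_(j <- r) F j) = \sum_(j <- r) f (F j).
Proof.
elim: r => [|j r IH]; first by rewrite !big_nil linear_map0.
by rewrite !big_cons linear_mapD IH.
Qed.

End LinearMaps.

(** * Modulus and conjugation of complex numbers *)

Section ComplexModulus.
Context {R : realType}.
Implicit Types z : R[i].

Lemma normc_norm z : `|z| = (normc z)%:C.
Proof. by case: z. Qed.

Lemma normc_ge0 z : 0 <= normc z.
Proof. by case: z => a b; rewrite sqrtr_ge0. Qed.

Lemma normc_sum (I : Type) (r : seq I) (P : pred I) (f : I -> R[i]) :
  normc (\sum_(i <- r | P i) f i) <= \sum_(i <- r | P i) normc (f i).
Proof.
elim/big_rec2: _ => [|i y x _ le]; first by rewrite normc0.
exact: le_trans (le_normcD _ _) (lerD _ _).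
Qed.

(** Both conjugations satisfy [z * conj z = |z|^2], so [z] can be cancelled unless it is 0. *)
Lemma conjcE z : Num.conj z = z^*%C.
Proof.
have := normCK z; rewrite sqr_normc => /eqP.
have [->|z0] := eqVneq z 0; first by rewrite !rmorph0.
by rewrite eq_sym -subr_eq0 -mulrBr mulf_eq0 (negPf z0)/= subr_eq0 => /eqP.
Qed.

Lemma normc_conj z : normc (Num.conj z) = normc z.
Proof. by rewrite conjcE; case: z => a b /=; rewrite sqrrN. Qed.

Lemma normc_real (a : R) : normc a%:C = `|a|.
Proof. by rewrite /= expr0n addr0 sqrtr_sqr. Qed.

Lemma normc_eq0 z : (normc z == 0) = (z == 0).
Proof.
apply/eqP/eqP => [|->]; last exact: normc0.
exact: eq0_normc.
Qed.

Lemma normc_gt0 z : (0 < normc z) = (z != 0).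
Proof. by rewrite lt_def normc_ge0 andbT normc_eq0. Qed.

Lemma ler_Re_normc z : `|complex.Re z| <= normc z.
Proof. by case: z => a b /=; rewrite -sqrtr_sqr ler_sqrt ?lerDl ?addr_ge0 ?sqr_ge0. Qed.

Lemma ler_Im_normc z : `|complex.Im z| <= normc z.
Proof. by case: z => a b /=; rewrite -sqrtr_sqr ler_sqrt ?lerDr ?addr_ge0 ?sqr_ge0. Qed.

Lemma mulc_conj z : z * Num.conj z = (normc z ^+ 2)%:C.
Proof. by rewrite -normCK normc_norm rmorphXn. Qed.

Lemma conjK z : Num.conj (Num.conj z) = z.
Proof. exact: conjCK. Qed.

Lemma ReD z1 z2 : complex.Re (z1 + z2) = complex.Re z1 + complex.Re z2.
Proof. by case: z1; case: z2. Qed.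

Lemma ReN z : complex.Re (- z) = - complex.Re z.
Proof. by case: z. Qed.

Lemma ReB z1 z2 : complex.Re (z1 - z2) = complex.Re z1 - complex.Re z2.
Proof. by rewrite ReD ReN. Qed.

Lemma Rec_conj z : complex.Re (Num.conj z) = complex.Re z.
Proof. by rewrite conjcE; case: z. Qed.

Lemma ReZ (a : R) z : complex.Re (a%:C * z) = a * complex.Re z.
Proof. by case: z => x y /=; rewrite mul0r subr0. Qed.

Lemma Re_real (a : R) : complex.Re (a%:C) = a.
Proof. by []. Qed.

(** A rotation turns a modulus into a real part; bounds for real parts thereby become bounds for
    moduli. *)
Lemma unimodular z : exists2 u, normc u = 1 & u * z = (normc z)%:C.
Proof.
have [->|z0] := eqVneq z 0; first by exists 1; rewrite ?normc1 // normc0 mulr0.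
exists (Num.conj z / (normc z)%:C).
  by rewrite normcM normcV normc_conj normc_real ger0_norm ?normc_ge0// divff ?normc_eq0.
rewrite mulrAC [_ * z]mulrC mulc_conj expr2 rmorphM mulfK//.
by apply: contra z0 => /eqP/complexI/eqP; rewrite normc_eq0.
Qed.

End ComplexModulus.

(** * Unordered sums *)

Section Sums.
Context {R : realType} {I : choiceType}.
Implicit Types (c : R) (a : R[i]) (f g h : I -> R) (u v : I -> R[i]).

(** Meant for nonnegative [f]: the value is then always defined in the extended reals, and being
    finite is summability. *)
Definition nsum f : \bar R := (\esum_(i in [set: I]) (f i)%:E)%E.

Lemma nsum_ge0 f : (forall i, 0 <= f i) -> (0 <= nsum f)%E.
Proof. by move=> f0; apply: esum_ge0 => i _; rewrite lee_fin. Qed.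

Lemma nsum_fin f : (forall i, 0 <= f i) -> (nsum f < +oo)%E ->
  nsum f = (fine (nsum f))%:E.
Proof. by move=> f0 foo; rewrite fineK// ge0_fin_numE// nsum_ge0. Qed.

Lemma le_nsum f g : (forall i, f i <= g i) -> (nsum f <= nsum g)%E.
Proof. by move=> fg; apply: le_esum => i _; rewrite lee_fin. Qed.

Lemma eq_nsum f g : (forall i, f i = g i) -> nsum f = nsum g.
Proof. by move=> fg; apply: eq_esum => i _; rewrite fg. Qed.

Lemma nsumD f g : (forall i, 0 <= f i) -> (forall i, 0 <= g i) ->
  nsum (fun i => (f i + g i)%R) = (nsum f + nsum g)%E.
Proof. by move=> f0 g0; rewrite /nsum -esumD// => i _; rewrite lee_fin. Qed.

Lemma nsum_sum (J : Type) (r : seq J) (P : pred J) (f : J -> I -> R) :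
  (forall j i, 0 <= f j i) ->
  nsum (fun i => (\sum_(j <- r | P j) f j i)%R) = (\sum_(j <- r | P j) nsum (f j))%E.
Proof.
move=> f0; elim: r => [|j r IH].
  by rewrite big_nil /nsum esum1// => i _; rewrite big_nil.
rewrite big_cons; case: ifP => Pj.
  rewrite -IH -nsumD//; last by move=> i; apply: sumr_ge0.
  by apply: eq_nsum => i; rewrite big_cons Pj.
by rewrite -IH; apply: eq_nsum => i; rewrite big_cons Pj.
Qed.

Lemma nsumZ_le c f : 0 <= c -> (forall i, 0 <= f i) ->
  (nsum (fun i => (c * f i)%R) <= c%:E * nsum f)%E.
Proof.
move=> c0 f0; apply: ge_ereal_sup => _ [A [Afin _] <-].
under eq_fsbigr do rewrite EFinM.
rewrite -ge0_mule_fsumr//.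
by rewrite lee_wpmul2l ?lee_fin//; apply: esum_ge; exists A.
Qed.

Lemma nsumZ c f : 0 <= c -> (forall i, 0 <= f i) ->
  nsum (fun i => (c * f i)%R) = (c%:E * nsum f)%E.
Proof.
move=> c0 f0; apply/eqP; rewrite eq_le nsumZ_le//=.
have [->|c1] := eqVneq c 0.
  by rewrite mul0e nsum_ge0// => i; rewrite mul0r.
have c2 : 0 < c by rewrite lt_def c1.
(* The reverse inequality is [nsumZ_le] for the factor [c^-1]. *)
rewrite -lee_pdivlMl//; apply: le_trans (nsumZ_le _ _); rewrite ?invr_ge0//.
  by apply: le_nsum => i; rewrite mulrA mulVf// mul1r.
by move=> i; rewrite mulr_ge0.
Qed.

Lemma nsum_ge_term f i : (forall i, 0 <= f i) -> ((f i)%:E <= nsum f)%E.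
Proof.
move=> f0; apply: esum_ge; exists [set i]; first by split => //; exact: finite_set1.
by rewrite fsbig_set1.
Qed.

Lemma nsum_ge_seq f (r : seq I) : uniq r -> (forall i, 0 <= f i) ->
  ((\sum_(i <- r) f i)%R%:E <= nsum f)%E.
Proof.
move=> ur f0; apply: esum_ge; exists [set` r].
  split => //; exact: finite_seq.
by rewrite -fsbig_seq// sumEFin.
Qed.

Lemma nsum_le_seq f (M : \bar R) :
  (forall r : seq I, uniq r -> ((\sum_(i <- r) f i)%R%:E <= M)%E) -> (nsum f <= M)%E.
Proof.
move=> le; apply: ge_ereal_sup => _ [A [Afin _] <-].
rewrite fsbig_finite//= sumEFin; exact: le.
Qed.

Lemma nsum_supp1 f i0 : 0 <= f i0 -> (forall i, i != i0 -> f i = 0) -> nsum f = (f i0)%:E.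
Proof.
move=> f0 fs; rewrite /nsum (eq_esum (b := fun i => if i \in [set i0] then (f i)%:E else 0%E)).
  by rewrite -(esum_mkcond [set i0]) esum_set1 ?lee_fin.
move=> i _; case: ifPn => //; rewrite notin_setE/= => /eqP ne; by rewrite fs.
Qed.

(** [rsum] is defined by the canonical positive and negative parts, but any splitting into summable
    nonnegative parts gives the same value. Additivity, homogeneity and the Fubini rule are all
    deduced from [nsum] through this freedom. *)
Lemma rsumB f g : (forall i, 0 <= f i) -> (forall i, 0 <= g i) ->
  (nsum f < +oo)%E -> (nsum g < +oo)%E ->
  rsum (fun i => f i - g i) = fine (nsum f) - fine (nsum g).
Proof.
move=> f0 g0 fo go; rewrite /rsum.
have E : EFin \o (fun i => f i - g i) = ((EFin \o f) \- (EFin \o g))%E.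
  by apply/funext => i /=; rewrite EFinB.
have abs h : (forall i, 0 <= h i) -> (nsum h < +oo)%E -> summable [set: I] (EFin \o h).
  by move=> h0; apply: le_lt_trans; apply: le_esum => i _ /=; rewrite lee_fin ger0_norm.
have fin (k : I -> \bar R) h : (forall i, 0 <= k i)%E -> (forall i, k i <= `|h i|%R%:E)%E ->
  (nsum (fun i => `|h i|%R) < +oo)%E -> (\esum_(i in [set: I]) k i)%E \is a fin_num.
  move=> k0 kh ho; rewrite ge0_fin_numE ?esum_ge0//.
  by apply: le_lt_trans ho; apply: le_esum.
have ho : (nsum (fun i => `|f i - g i|%R) < +oo)%E.
  apply: (@le_lt_trans _ _ (nsum (fun i => (f i + g i)%R))).
    by apply: le_nsum => i; apply: le_trans (ler_normB _ _) _; rewrite !ger0_norm.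
  by rewrite nsumD// lte_add_pinfty.
have P1 : (\esum_(i in [set: I]) (EFin \o (fun i => (f i - g i)%R))^\+ i)%E \is a fin_num.
  apply: (fin _ (fun i => f i - g i)) => // i /=.
  by rewrite funeposE /= -EFin_max lee_fin ge_max ler_norm normr_ge0.
have P2 : (\esum_(i in [set: I]) (EFin \o (fun i => (f i - g i)%R))^\- i)%E \is a fin_num.
  apply: (fin _ (fun i => f i - g i)) => // i /=.
  by rewrite funenegE /= -EFin_max lee_fin ge_max -normrN ler_norm normr_ge0.
rewrite -fineB// E esumB//; [| exact: abs.. | by move=> i _ /=; rewrite lee_fin | by move=> i _ /=; rewrite lee_fin].
by rewrite fineB// ge0_fin_numE// nsum_ge0.
Qed.

Definition abssum u := (nsum (fun i => normc (u i)) < +oo)%E.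

Lemma rsum_posneg f : (nsum (fun i => `|f i|%R) < +oo)%E ->
  exists g h, [/\ forall i, 0 <= g i <= `|f i|, forall i, 0 <= h i <= `|f i|, f = (fun i => g i - h i)
   & [/\ (nsum g < +oo)%E, (nsum h < +oo)%E & rsum f = fine (nsum g) - fine (nsum h)]].
Proof.
move=> fo; pose pos i := Num.max (f i) 0; pose neg i := Num.max (- f i) 0.
have pos_ge0 i : 0 <= pos i by rewrite le_max lexx orbT.
have neg_ge0 i : 0 <= neg i by rewrite le_max lexx orbT.
have pos_le i : pos i <= `|f i| by rewrite ge_max ler_norm normr_ge0.
have neg_le i : neg i <= `|f i| by rewrite ge_max -normrN ler_norm normr_ge0.
have E : f = (fun i => pos i - neg i).
  apply/funext => i; rewrite /pos /neg; case: (leP (f i) 0) => h.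
    by rewrite max_l ?oppr_ge0// sub0r opprK.
  by rewrite max_r ?subr0// oppr_le0 ltW.
have po : (nsum pos < +oo)%E by apply: le_lt_trans fo; exact: le_nsum.
have no : (nsum neg < +oo)%E by apply: le_lt_trans fo; exact: le_nsum.
exists pos, neg; split => //.
- by move=> i; rewrite pos_ge0 pos_le.
- by move=> i; rewrite neg_ge0 neg_le.
by split => //; rewrite {1}E rsumB.
Qed.

Lemma rsumD f g : (nsum (fun i => `|f i|%R) < +oo)%E -> (nsum (fun i => `|g i|%R) < +oo)%E ->
  rsum (fun i => f i + g i) = rsum f + rsum g.
Proof.
move=> /rsum_posneg[f1 [f2 [f1b f2b fE [f1o f2o ->]]]].
move=> /rsum_posneg[g1 [g2 [g1b g2b gE [g1o g2o ->]]]].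
have ge0 (h k : I -> R) : (forall i, 0 <= h i <= k i) -> forall i, 0 <= h i.
  by move=> hk i; case/andP: (hk i).
have := ge0 _ _ f1b; have := ge0 _ _ f2b; have := ge0 _ _ g1b; have := ge0 _ _ g2b.
move=> h1 h2 h3 h4; rewrite fE gE.
rewrite (_ : (fun i => _) = (fun i => (f1 i + g1 i) - (f2 i + g2 i))); last first.
  by apply/funext => i; rewrite opprD addrACA.
rewrite rsumB ?nsumD ?lte_add_pinfty//; try by move=> i; rewrite addr_ge0.
rewrite !fineD ?ge0_fin_numE ?nsum_ge0//.
by rewrite opprD addrACA.
Qed.

Lemma rsumN f : rsum (fun i => - f i) = - rsum f.
Proof.
rewrite /rsum opprB; congr (fine _ - fine _); apply: eq_esum => i _.
  by rewrite funeposE funenegE/=.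
by rewrite funeposE funenegE /= opprK.
Qed.

Lemma rsumZ c f : (nsum (fun i => `|f i|%R) < +oo)%E -> rsum (fun i => c * f i) = c * rsum f.
Proof.
wlog c0 : c f / 0 <= c => [H fo|].
  case: (leP 0 c) => [/H->//|c0].
  rewrite (_ : (fun i => _) = (fun i => - (- c * f i))); last first.
    by apply/funext => i; rewrite mulNr opprK.
  by rewrite rsumN H// ?oppr_ge0 ?ltW// mulNr opprK.
move=> /rsum_posneg[f1 [f2 [f1b f2b fE [f1o f2o ->]]]].
have ge0 (h k : I -> R) : (forall i, 0 <= h i <= k i) -> forall i, 0 <= h i.
  by move=> hk i; case/andP: (hk i).
have h1 := ge0 _ _ f1b; have h2 := ge0 _ _ f2b; rewrite fE.
rewrite (_ : (fun i => _) = (fun i => c * f1 i - c * f2 i)); last first.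
  by apply/funext => i; rewrite mulrBr.
rewrite rsumB.
- have E k : (forall i, 0 <= k i) -> (nsum k < +oo)%E ->
    fine (nsum (fun i => c * k i)) = c * fine (nsum k).
    by move=> k0 ko; rewrite nsumZ// fineM// ge0_fin_numE// nsum_ge0.
  by rewrite (E f1)// (E f2)// mulrBr.
- by move=> i; rewrite mulr_ge0.
- by move=> i; rewrite mulr_ge0.
- by rewrite (nsumZ c0 h1) lte_mul_pinfty// lee_fin.
- by rewrite (nsumZ c0 h2) lte_mul_pinfty// lee_fin.
Qed.

Lemma rsum_le f : (nsum (fun i => `|f i|%R) < +oo)%E -> rsum f <= fine (nsum (fun i => `|f i|%R)).
Proof.
move=> fo; have := rsum_posneg fo => -[f1 [f2 [f1b f2b fE [f1o f2o ->]]]].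
have h1 i : 0 <= f1 i by case/andP: (f1b i).
have h2 i : 0 <= f2 i by case/andP: (f2b i).
rewrite (@le_trans _ _ (fine (nsum f1)))//.
  by rewrite gerBl fine_ge0// nsum_ge0.
rewrite fine_le ?ge0_fin_numE ?nsum_ge0//.
by apply: le_nsum => i; case/andP: (f1b i).
Qed.

Lemma abssum_Re u : abssum u -> (nsum (fun i => `|complex.Re (u i)|%R) < +oo)%E.
Proof. by apply: le_lt_trans; apply: le_nsum => i; exact: ler_Re_normc. Qed.

Lemma abssum_Im u : abssum u -> (nsum (fun i => `|complex.Im (u i)|%R) < +oo)%E.
Proof. by apply: le_lt_trans; apply: le_nsum => i; exact: ler_Im_normc. Qed.

Lemma abssumD u v : abssum u -> abssum v -> abssum (fun i => u i + v i).
Proof.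
move=> uo vo; apply: (@le_lt_trans _ _ (nsum (fun i => normc (u i)) + nsum (fun i => normc (v i)))%E).
  rewrite -nsumD; [|by move=> i; exact: normc_ge0..].
  by apply: le_nsum => i; exact: le_normcD.
by rewrite lte_add_pinfty.
Qed.

Lemma abssumZ a u : abssum u -> abssum (fun i => a * u i).
Proof.
move=> uo; rewrite /abssum (eq_nsum (g := fun i => normc a * normc (u i))); last first.
  by move=> i /=; rewrite -normcM.
rewrite nsumZ ?normc_ge0//; last by move=> i; exact: normc_ge0.
by rewrite lte_mul_pinfty// lee_fin normc_ge0.
Qed.

Lemma csumD u v : abssum u -> abssum v ->
  csum (fun i => u i + v i) = csum u + csum v.
Proof.
move=> uo vo; rewrite /csum [RHS]/=.
congr (_ +i* _).
  rewrite -(rsumD (abssum_Re uo) (abssum_Re vo)).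
  by congr rsum; apply/funext => i; case: (u i); case: (v i).
rewrite -(rsumD (abssum_Im uo) (abssum_Im vo)).
by congr rsum; apply/funext => i; case: (u i); case: (v i).
Qed.

Lemma csumZ a u : abssum u -> csum (fun i => a * u i) = a * csum u.
Proof.
move=> uo; rewrite /csum [RHS]/=; case: a => a b /=.
have r c : (nsum (fun i => `|c * complex.Re (u i)|%R) < +oo)%E.
  have := abssum_Re (abssumZ c%:C uo); apply: le_lt_trans; apply: le_nsum => i /=.
  by rewrite ReZ.
have s c : (nsum (fun i => `|c * complex.Im (u i)|%R) < +oo)%E.
  have := abssum_Im (abssumZ c%:C uo); apply: le_lt_trans; apply: le_nsum => i /=.
  by case: (u i) => x y /=; rewrite mul0r addr0.
congr (_ +i* _).
  rewrite -(rsumZ a (abssum_Re uo)) -(rsumZ b (abssum_Im uo)) -rsumN -(rsumD (r a)).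
    by congr rsum; apply/funext => i; case: (u i).
  by have := s b; apply: le_lt_trans; apply: le_nsum => i /=; rewrite normrN.
rewrite -(rsumZ a (abssum_Im uo)) -(rsumZ b (abssum_Re uo)) -(rsumD (s a) (r b)).
by congr rsum; apply/funext => i; case: (u i).
Qed.

Lemma csum_conj u : csum (fun i => Num.conj (u i)) = Num.conj (csum u).
Proof.
rewrite conjcE /csum /=; congr (_ +i* _).
  by congr rsum; apply/funext => i; rewrite Rec_conj.
rewrite -rsumN; congr rsum; apply/funext => i; rewrite conjcE; by case: (u i).
Qed.

(** After rotation the modulus of the sum is the real part of a sum, and real parts are dominated by
    moduli term by term. *)
Lemma csum_le u : abssum u -> normc (csum u) <= fine (nsum (fun i => normc (u i))).
Proof.
move=> uo; have [a a1 aE] := unimodular (csum u).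
have -> : normc (csum u) = complex.Re (csum (fun i => a * u i)) by rewrite csumZ// aE.
have au := abssumZ a uo.
apply: le_trans (rsum_le (abssum_Re au)) _.
rewrite fine_le ?ge0_fin_numE ?nsum_ge0//; try by move=> i /=; rewrite ?normc_ge0.
- exact: abssum_Re.
- apply: le_nsum => i /=; apply: le_trans (ler_Re_normc _) _.
  by rewrite normcM a1 mul1r.
Qed.

Lemma abssum1 u i0 : (forall i, i != i0 -> u i = 0) -> abssum u.
Proof.
move=> us; rewrite /abssum (@nsum_supp1 _ i0) ?ltry//= ?normc_ge0// => i /us ->.
by rewrite normc0.
Qed.

Lemma csum1 u i0 : (forall i, i != i0 -> u i = 0) -> csum u = u i0.
Proof.
move=> us; suff H f : (forall i, i != i0 -> f i = 0) -> rsum f = f i0.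
  by rewrite /csum !H; [case: (u i0)|move=> i /us ->..].
move=> fs; have fo : (nsum (fun i => `|f i|%R) < +oo)%E.
  by rewrite (@nsum_supp1 _ i0) ?ltry//= ?normr_ge0// => i /fs ->; rewrite normr0.
have [g [h [gb hb fE [go ho ->]]]] := rsum_posneg fo.
have z (k : I -> R) : (forall i, 0 <= k i <= `|f i|) -> nsum k = (k i0)%:E.
  move=> kb; apply: nsum_supp1; first by case/andP: (kb i0).
  by move=> i /fs e; have := kb i; rewrite e normr0 => /andP[? ?]; apply/eqP; rewrite eq_le; apply/andP.
by rewrite !z//= fE.
Qed.

Lemma csum0 u : (forall i, u i = 0) -> csum u = 0.
Proof.
move=> u0; rewrite /csum; have r0 (f : I -> R) : (forall i, f i = 0) -> rsum f = 0.
  move=> f0; rewrite /rsum !esum1 ?subr0//= => i _.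
    by rewrite funenegE /= f0 oppr0 maxxx.
  by rewrite funeposE /= f0 maxxx.
by rewrite !r0// => i; rewrite u0.
Qed.

Lemma abssum0 u : (forall i, u i = 0) -> abssum u.
Proof.
move=> u0; rewrite /abssum /nsum esum1 ?ltry// => i _ /=.
by rewrite u0 normc0.
Qed.

Lemma eq_csum u v : (forall i, u i = v i) -> csum u = csum v.
Proof. by move=> uv; congr csum; apply/funext. Qed.

Lemma eq_abssum u v : (forall i, u i = v i) -> abssum u -> abssum v.
Proof. by move=> uv; rewrite (_ : u = v)//; apply/funext. Qed.

Lemma le_abssum u (f : I -> R) : (forall i, normc (u i) <= f i) -> (nsum f < +oo)%E -> abssum u.
Proof. by move=> uf; apply: le_lt_trans; apply: le_nsum. Qed.

Lemma abssum_sum (J : Type) (r : seq J) (P : pred J) (u : J -> I -> R[i]) :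
  (forall j, P j -> abssum (u j)) -> abssum (fun i => \sum_(j <- r | P j) u j i).
Proof.
move=> uo; elim: r => [|j r IH]; first by apply: abssum0 => i; rewrite big_nil.
case: (boolP (P j)) => Pj.
  by apply: eq_abssum (abssumD (uo j Pj) IH) => i; rewrite big_cons Pj.
by apply: eq_abssum IH => i; rewrite big_cons (negPf Pj).
Qed.

Lemma csum_sum (J : Type) (r : seq J) (P : pred J) (u : J -> I -> R[i]) :
  (forall j, P j -> abssum (u j)) ->
  csum (fun i => \sum_(j <- r | P j) u j i) = \sum_(j <- r | P j) csum (u j).
Proof.
move=> uo; elim: r => [|j r IH]; first by rewrite big_nil csum0// => i; rewrite big_nil.
rewrite big_cons -IH; case: (boolP (P j)) => Pj.
  rewrite -csumD//; [|exact: uo|exact: abssum_sum].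
  by apply: eq_csum => i; rewrite big_cons Pj.
by apply: eq_csum => i; rewrite big_cons (negPf Pj).
Qed.

End Sums.

(** * Sums over products, reindexing and tails *)

Section SumsProduct.
Context {R : realType}.

Lemma nsum_prod (I J : choiceType) (f : I * J -> R) : (forall k, 0 <= f k) ->
  nsum f = (\esum_(i in [set: I]) nsum (fun j => f (i, j)))%E.
Proof.
move=> f0; rewrite /nsum (esum_esum (a := fun i j => (f (i, j))%:E)); last first.
  by move=> *; rewrite lee_fin.
rewrite (_ : [set: I] `*`` _ = setT); last by apply/seteqP; split.
by apply: eq_esum => -[].
Qed.

Lemma nsum_reindex (I J : choiceType) (e : I -> J) (f : J -> R) : bijective e ->
  nsum f = nsum (f \o e).
Proof.
case=> d ed de; rewrite /nsum (@reindex_esum R I J setT setT e)//.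
split => //; first by move=> x y _ _; exact: (can_inj ed).
by move=> y _; exists (d y) => //; rewrite de.
Qed.

Lemma csum_reindex (I J : choiceType) (e : I -> J) (u : J -> R[i]) : bijective e ->
  csum u = csum (u \o e).
Proof.
case=> d ed de.
have H (f : J -> \bar R) : (\esum_(j in [set: J]) f j = \esum_(i in [set: I]) f (e i))%E.
  apply: reindex_esum; split => //; first by move=> x y _ _; exact: (can_inj ed).
  by move=> y _; exists (d y) => //; rewrite de.
have rH (f : J -> R) : rsum f = rsum (f \o e).
  rewrite /rsum !H; congr (fine _ - fine _); apply: eq_esum => i _.
    by rewrite !funeposE.
  by rewrite !funenegE.
by rewrite /csum !rH.
Qed.

Lemma nsum_prod_fin (I J : choiceType) (f : I * J -> R) : (forall k, 0 <= f k) ->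
  (nsum f < +oo)%E ->
  (forall i, nsum (fun j => f (i, j)) < +oo)%E /\
  nsum f = nsum (fun i => fine (nsum (fun j => f (i, j)))).
Proof.
move=> f0 fo; have H i : (nsum (fun j => f (i, j)) < +oo)%E.
  apply: le_lt_trans fo; rewrite nsum_prod//.
  apply: esum_ge; exists [set i]; first by split => //; exact: finite_set1.
  by rewrite fsbig_set1.
split => //; rewrite nsum_prod//; apply: eq_esum => i _.
by rewrite -nsum_fin.
Qed.

Lemma csum_prod (I J : choiceType) (u : I * J -> R[i]) : abssum u ->
  csum u = csum (fun i => csum (fun j => u (i, j))).
Proof.
move=> uo; have H (f : I * J -> R) : (nsum (fun i => `|f i|%R) < +oo)%E ->
    rsum f = rsum (fun i => rsum (fun j => f (i, j))).
  move=> fo; have [g [h [gb hb fE [go ho ->]]]] := rsum_posneg fo.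
  have g0 k : 0 <= g k by case/andP: (gb k).
  have h0 k : 0 <= h k by case/andP: (hb k).
  have [g1 g2] := nsum_prod_fin g0 go; have [h1 h2] := nsum_prod_fin h0 ho.
  rewrite g2 h2 -rsumB -?g2 -?h2// ?fE.
  - by congr rsum; apply/funext => i; rewrite -rsumB.
  - by move=> i; rewrite fine_ge0// nsum_ge0.
  - by move=> i; rewrite fine_ge0// nsum_ge0.
by rewrite /csum H ?H//; [exact: abssum_Im|exact: abssum_Re].
Qed.

(** Some finite set carries all but [e] of the sum; beyond any [N] above its elements less than [e]
    remains. *)
Lemma nsum_tail (c : nat -> R) : (forall n, 0 <= c n) -> (nsum c < +oo)%E ->
  forall e : R, 0 < e -> exists N, forall n, (N <= n)%N ->
  (nsum (fun k => if (n <= k)%N then c k else 0%R) < e%:E)%E.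
Proof.
move=> c0 co e e0; have cE := nsum_fin c0 co.
have : (nsum c - e%:E < nsum c)%E by rewrite cE -EFinB lte_fin gtrBl.
move=> /ereal_sup_gt[_ [A [Afin _] <-]] lt.
have [N NA] : exists N, forall k, A k -> (k < N)%N.
  exists (\max_(k <- enum_fset (fset_set A)) k).+1 => k Ak.
  rewrite ltnS; have kA : k \in enum_fset (fset_set A) by have := in_fset_set Afin k; rewrite mem_set.
  exact: (@leq_bigmax_seq _ _ xpredT id k kA isT).
exists N => n Nn; set t := nsum _.
have t0 : (0 <= t)%E by apply: nsum_ge0 => k; case: ifP.
have to : (t < +oo)%E by apply: le_lt_trans co; apply: le_nsum => k; case: ifP.
have : (\sum_(i \in A) (c i)%:E + t <= nsum c)%E.
  have -> : nsum c = (nsum (fun k => if (n <= k)%N then 0%R else c k) + t)%E.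
    rewrite -nsumD; try by move=> k; case: ifP.
    by apply: eq_nsum => k; case: ifP; rewrite ?addr0 ?add0r.
  rewrite leeD2r//; apply: esum_ge; exists A => //.
  apply: le_of_eq; apply: eq_fsbigr => k /[!inE] Ak.
  by rewrite ifF// leqNgt (leq_trans (NA k Ak) Nn).
move: lt; rewrite cE [t]nsum_fin//; last by move=> k; case: ifP.
rewrite fsbig_finite//= sumEFin -EFinB !lte_fin -EFinD lee_fin.
set a := \sum_(i <- _) _; rewrite -/t; move=> ? ?; lra.
Qed.

Lemma csum_nat_split (u : nat -> R[i]) N : abssum u ->
  csum u = \sum_(n < N) u n + csum (fun k => if (N <= k)%N then u k else 0).
Proof.
move=> uo; elim: N => [|N IH]; first by rewrite big_ord0 add0r.
rewrite big_ord_recr/= -addrA IH; congr (_ + _).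
pose v k := if k == N then u N else 0.
have vs k : k != N -> v k = 0 by rewrite /v => /negPf ->.
have -> : u N = csum v by rewrite (csum1 vs) /v eqxx.
rewrite -csumD.
- apply: eq_csum => k; rewrite /v leq_eqVlt eq_sym; case: eqVneq => [->|] /=.
    by rewrite ltnn addr0.
  by rewrite add0r.
- exact: abssum1 vs.
- apply: le_lt_trans uo; apply: le_nsum => k /=.
  by case: ifP; rewrite ?normc0 ?normc_ge0.
Qed.

Lemma csum_nat_tail (u : nat -> R[i]) (e : R) : abssum u -> 0 < e ->
  exists N, forall n, (N <= n)%N -> normc (csum u - \sum_(k < n) u k) < e.
Proof.
move=> uo e0.
have [N HN] := nsum_tail (fun n => normc_ge0 (u n)) uo e0.
exists N => n /HN lt; rewrite (csum_nat_split n uo) addrC addKr.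
set v := fun k => _; have vE : nsum (fun i => normc (v i)) = nsum (fun k => if (n <= k)%N then normc (u k) else 0).
  by apply: eq_nsum => k /=; rewrite /v; case: ifP; rewrite ?normc0.
have vo : abssum v by rewrite /abssum vE (lt_trans lt)// ltry.
apply: le_lt_trans (csum_le vo) _; rewrite -lte_fin -nsum_fin ?vE//.
  by move=> i; exact: normc_ge0.
by rewrite (lt_trans lt)// ltry.
Qed.

End SumsProduct.

(** * Hilbert spaces *)

Section HilbertGeometry.
Context {R : realType} (H : hilbert R).
Implicit Types (x y z : H) (a : R[i]).
Local Notation dot := (@hdot R H).
Local Notation N := (@hnorm R H).

Lemma hdotDl x y z : dot (x + y) z = dot x z + dot y z.
Proof. exact: linearDl. Qed.
Lemma hdotDr x y z : dot z (x + y) = dot z x + dot z y.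
Proof. exact: linearDr. Qed.
Lemma hdotNl x z : dot (- x) z = - dot x z.
Proof. exact: linearNl. Qed.
Lemma hdotNr x z : dot z (- x) = - dot z x.
Proof. exact: linearNr. Qed.
Lemma hdotBl x y z : dot (x - y) z = dot x z - dot y z.
Proof. by rewrite hdotDl hdotNl. Qed.
Lemma hdotBr x y z : dot z (x - y) = dot z x - dot z y.
Proof. by rewrite hdotDr hdotNr. Qed.
Lemma hdotZl a x z : dot (a *: x) z = a * dot x z.
Proof. exact: linearZl_LR. Qed.
Lemma hdotZr a x z : dot z (a *: x) = Num.conj a * dot z x.
Proof. exact: linearZr_LR. Qed.
Lemma hdot0l z : dot 0 z = 0.
Proof. exact: linear0l. Qed.
Lemma hdot0r z : dot z 0 = 0.
Proof. exact: linear0r. Qed.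
Lemma hdotC x y : dot x y = Num.conj (dot y x).
Proof. by rewrite {1}hermC/= expr0 mul1r. Qed.
Lemma hdot_suml (J : Type) (r : seq J) (P : pred J) (f : J -> H) z :
  dot (\sum_(j <- r | P j) f j) z = \sum_(j <- r | P j) dot (f j) z.
Proof. by elim/big_rec2: _ => [|j u v _ <-]; rewrite ?hdot0l ?hdotDl. Qed.

Lemma hdot_ge0 x : 0 <= dot x x.
Proof.
have [->|x0] := eqVneq x 0; first by rewrite hdot0l.
have := @neq0_dnorm_gt0 _ _ _ (@hdot R H) x x0; exact: ltW.
Qed.

Lemma hnorm_ge0 x : 0 <= N x.
Proof. exact: sqrtr_ge0. Qed.

Lemma Re_hdot_ge0 x : 0 <= complex.Re (dot x x).
Proof. by have := hdot_ge0 x; rewrite lecE => /andP[]. Qed.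

Lemma sqr_hnorm x : N x ^+ 2 = complex.Re (dot x x).
Proof. by rewrite sqr_sqrtr// Re_hdot_ge0. Qed.

Lemma hdotE x : dot x x = (N x ^+ 2)%:C.
Proof.
rewrite sqr_hnorm; have := hdot_ge0 x; rewrite lecE; case: (dot x x) => a b /=.
by move=> /andP[/eqP -> _].
Qed.

Lemma hnorm_eq0 x : (N x == 0) = (x == 0).
Proof.
apply/idP/idP => [/eqP e|/eqP ->]; last by rewrite -sqrf_eq0 sqr_hnorm hdot0l.
apply: contraT => x0; have := @neq0_dnorm_gt0 _ _ _ (@hdot R H) x x0.
by rewrite hdotE e expr0n/= ltxx.
Qed.

Lemma hnorm0 : N 0 = 0.
Proof. by apply/eqP; rewrite hnorm_eq0. Qed.

Lemma hnormZ a x : N (a *: x) = normc a * N x.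
Proof.
apply/eqP; rewrite -(@eqrXn2 _ 2)// ?mulr_ge0 ?hnorm_ge0 ?normc_ge0//.
apply/eqP/complexI.
rewrite -hdotE hdotZl hdotZr mulrA mulc_conj hdotE -rmorphM.
by rewrite exprMn.
Qed.

Lemma hnormN x : N (- x) = N x.
Proof. by rewrite -scaleN1r hnormZ normcN normc1 mul1r. Qed.

Lemma hnormB_sym x y : N (x - y) = N (y - x).
Proof. by rewrite -hnormN opprB. Qed.

Lemma sqr_hnormD x y :
  N (x + y) ^+ 2 = N x ^+ 2 + N y ^+ 2 + 2 * complex.Re (dot x y).
Proof.
rewrite !sqr_hnorm hdotDl !hdotDr !ReD (hdotC y x) Rec_conj; ring.
Qed.

Lemma sqr_hnormB x y :
  N (x - y) ^+ 2 = N x ^+ 2 + N y ^+ 2 - 2 * complex.Re (dot x y).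
Proof. by rewrite sqr_hnormD hnormN hdotNr ReN mulrN. Qed.

Lemma hparallelogram x y :
  N (x + y) ^+ 2 + N (x - y) ^+ 2 = 2 * (N x ^+ 2 + N y ^+ 2).
Proof. rewrite sqr_hnormD sqr_hnormB; ring. Qed.

Lemma hCauchySchwarz x y : normc (dot x y) <= N x * N y.
Proof.
have [->|y0] := eqVneq y 0; first by rewrite hdot0r hnorm0 mulr0 normc0.
have [u u1 uE] := unimodular (dot x y).
have ny : 0 < N y by rewrite lt_def hnorm_ge0 hnorm_eq0 y0.
(* The value of [t] that minimises the norm of [u *: x - t *: y]. *)
pose t := normc (dot x y) / N y ^+ 2.
have := sqr_ge0 (N (u *: x - t%:C *: y)).
rewrite sqr_hnormB !hnormZ u1 mul1r normc_real hdotZr hdotZl uE conjcE conjc_real.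
rewrite -rmorphM /= => h; rewrite -(ler_pXn2r (n := 2))// ?nnegrE ?mulr_ge0 ?hnorm_ge0 ?normc_ge0//.
rewrite ger0_norm in h; last by rewrite divr_ge0 ?normc_ge0 ?sqr_ge0.
rewrite exprMn /t in h; rewrite exprMn.
have n2 : N y ^+ 2 != 0 by rewrite expf_neq0// gt_eqF.
have -> : normc (dot x y) ^+ 2 =
   (N x ^+ 2 - (N x ^+ 2 + (normc (dot x y) / N y ^+ 2) ^+ 2 * N y ^+ 2 -
    2 * (normc (dot x y) / N y ^+ 2 * normc (dot x y)))) * N y ^+ 2.
  by field; rewrite gt_eqF.
by rewrite ler_pM2r ?exprn_gt0// gerBl.
Qed.

Lemma hnormD x y : N (x + y) <= N x + N y.
Proof.
rewrite -(ler_pXn2r (n := 2))// ?nnegrE ?addr_ge0 ?hnorm_ge0//.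
have le : complex.Re (dot x y) <= N x * N y.
  apply: le_trans (ler_norm _) _.
  exact: le_trans (ler_Re_normc _) (hCauchySchwarz _ _).
rewrite sqr_hnormD sqrrD; set p := N x * N y in le *; set q := N x ^+ 2; set r := N y ^+ 2.
lra.
Qed.

Lemma hnorm_tri x y z : N (x - z) <= N (x - y) + N (y - z).
Proof. by apply: le_trans (hnormD _ _); rewrite addrA subrK. Qed.

Lemma hdot_inj x y : (forall z, dot x z = dot y z) -> x = y.
Proof.
move=> e; apply/eqP; rewrite -subr_eq0 -hnorm_eq0 -sqrf_eq0 sqr_hnorm.
by rewrite hdotBl e subrr.
Qed.

Definition closed_subspace (M : set H) : Prop :=
  [/\ M 0, forall a x y, M x -> M y -> M (a *: x + y) &
      forall x, (forall e, 0 < e -> exists2 m, M m & N (x - m) < e) -> M x].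

Lemma closed_subspaceN M x : closed_subspace M -> M x -> M (- x).
Proof. by case=> M0 ML _ Mx; rewrite -scaleN1r -[X in M X]addr0; apply: ML. Qed.

Lemma closed_subspaceD M x y : closed_subspace M -> M x -> M y -> M (x + y).
Proof. by case=> M0 ML _ Mx My; rewrite -[x]scale1r; apply: ML. Qed.

(* A minimising sequence is Cauchy by the parallelogram law. *)
Lemma hproj_exists M x : closed_subspace M ->
  exists2 m, M m & forall y, M y -> dot (x - m) y = 0.
Proof.
move=> Mc; have [M0 ML Mcl] := Mc.
pose D := [set r : R | exists2 m, M m & r = N (x - m) ^+ 2].
have Dinf : has_inf D.
  split; first by exists (N (x - 0) ^+ 2), 0.
  by exists 0 => _ [m _ ->]; rewrite sqr_ge0.
pose d := inf D.
have dle m : M m -> d <= N (x - m) ^+ 2.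
  by move=> Mm; apply: ge_inf => //; [case: Dinf|exists m].
(* The midpoint of [m1] and [m2] lies in [M], so its squared distance to [x] is at least [d];
   doubling it in the parallelogram law produces the factor 4. *)
have mid m1 m2 : M m1 -> M m2 ->
    N (m1 - m2) ^+ 2 <= 2 * (N (x - m1) ^+ 2 + N (x - m2) ^+ 2) - 4 * d.
  move=> M1 M2; have := hparallelogram (x - m1) (x - m2).
  have -> : x - m1 - (x - m2) = m2 - m1 by rewrite opprB addrC addrA subrK.
  have -> : x - m1 + (x - m2) = 2%:R *: (x - 2%:R^-1 *: (m1 + m2)).
    rewrite scalerBr scalerA divff ?pnatr_eq0// scale1r scaler_nat mulr2n.
    by rewrite addrACA opprD.
  rewrite hnormZ exprMn (hnormB_sym m2) => <-.
  have -> : normc 2%:R ^+ 2 = 4 :> R.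
    have -> : 2%:R = (2%:R : R)%:C by rewrite rmorph_nat.
    rewrite normc_real ger0_norm//; ring.
  have Mm : M (2%:R^-1 *: (m1 + m2)).
    by rewrite -[X in M X]addr0; apply: ML => //; exact: closed_subspaceD.
  have := dle _ Mm; set q := N _ ^+ 2; set s := N (m1 - m2) ^+ 2; lra.
have seqP n : exists m, M m /\ N (x - m) ^+ 2 < d + n.+1%:R^-1.
  have n0 : (0 : R) < n.+1%:R^-1 by rewrite invr_gt0 ltr0n.
  have [_ [m Mm ->] lt] := inf_adherent n0 Dinf.
  by exists m.
have [u uP] := choice seqP.
have cau e : 0 < e -> exists k, forall m n, (k <= m)%N -> (k <= n)%N -> N (u m - u n) < e.
  move=> e0; have e2 : 0 < 4 / e ^+ 2 by rewrite divr_gt0 ?exprn_gt0.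
  exists (Num.bound (4 / e ^+ 2)) => m n km kn.
  rewrite -(ltr_pXn2r (n := 2))// ?nnegrE ?hnorm_ge0 ?ltW//.
  have [Mm lm] := uP m; have [Mn ln] := uP n.
  apply: le_lt_trans (mid _ _ Mm Mn) _.
  have b k : (Num.bound (4 / e ^+ 2) <= k)%N -> k.+1%:R^-1 < e ^+ 2 / 4.
    move=> lek; have := archi_boundP (ltW e2).
    move=> lt; rewrite -[X in _ < X]invf_div ltf_pV2 ?posrE ?ltr0n//.
    by apply: lt_le_trans lt _; rewrite ler_nat (leq_trans lek).
  have := b _ km; have := b _ kn; move: lm ln; set p := N _ ^+ 2; set q := N _ ^+ 2.
  set r := e ^+ 2; set s := _^-1; set t := _^-1; lra.
have [m mP] := hcomplete cau.
have Mm : M m.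
  apply: Mcl => e /mP[k /(_ k (leqnn k)) lt].
  by exists (u k); [case: (uP k)|rewrite hnormB_sym].
have md : N (x - m) ^+ 2 <= d.
  rewrite -[d]sqr_sqrtr; last first.
    by apply: lb_le_inf; [case: Dinf|move=> _ [? _ ->]; rewrite sqr_ge0].
  rewrite ler_pXn2r// ?nnegrE ?hnorm_ge0 ?sqrtr_ge0//.
  apply/ler_addgt0Pr => e e0.
  have e2 : 0 < e / 2 by rewrite divr_gt0.
  have [k kP] := mP _ e2.
  pose n := maxn k (Num.bound (4 / e ^+ 2)).
  have := kP n (leq_maxl _ _) => l1; have [_ l2] := uP n.
  apply: le_trans (hnorm_tri _ (u n) _) _.
  have lb : n.+1%:R^-1 < (e / 2) ^+ 2.
    have e3 : 0 < 4 / e ^+ 2 by rewrite divr_gt0 ?exprn_gt0.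
    have := archi_boundP (ltW e3) => lt.
    have -> : (e / 2) ^+ 2 = (4 / e ^+ 2)^-1 by rewrite invf_div expr_div_n -natrX.
    rewrite ltf_pV2 ?posrE ?ltr0n//.
    apply: lt_le_trans lt _; rewrite ler_nat; apply: leq_trans (leq_maxr k _) _.
    by rewrite leqnSn.
  have d0 : 0 <= d by apply: lb_le_inf; [case: Dinf|move=> _ [? _ ->]; rewrite sqr_ge0].
  have l3 : N (x - u n) <= Num.sqrt d + e / 2.
    rewrite -(ler_pXn2r (n := 2))// ?nnegrE ?hnorm_ge0 ?addr_ge0 ?sqrtr_ge0 ?(ltW e2)//.
    rewrite sqrrD (sqr_sqrtr d0).
    have s0 : 0 <= Num.sqrt d * (e / 2) by rewrite mulr_ge0 ?sqrtr_ge0 ?(ltW e2).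
    apply: ltW; apply: lt_le_trans l2 _; rewrite mulr2n.
    move: lb; set a := _^-1; set b := (e / 2) ^+ 2; set c := Num.sqrt d * _ in s0 *; lra.
  move: l1 l3; set a := N _; set b := N _; lra.
exists m => // y My.
have [u0 u1 uE] := unimodular (dot (x - m) y).
apply/eqP; rewrite -normc_eq0; set c := normc _ in uE *.
have [//|c0] := eqVneq c 0; exfalso.
have cp : 0 < c by rewrite lt_def c0 normc_ge0.
pose z := Num.conj u0 *: y.
have Mz : M z by rewrite -[X in M X]addr0; apply: ML.
have zE : complex.Re (dot (x - m) z) = c by rewrite hdotZr conjCK uE.
have nz : 0 < N z.
  rewrite lt_def hnorm_ge0 hnorm_eq0 andbT; apply/eqP => z0.
  by move: zE; rewrite z0 hdot0r/= => /esym/eqP; rewrite (negPf c0).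
(* Moving [m] by this multiple of [z] would lower the squared distance by [c^2 / ||z||^2], below the
   infimum. *)
pose t := c / N z ^+ 2.
have Mt : M (m + t%:C *: z) by rewrite addrC; apply: ML.
have := dle _ Mt; rewrite opprD addrA sqr_hnormB hnormZ hdotZr conjcE conjc_real ReZ zE.
rewrite normc_real exprMn real_normK ?num_real// => le.
have := le_trans md le; rewrite -addrA lerDl.
have -> : t ^+ 2 * N z ^+ 2 - 2 * (t * c) = - (c ^+ 2 / N z ^+ 2).
  by rewrite /t; field; rewrite gt_eqF.
by rewrite oppr_ge0 leNgt divr_gt0 ?exprn_gt0.
Qed.

(** Everything follows from the uniqueness of the decomposition into a part in [M] and a part
    orthogonal to [M]. It is kept as the last clause, since it will show that the projector commutes
    with a group action preserving [M]. *)
Lemma hprojector M : closed_subspace M -> exists P : H -> H,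
  [/\ forall x, M (P x), forall x, M x -> P x = x,
      forall a x y, P (a *: x + y) = a *: P x + P y,
      forall x y, dot (P x) y = dot x (P y) &
      [/\ forall x, N (P x) <= N x, forall x, (forall y, M y -> dot x y = 0) -> P x = 0 &
      forall x m, M m -> (forall y, M y -> dot (x - m) y = 0) -> P x = m]].
Proof.
move=> Mc; have [M0 ML Mcl] := Mc.
have ex x : exists m, M m /\ forall y, M y -> dot (x - m) y = 0.
  by have [m Mm mP] := hproj_exists x Mc; exists m.
have [P PP] := choice ex.
have PM x : M (P x) by case: (PP x).
have orth x y : M y -> dot (x - P x) y = 0 by case: (PP x) => _; exact.
have uniq x m : M m -> (forall y, M y -> dot (x - m) y = 0) -> P x = m.
  move=> Mm mo; apply/eqP; rewrite -subr_eq0 -hnorm_eq0 -sqrf_eq0 sqr_hnorm.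
  have Md : M (P x - m) by apply: closed_subspaceD => //; exact: closed_subspaceN.
  have -> : dot (P x - m) (P x - m) = dot (x - m) (P x - m) - dot (x - P x) (P x - m).
    by rewrite -hdotBl; congr (@hdot R H _ _); rewrite opprB [RHS]addrC addrA subrK.
  by rewrite mo// orth// subr0.
exists P; split => //.
- by move=> x Mx; apply: uniq => // y _; rewrite subrr hdot0l.
- move=> a x y; apply: uniq; first exact: ML.
  move=> z Mz; rewrite opprD addrACA -scalerBr hdotDl hdotZl !orth// mulr0 addr0 //.
- move=> x y; have e1 := orth x (P y) (PM y); have e2 := orth y (P x) (PM x).
  move: e1 e2; rewrite !hdotBl => /eqP; rewrite subr_eq0 => /eqP -> /eqP.
  by rewrite subr_eq0 => /eqP e; rewrite (hdotC _ y) e -hdotC.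
split => //.
  move=> x; have [->|p0] := eqVneq (P x) 0; first by rewrite hnorm0 hnorm_ge0.
  have np : 0 < N (P x) by rewrite lt_def hnorm_ge0 hnorm_eq0 p0.
  rewrite -(ler_pM2r np) -expr2 sqr_hnorm.
  have -> : dot (P x) (P x) = dot x (P x).
    by apply/esym/eqP; rewrite -subr_eq0 -hdotBl orth.
  apply: le_trans (le_trans (ler_Re_normc _) (hCauchySchwarz _ _)).
  exact: ler_norm.
by move=> x xo; apply: uniq => // y My; rewrite subr0 xo.
Qed.

Definition bounded_functional (phi : H -> R[i]) : Prop :=
  (forall a x y, phi (a *: x + y) = a * phi x + phi y) /\
  exists2 M, 0 <= M & forall x, normc (phi x) <= M * N x.

(** The representing vector spans the orthogonal complement of the kernel, which is closed because
    [phi] is bounded. *)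
Lemma riesz phi : bounded_functional phi -> exists y, forall x, phi x = dot x y.
Proof.
move=> [lin [M M0 bd]].
have phi0 : phi 0 = 0 by have := lin (-1) 0 0; rewrite scaler0 addr0 mulN1r addNr.
have phiB x y : phi (x - y) = phi x - phi y.
  by rewrite addrC -scaleN1r lin mulN1r addrC.
have Kc : closed_subspace [set x | phi x = 0].
  split => //=.
    by move=> a x y xk yk; rewrite lin xk yk mulr0 addr0.
  move=> x xP; apply/eqP; rewrite -normc_eq0; apply/eqP/le_anti.
  rewrite normc_ge0 andbT; apply/ler_addgt0Pr => e e0; rewrite add0r.
  have M1 : 0 < M + 1 by rewrite ltr_wpDl.
  have [m mk lt] := xP (e / (M + 1)) ltac:(by rewrite divr_gt0).
  have -> : phi x = phi (x - m) by rewrite phiB mk subr0.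
  apply: le_trans (bd _) _.
  apply: (@le_trans _ _ ((M + 1) * N (x - m))).
    by rewrite ler_wpM2r ?hnorm_ge0// lerDl.
  by rewrite -ler_pdivlMl// mulrC ltW.
have [ph|] := pselect (forall x, phi x = 0).
  by exists 0 => x; rewrite ph hdot0r.
move=> /existsNP[v /eqP pv].
have [m /= mk orth] := hproj_exists v Kc.
set z := v - m in orth.
have pz : phi z = phi v by rewrite phiB mk subr0.
have z0 : N z != 0.
  by rewrite hnorm_eq0; apply: contra pv => /eqP e; rewrite -pz e phi0.
(* The factor is forced by [x = z]; for general [x] the vector [x - (phi x / phi z) z] is in the
   kernel, hence orthogonal to [z]. *)
pose c : R[i] := phi z / dot z z; exists (Num.conj c *: z) => x.
have := orth (x - (phi x / phi z) *: z).
have -> : phi (x - (phi x / phi z) *: z) = 0.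
  by rewrite phiB -[_ *: z]addr0 lin phi0 addr0 divfK ?subrr// pz.
move=> /(_ erefl); rewrite hdotBr hdotZr => /eqP; rewrite subr_eq0 => /eqP e.
have dz : dot z z != 0.
  by rewrite hdotE -(rmorph0 (@real_complex R)) (inj_eq (@complexI R)) sqrf_eq0.
rewrite hdotZr conjK (hdotC x z) e rmorphM /= conjK -(hdotC z z) /c.
rewrite -pz in pv; move: pv dz; set p := phi z; set q := dot z z; set r := phi x => pv dz.
by field; rewrite pv.
Qed.

(* Lax-Milgram for [1 + k]: its range is closed and its orthogonal complement trivial. *)
Lemma posop_resolvent (k : H -> H) (M : R) :
  (forall a x y, k (a *: x + y) = a *: k x + k y) ->
  (forall x, N (k x) <= M * N x) -> (forall x y, dot (k x) y = dot x (k y)) ->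
  (forall x, 0 <= complex.Re (dot (k x) x)) ->
  forall b, exists x, x + k x = b.
Proof.
move=> lin bd sa pos b.
have k0 : k 0 = 0 by exact: linear_map0 lin.
have kB x y : k (x - y) = k x - k y by rewrite addrC -scaleN1r lin scaleN1r addrC.
(* Pairing [x + k x] with [x] and using positivity of [k]: [1 + k] is bounded below by 1, which
   makes preimages of a Cauchy sequence Cauchy. *)
have below x : N x <= N (x + k x).
  have [->|x0] := eqVneq x 0; first by rewrite hnorm0 hnorm_ge0.
  have nx : 0 < N x by rewrite lt_def hnorm_ge0 hnorm_eq0 x0.
  rewrite -(ler_pM2r nx) -expr2 sqr_hnorm.
  apply: le_trans (le_trans (ler_Re_normc _) (hCauchySchwarz (x + k x) x)).
  by apply: le_trans (ler_norm _); rewrite hdotDl ReD lerDl.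
have Mc : closed_subspace [set y | exists x, x + k x = y].
  split.
  - by exists 0; rewrite k0 addr0.
  - by move=> a _ _ [x <-] [y <-]; exists (a *: x + y); rewrite lin scalerDr addrACA.
  move=> y yP.
  have ap n : exists x, N (y - (x + k x)) < n.+1%:R^-1.
    by have [_ [x <-]] := yP n.+1%:R^-1 ltac:(by rewrite invr_gt0 ltr0n); exists x.
  have [u uP] := choice ap.
  have small e : 0 < e -> exists K, forall n, (K <= n)%N -> N (y - (u n + k (u n))) < e.
    move=> e0; exists (Num.bound e^-1) => n Kn; apply: lt_trans (uP n) _.
    rewrite invf_plt ?posrE ?ltr0n//; apply: lt_le_trans (archi_boundP _) _.
      by rewrite invr_ge0 ltW.
    by rewrite ler_nat leqW.
  have cau e : 0 < e -> exists K, forall m n, (K <= m)%N -> (K <= n)%N -> N (u m - u n) < e.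
    move=> e0; have [K KP] := small (e / 2) ltac:(by rewrite divr_gt0).
    exists K => m n /KP lm /KP ln; apply: le_lt_trans (below _) _.
    have -> : u m - u n + k (u m - u n) = (u m + k (u m)) - (u n + k (u n)).
      by rewrite kB opprD addrACA.
    apply: le_lt_trans (hnorm_tri _ y _) _; rewrite hnormB_sym.
    by rewrite (splitr e) ltrD.
  have [x xP] := hcomplete cau; exists x.
  apply/eqP; rewrite -subr_eq0 -hnorm_eq0; apply/eqP/le_anti; rewrite hnorm_ge0 andbT.
  apply/ler_addgt0Pr => e e0; rewrite add0r.
  have M1 : 0 < `|M| + 1 by rewrite ltr_wpDl.
  have [K1 P1] := small (e / 2) ltac:(by rewrite divr_gt0).
  have [K2 P2] := xP (e / 2 / (1 + (`|M| + 1))) ltac:(by rewrite !divr_gt0// addr_gt0).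
  set n := maxn K1 K2.
  have l1 := P1 n (leq_maxl _ _); have l2 := P2 n (leq_maxr _ _).
  apply: le_trans (hnorm_tri _ (u n + k (u n)) _) _.
  rewrite [X in _ <= X](splitr e); apply: lerD; last by rewrite hnormB_sym ltW.
  rewrite hnormB_sym opprD addrACA -kB.
  apply: le_trans (hnormD _ _) _.
  apply: (@le_trans _ _ ((1 + (`|M| + 1)) * N (u n - x))).
    rewrite mulrDl mul1r lerD2l; apply: le_trans (bd _) _.
    by rewrite ler_wpM2r ?hnorm_ge0// (le_trans (ler_norm _))// lerDl.
  have c0 : 0 < 1 + (`|M| + 1) by rewrite addr_gt0.
  have := ltW l2; rewrite (ler_pdivlMr _ _ c0) => h.
  by apply: le_trans h; rewrite mulrC.
have [m [x xm] orth] := hproj_exists b Mc.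
exists x; rewrite xm; apply/eqP; rewrite eq_sym -subr_eq0 -hnorm_eq0.
set z := b - m in orth *.
(* The residue [z] is orthogonal to its own image under [1 + k], so [||z||^2 + <k z, z> = 0] with
   both terms nonnegative. *)
have := orth (z + k z) ltac:(by exists z).
rewrite hdotDr => /(congr1 (@complex.Re R)); rewrite ReD -sqr_hnorm -sa => e.
by have := pos z; have := sqr_ge0 (N z); rewrite -sqrf_eq0 => ? ?; apply/eqP; lra.
Qed.

Lemma adjoint_exists (U : H -> H) : bounded_op N U ->
  exists V : H -> H, forall x y, dot (U x) y = dot x (V y).
Proof.
move=> [lin [M bd]].
suff H1 y : exists v, forall x, dot (U x) y = dot x v.
  by have [V VP] := choice H1; exists V => x y; exact: VP.
apply: riesz; split; first by move=> a x z; rewrite lin hdotDl hdotZl.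
exists (`|M| * N y); first by rewrite mulr_ge0 ?hnorm_ge0.
move=> x; apply: le_trans (hCauchySchwarz _ _) _.
rewrite mulrAC ler_wpM2r ?hnorm_ge0//; apply: le_trans (bd x) _.
by rewrite ler_wpM2r ?hnorm_ge0// ler_norm.
Qed.

End HilbertGeometry.

(** * Completeness of the real and complex numbers *)

Section CauchyReal.
Context {R : realType}.

Lemma csum_real (I : choiceType) (f : I -> R) : (forall i, 0 <= f i) -> (nsum f < +oo)%E ->
  csum (fun i => (f i)%:C) = (fine (nsum f))%:C.
Proof.
move=> f0 fo; rewrite /csum /=.
have z0 : nsum (fun _ : I => 0 : R) = 0%E by apply: esum1.
have -> : rsum f = fine (nsum f).
  transitivity (rsum (fun i => f i - 0)).
    by congr rsum; apply/funext => i; rewrite subr0.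
  by rewrite rsumB ?z0 ?ltry//= subr0.
have -> : rsum (fun _ : I => 0 : R) = 0; last by [].
transitivity (rsum (fun _ : I => 0 - 0 : R)).
  by congr rsum; apply/funext => i; rewrite subr0.
by rewrite rsumB ?z0 ?ltry//= subr0.
Qed.

(** The limit is obtained as the lower limit, the supremum of the eventual lower bounds. *)
Lemma cauchy_real (a : nat -> R) :
  (forall e : R, 0 < e -> exists k, forall m n, (k <= m)%N -> (k <= n)%N -> `|a m - a n| < e) ->
  exists l, forall e : R, 0 < e -> exists k, forall n, (k <= n)%N -> `|a n - l| < e.
Proof.
move=> cau; pose A := [set r : R | exists K, forall n, (K <= n)%N -> r <= a n].
have near (e : R) : 0 < e -> exists K, A (a K - e) /\
    forall n r, (K <= n)%N -> A r -> r <= a n + e.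
  move=> e0; have [K KP] := cau _ e0; exists K; split.
    exists K => n Kn; have := KP n K Kn (leqnn _); rewrite ltr_norml => /andP[h1 h2].
    by rewrite lerBlDr -lerBlDl; apply: ltW; move: h1 h2; lra.
  move=> n r Kn [K' K'P]; have := K'P _ (leq_maxr K K') => le.
  have := KP _ _ (leq_maxl K K') Kn; rewrite ltr_norml => /andP[h1 h2].
  by move: le h1 h2; set x := a _; lra.
have As : has_sup A.
  have [K [AK KP]] := near 1 ltr01; split; first by exists (a K - 1).
  by exists (a K + 1) => r Ar; exact: KP.
exists (sup A) => e e0; have e2 : 0 < e / 3 by rewrite divr_gt0.
have [K [AK KP]] := near _ e2; have [K' K'P] := cau _ e2.
exists (maxn K K') => n; rewrite geq_max => /andP[Kn K'n].
have l1 : sup A <= a n + e / 3 by apply: ge_sup => [|r Ar]; [case: As|exact: KP].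
have l2 : a n - e / 3 <= sup A.
  apply: ub_le_sup; first by case: As.
  exists K' => m K'm; have := K'P _ _ K'm K'n; rewrite ltr_norml => /andP[h1 h2]; lra.
rewrite ltr_norml; apply/andP; split; lra.
Qed.

Lemma cauchy_complex (a : nat -> R[i]) :
  (forall e : R, 0 < e -> exists k, forall m n, (k <= m)%N -> (k <= n)%N -> normc (a m - a n) < e) ->
  exists l, forall e : R, 0 < e -> exists k, forall n, (k <= n)%N -> normc (a n - l) < e.
Proof.
move=> cau.
have [l1 l1P] : exists l, forall e : R, 0 < e -> exists k, forall n, (k <= n)%N -> `|complex.Re (a n) - l| < e.
  apply: cauchy_real => e /cau[k kP]; exists k => m n km kn.
  by rewrite -ReB; apply: le_lt_trans (ler_Re_normc _) (kP _ _ km kn).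
have [l2 l2P] : exists l, forall e : R, 0 < e -> exists k, forall n, (k <= n)%N -> `|complex.Im (a n) - l| < e.
  apply: cauchy_real => e /cau[k kP]; exists k => m n km kn.
  have -> : complex.Im (a m) - complex.Im (a n) = complex.Im (a m - a n) by case: (a m); case: (a n).
  by apply: le_lt_trans (ler_Im_normc _) (kP _ _ km kn).
exists (l1 +i* l2) => e e0; have e2 : 0 < e / 2 by rewrite divr_gt0.
have [k1 k1P] := l1P _ e2; have [k2 k2P] := l2P _ e2.
exists (maxn k1 k2) => n; rewrite geq_max => /andP[/k1P h1 /k2P h2].
have -> : a n - (l1 +i* l2) = (complex.Re (a n) - l1)%:C + 'i%C * (complex.Im (a n) - l2)%:C.
  by case: (a n) => x y /=; apply/eqP; rewrite eq_complex /=; apply/andP; split; apply/eqP; ring.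
apply: le_lt_trans (le_normcD _ _) _; rewrite (splitr e) ltrD ?normc_real//.
rewrite normcM normc_real (_ : normc 'i%C = 1) ?mul1r//.
by rewrite /= expr0n expr1n add0r sqrtr1.
Qed.

End CauchyReal.

(** * The Hilbert space [l2] *)

Section L2Hilbert.
Context {R : realType} {I : choiceType}.
Local Notation L := (l2space R I).
Implicit Types (f g : L) (u v : I -> R[i]).

Definition sqsum u : \bar R := nsum (fun i => normc (u i) ^+ 2).

Lemma sqsum_ge0 u : (0 <= sqsum u)%E.
Proof. by apply: nsum_ge0 => i; rewrite sqr_ge0. Qed.

Lemma sqsum_fin u : (sqsum u < +oo)%E -> sqsum u = (fine (sqsum u))%:E.
Proof. by apply: nsum_fin => i; rewrite sqr_ge0. Qed.

Lemma l2space_fin f : (sqsum f < +oo)%E.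
Proof. by have /asboolP := l2valP f. Qed.

Lemma l2_pred_fin u : (sqsum u < +oo)%E -> u \in @l2_pred R I.
Proof. by move=> h; apply/asboolP. Qed.

Definition mkl2 u (h : (sqsum u < +oo)%E) : L := L2Space (l2_pred_fin h).

Lemma l2space_inj f g : (forall i, f i = g i) -> f = g.
Proof. by move=> fg; apply: val_inj; apply/funext. Qed.

Lemma l2addE f g i : (f + g) i = f i + g i. Proof. by []. Qed.

Lemma l2subE f g i : (f - g) i = f i - g i. Proof. by []. Qed.
Lemma l2scaleE a f i : (a *: f) i = a * f i. Proof. by []. Qed.
Lemma l2zeroE i : (0 : L) i = 0. Proof. by []. Qed.
Lemma l2sumE (J : Type) (r : seq J) (P : pred J) (F : J -> L) i :
  (\sum_(j <- r | P j) F j) i = \sum_(j <- r | P j) F j i.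
Proof. by elim/big_rec2: _ => // j u v _ <-. Qed.

Lemma sqr_l2norm f : (l2norm f ^+ 2)%:E = sqsum f.
Proof.
rewrite sqr_sqrtr; last exact: fine_ge0 (sqsum_ge0 f).
by rewrite (sqsum_fin (l2space_fin f)).
Qed.

Lemma abssumM u v : (sqsum u < +oo)%E -> (sqsum v < +oo)%E -> abssum (fun i => u i * v i).
Proof.
move=> uo vo; apply: (@le_abssum _ _ _ (fun i => normc (u i) ^+ 2 + normc (v i) ^+ 2)).
  move=> i; rewrite normcM; have := sqr_ge0 (normc (u i) - normc (v i)).
  have := sqr_ge0 (normc (u i)); have := sqr_ge0 (normc (v i)).
  rewrite sqrrB; set a := normc _; set b := normc _; rewrite mulr2n => *; lra.
by rewrite nsumD ?lte_add_pinfty// => i; rewrite sqr_ge0.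
Qed.

Lemma sqsum_conj u : sqsum (fun i => Num.conj (u i)) = sqsum u.
Proof. by apply: eq_nsum => i; rewrite normc_conj. Qed.

Lemma abssum_l2dot f g : abssum (fun i => f i * Num.conj (g i)).
Proof. by apply: abssumM; rewrite ?sqsum_conj l2space_fin. Qed.

Lemma l2dotPl a f g h : l2dot (a *: f + g) h = a * l2dot f h + l2dot g h.
Proof.
rewrite /l2dot -csumZ; last exact: abssum_l2dot.
rewrite -csumD; [|exact: abssumZ (abssum_l2dot _ _)|exact: abssum_l2dot].
by apply: eq_csum => i; rewrite l2addE l2scaleE mulrDl mulrA.
Qed.

Lemma l2dotC f g : l2dot f g = Num.conj (l2dot g f).
Proof.
rewrite /l2dot -csum_conj; apply: eq_csum => i.
by rewrite rmorphM /= conjK mulrC.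
Qed.

Lemma l2dotPr a f g h : l2dot h (a *: f + g) = Num.conj a * l2dot h f + l2dot h g.
Proof. by rewrite l2dotC l2dotPl rmorphD rmorphM /= -!l2dotC. Qed.

Lemma l2dotE f : l2dot f f = (l2norm f ^+ 2)%:C.
Proof.
rewrite /l2dot (eq_csum (v := fun i => (normc (f i) ^+ 2)%:C)).
  rewrite csum_real; [|by move=> i; rewrite sqr_ge0|exact: l2space_fin].
  congr (_ %:C); apply: EFin_inj; rewrite sqr_l2norm.
  by rewrite (sqsum_fin (l2space_fin f)).
by move=> i; rewrite mulc_conj.
Qed.

Lemma l2norm_ge0 f : 0 <= l2norm f.
Proof. exact: sqrtr_ge0. Qed.

Lemma ler_l2norm_term f i : normc (f i) <= l2norm f.
Proof.
rewrite -(ler_pXn2r (n := 2))// ?nnegrE ?normc_ge0 ?l2norm_ge0// -lee_fin sqr_l2norm.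
by apply: (nsum_ge_term (f := fun i => normc (f i) ^+ 2)) => j; rewrite sqr_ge0.
Qed.

Lemma l2norm_eq0 f : l2norm f = 0 -> f = 0.
Proof.
move=> f0; apply: l2space_inj => i; apply: eq0_normc; apply/le_anti.
by rewrite normc_ge0 andbT -f0 ler_l2norm_term.
Qed.

Lemma l2norm_le f (M : R) : 0 <= M ->
  (sqsum f <= (M ^+ 2)%:E)%E -> l2norm f <= M.
Proof.
by move=> M0; rewrite -sqr_l2norm lee_fin ler_pXn2r// nnegrE ?l2norm_ge0.
Qed.

Lemma l2dot_bilinear : bilinear_for *%R (Num.conj \; *%R) (@l2dot R I).
Proof.
by split => h a f g; [exact: l2dotPl|exact: l2dotPr].
Qed.

HB.instance Definition _ := bilinear_isBilinear.Build R[i] L L R[i] *%R (Num.conj \; *%R)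
  (@l2dot R I) l2dot_bilinear.

Lemma l2dot_herm (f g : L) : l2dot f g = (-1) ^+ false * Num.conj (l2dot g f).
Proof. by rewrite expr0 mul1r l2dotC. Qed.

HB.instance Definition _ := isHermitianSesquilinear.Build R[i] L false Num.conj (@l2dot R I) l2dot_herm.

Lemma l2dot_pos (f : L) : f != 0 -> 0 < l2dot f f.
Proof.
move=> f0; rewrite l2dotE ltcR exprn_gt0// lt_def l2norm_ge0 andbT.
by apply: contra f0 => /eqP/l2norm_eq0 ->.
Qed.

HB.instance Definition _ := isDotProduct.Build R[i] L (@l2dot R I) l2dot_pos.

Definition l2dot_form : {dot L for Num.conj} := @l2dot R I.

(** Coordinates are dominated by the norm, so coordinatewise limits exist. The Cauchy bound passes
    to the limit on each finite set of coordinates, and then to the whole sum, which is a supremum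
    over such sets. *)
Lemma l2complete (u : nat -> L) :
  (forall e : R, 0 < e -> exists k, forall m n, (k <= m)%N -> (k <= n)%N ->
     Num.sqrt (complex.Re (l2dot_form (u m - u n) (u m - u n))) < e) ->
  exists l, forall e : R, 0 < e -> exists k, forall n, (k <= n)%N ->
     Num.sqrt (complex.Re (l2dot_form (u n - l) (u n - l))) < e.
Proof.
have E f : Num.sqrt (complex.Re (l2dot_form f f)) = l2norm f.
  by rewrite (_ : l2dot_form f f = (l2norm f ^+ 2)%:C); [rewrite /= sqrtr_sqr ger0_norm ?l2norm_ge0|exact: l2dotE].
move=> cau.
have {}cau (e : R) : 0 < e -> exists k, forall m n, (k <= m)%N -> (k <= n)%N -> l2norm (u m - u n) < e.
  by move=> /cau[k kP]; exists k => m n km kn; rewrite -E kP.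
have lim i : exists l, forall e : R, 0 < e -> exists k, forall n, (k <= n)%N -> normc (u n i - l) < e.
  apply: cauchy_complex => e /cau[k kP]; exists k => m n km kn.
  exact: le_lt_trans (ler_l2norm_term _ _) (kP _ _ km kn).
have [l lP] := choice lim.
have key (e : R) : 0 < e -> exists k, forall n, (k <= n)%N ->
    (sqsum (fun i => (u n i - l i)%R) <= (e ^+ 2)%:E)%E.
  move=> e0; have [k kP] := cau _ e0; exists k => n kn.
  apply: nsum_le_seq => r ur; rewrite lee_fin.
  apply/ler_addgt0Pr => d d0.
  have approx i (d' : R) : 0 < d' -> exists K, forall m, (K <= m)%N ->
      normc (u n i - l i) ^+ 2 <= normc (u n i - u m i) ^+ 2 + d'.
    move=> d'0; set a := normc (u n i - l i).
    have a0 : 0 <= a by exact: normc_ge0.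
    have a1 : 0 < 2 * a + 1 by rewrite ltr_wpDl ?mulr_ge0.
    (* When [b < a], the factor [a + b] of [a^2 - b^2] is at most [2 * a + 1]; the added 1 keeps the
       divisor positive. *)
    have [K KP] := lP i (d' / (2 * a + 1)) ltac:(by rewrite divr_gt0).
    exists K => m /KP lt; set b := normc (u n i - u m i).
    have ab : a <= b + normc (u m i - l i).
      by apply: le_trans (le_normcD _ _); rewrite addrA subrK.
    have b0 : 0 <= b by exact: normc_ge0.
    rewrite ltr_pdivlMr// in lt; move: lt ab; set c := normc _ => lt ab.
    have c0 : 0 <= c by exact: normc_ge0.
    have [le|gt] := leP a b.
      by apply: (@le_trans _ _ (b ^+ 2)); rewrite ?lerDl ?(ltW d'0)// ler_pXn2r.
    rewrite -lerBlDl subr_sqr; apply: (@le_trans _ _ (c * (2 * a + 1))); last exact: ltW.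
    by apply: ler_pM; [rewrite subr_ge0 ltW|rewrite addr_ge0|rewrite lerBlDl|lra].
  have [K KP] : exists K, forall m, (K <= m)%N -> \sum_(i <- r) normc (u n i - l i) ^+ 2
      <= \sum_(i <- r) normc (u n i - u m i) ^+ 2 + d.
    elim: r {ur} d d0 => [d d0|i r IH d d0].
      by exists 0%N => m _; rewrite !big_nil add0r ltW.
    have d2 : 0 < d / 2 by rewrite divr_gt0.
    have [K1 P1] := IH _ d2; have [K2 P2] := approx i _ d2.
    exists (maxn K1 K2) => m; rewrite geq_max => /andP[/P1 h1 /P2 h2].
    by rewrite !big_cons [d in X in _ <= X]splitr addrACA lerD.
  have kK := leq_maxl k K; have := KP _ (leq_maxr k K).
  move=> /le_trans; apply; rewrite lerD2r.
  apply: (@le_trans _ _ (l2norm (u n - u (maxn k K)) ^+ 2)).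
    rewrite -lee_fin sqr_l2norm.
    by apply: (nsum_ge_seq (f := fun i => normc ((u n - u (maxn k K)) i) ^+ 2)) => // i; rewrite sqr_ge0.
  by rewrite ler_pXn2r ?nnegrE ?l2norm_ge0 ?(ltW e0)//; apply: ltW; exact: kP.
(* [l] is the difference of [u k] and of the square summable function [u k - l]. *)
have lo : (sqsum l < +oo)%E.
  have [k kP] := key 1 ltr01.
  have h : (sqsum (fun i => (u k i - l i)%R) < +oo)%E by apply: le_lt_trans (kP _ (leqnn k)) _; rewrite ltry.
  have := l2val (u k - mkl2 h); have := l2space_fin (u k - mkl2 h).
  rewrite (_ : l2val (u k - mkl2 h) = l)//.
  by apply/funext => i; rewrite l2subE /= opprB addrC subrK.
exists (mkl2 lo) => e e0; have e2 : 0 < e / 2 by rewrite divr_gt0.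
have [k kP] := key _ e2; exists k => n /kP h; rewrite E.
have hE : sqsum (u n - mkl2 lo) = sqsum (fun i => (u n i - l i)%R).
  by apply: eq_nsum => i; rewrite l2subE.
rewrite -hE in h; apply: le_lt_trans (l2norm_le (ltW e2) h) _.
by rewrite ltr_pdivrMr// ltr_pMr// ltr1n.
Qed.

Definition l2hilbert : hilbert R := @Hilbert R L l2dot_form l2complete.

Lemma l2normE f : l2norm f = @hnorm R l2hilbert f.
Proof.
rewrite /hnorm (_ : @hdot R l2hilbert f f = (l2norm f ^+ 2)%:C); last exact: l2dotE.
by rewrite /= sqrtr_sqr ger0_norm ?l2norm_ge0.
Qed.

Lemma hnorm_l2 : @hnorm R l2hilbert = @l2norm R I.
Proof. by apply/funext => f; rewrite l2normE. Qed.

Lemma l2normZ a f : l2norm (a *: f) = normc a * l2norm f.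
Proof. by rewrite !l2normE; exact: (@hnormZ R l2hilbert). Qed.

Lemma l2normN f : l2norm (- f) = l2norm f.
Proof. by rewrite !l2normE; exact: (@hnormN R l2hilbert). Qed.

Lemma l2normD f g : l2norm (f + g) <= l2norm f + l2norm g.
Proof. by rewrite !l2normE; exact: (@hnormD R l2hilbert). Qed.

Lemma l2norm0 : l2norm (0 : L) = 0.
Proof. by rewrite l2normE; exact: (@hnorm0 R l2hilbert). Qed.

Lemma l2CauchySchwarz f g : normc (l2dot f g) <= l2norm f * l2norm g.
Proof. by rewrite !l2normE; exact: (@hCauchySchwarz R l2hilbert). Qed.

Lemma l2dot_inj f g : (forall h, l2dot f h = l2dot g h) -> f = g.
Proof. exact: (@hdot_inj R l2hilbert). Qed.

Lemma l2dotDl f g h : l2dot (f + g) h = l2dot f h + l2dot g h.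
Proof. exact: (@hdotDl R l2hilbert). Qed.
Lemma l2dotZl a f h : l2dot (a *: f) h = a * l2dot f h.
Proof. exact: (@hdotZl R l2hilbert). Qed.
Lemma l2dotDr f g h : l2dot h (f + g) = l2dot h f + l2dot h g.
Proof. exact: (@hdotDr R l2hilbert). Qed.
Lemma l2dotZr a f h : l2dot h (a *: f) = Num.conj a * l2dot h f.
Proof. exact: (@hdotZr R l2hilbert). Qed.
Lemma l2dot0l (h : L) : l2dot (0 : L) h = 0.
Proof. exact: (@hdot0l R l2hilbert). Qed.
Lemma l2dot0r (h : L) : l2dot h (0 : L) = 0.
Proof. exact: (@hdot0r R l2hilbert). Qed.
Lemma l2dotBl f g h : l2dot (f - g) h = l2dot f h - l2dot g h.
Proof. exact: (@hdotBl R l2hilbert). Qed.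

Lemma l2dot_suml (J : Type) (r : seq J) (P : pred J) (F : J -> L) h :
  l2dot (\sum_(j <- r | P j) F j) h = \sum_(j <- r | P j) l2dot (F j) h.
Proof. exact: (@hdot_suml R l2hilbert). Qed.

Definition delta_fun (i j : I) : R[i] := (j == i)%:R.

Lemma sqsum_delta i : sqsum (delta_fun i) = 1%E.
Proof.
rewrite /sqsum (nsum_supp1 (i0 := i)) /delta_fun ?eqxx ?normc1 ?expr1n// => j /negPf ->.
by rewrite normc0 expr0n.
Qed.

Fact delta_fin i : (sqsum (delta_fun i) < +oo)%E.
Proof. by rewrite sqsum_delta ltry. Qed.

Definition l2delta i : L := mkl2 (delta_fin i).

Lemma l2deltaE i j : l2delta i j = (j == i)%:R.
Proof. by []. Qed.

Lemma l2norm_delta i : l2norm (l2delta i) = 1.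
Proof.
apply/eqP; rewrite -(@eqrXn2 _ 2)// ?l2norm_ge0// expr1n; apply/eqP/EFin_inj.
by rewrite sqr_l2norm sqsum_delta.
Qed.

Lemma l2dot_delta f i : l2dot f (l2delta i) = f i.
Proof.
rewrite /l2dot (csum1 (i0 := i)); first by rewrite l2deltaE eqxx rmorph1 mulr1.
by move=> j /negPf e; rewrite l2deltaE e rmorph0 mulr0.
Qed.

End L2Hilbert.

(** * Functions on a product as direct sums of copies of l2 *)

Section Amplification.
Context {R : realType} {J I : choiceType}.
Local Notation L := (l2space R I).
Local Notation K := (l2space R (J * I)%type).
Implicit Types (f g : L) (A B : K).

Lemma sqsum_prod (u : J * I -> R[i]) :
  sqsum u = (\esum_(j in [set: J]) sqsum (fun i => u (j, i)))%E.
Proof. by rewrite /sqsum nsum_prod// => k; rewrite sqr_ge0. Qed.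

Fact slice_fin A j : (sqsum (fun i => A (j, i)) < +oo)%E.
Proof. by case: (nsum_prod_fin (fun k => sqr_ge0 (normc (A k))) (l2space_fin A)) => h _; exact: h. Qed.

Definition slice A j : L := mkl2 (slice_fin A j).

Lemma sliceE A j i : slice A j i = A (j, i). Proof. by []. Qed.

Lemma sqr_l2norm_slices A : (l2norm A ^+ 2)%:E = nsum (fun j => l2norm (slice A j) ^+ 2).
Proof.
by rewrite sqr_l2norm sqsum_prod; apply: eq_esum => j _; rewrite sqr_l2norm.
Qed.

Lemma l2dot_slices A B : l2dot A B = csum (fun j => l2dot (slice A j) (slice B j)).
Proof. by rewrite /l2dot csum_prod//; exact: abssum_l2dot. Qed.

Definition stack_fun (xi : J -> L) (p : J * I) : R[i] := xi p.1 p.2.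

Lemma sqsum_stack xi : sqsum (stack_fun xi) = nsum (fun j => l2norm (xi j) ^+ 2).
Proof. by rewrite sqsum_prod; apply: eq_esum => j _; rewrite sqr_l2norm. Qed.

Lemma stack_fin xi : (nsum (fun j => (l2norm (xi j) ^+ 2)%R) < +oo)%E ->
  (sqsum (stack_fun xi) < +oo)%E.
Proof. by rewrite sqsum_stack. Qed.

Definition stack xi (h : (nsum (fun j => (l2norm (xi j) ^+ 2)%R) < +oo)%E) : K :=
  mkl2 (stack_fin h).

Lemma slice_stack xi h j : slice (@stack xi h) j = xi j.
Proof. exact: l2space_inj. Qed.

Lemma sliceP a A B j : slice (a *: A + B) j = a *: slice A j + slice B j.
Proof. by apply: l2space_inj => i; rewrite sliceE !l2addE !l2scaleE. Qed.

Lemma slice_sum (T : Type) (r : seq T) (P : pred T) (F : T -> K) j :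
  slice (\sum_(t <- r | P t) F t) j = \sum_(t <- r | P t) slice (F t) j.
Proof. by apply: l2space_inj => i; rewrite l2sumE sliceE l2sumE. Qed.

Lemma slice_inj A B : (forall j, slice A j = slice B j) -> A = B.
Proof.
by move=> AB; apply: l2space_inj => -[j i]; rewrite -!sliceE AB.
Qed.

Definition embed_fun j f : J -> L := fun k => if k == j then f else 0.

Fact embed_fin j f : (nsum (fun k => (l2norm (embed_fun j f k) ^+ 2)%R) < +oo)%E.
Proof.
rewrite (nsum_supp1 (i0 := j)) ?ltry ?sqr_ge0// => k /negPf e.
by rewrite /embed_fun e l2norm0 expr0n.
Qed.

Definition embed j f : K := stack (embed_fin j f).

Lemma slice_embed j f k : slice (embed j f) k = if k == j then f else 0.
Proof. exact: slice_stack. Qed.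

Lemma embedP j a f g : embed j (a *: f + g) = a *: embed j f + embed j g.
Proof.
apply: slice_inj => k; rewrite sliceP !slice_embed; case: ifP => // _.
by rewrite scaler0 addr0.
Qed.

Lemma l2norm_embed j f : l2norm (embed j f) = l2norm f.
Proof.
apply/eqP; rewrite -(@eqrXn2 _ 2)// ?l2norm_ge0//; apply/eqP/EFin_inj.
rewrite sqr_l2norm_slices (nsum_supp1 (i0 := j)) ?sqr_ge0 ?slice_embed ?eqxx// => k /negPf e.
by rewrite slice_embed e l2norm0 expr0n.
Qed.

Lemma l2dot_embed j f B : l2dot (embed j f) B = l2dot f (slice B j).
Proof.
rewrite l2dot_slices (csum1 (i0 := j)) ?slice_embed ?eqxx// => k /negPf e.
by rewrite slice_embed e l2dot0l.
Qed.

Lemma l2norm_slice A j : l2norm (slice A j) <= l2norm A.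
Proof.
rewrite -(ler_pXn2r (n := 2))// ?nnegrE ?l2norm_ge0// -lee_fin sqr_l2norm_slices.
by apply: (nsum_ge_term (f := fun j => l2norm (slice A j) ^+ 2)) => k; rewrite sqr_ge0.
Qed.

End Amplification.

(** * Normal functionals on the group von Neumann algebra *)

Section GroupVN.
Context {R : realType} {G : groupType}.
Local Notation L := (l2space R G).
Local Notation N := (@l2norm R G).
Implicit Types (f g : L) (T U : L -> L) (s t : G).

Lemma lregE s f t : lreg s f t = f (s^-1 * t)%g. Proof. by []. Qed.

Lemma lreg_linear s a f g : lreg s (a *: f + g) = a *: lreg s f + lreg s g.
Proof. by apply: l2space_inj => t; rewrite !l2addE !l2scaleE. Qed.

Lemma lreg_mul s t f : lreg s (lreg t f) = lreg (s * t)%g f.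
Proof. by apply: l2space_inj => r; rewrite !lregE invgM mulgA. Qed.

Lemma lreg_id f : lreg 1%g f = f.
Proof. by apply: l2space_inj => r; rewrite lregE invg1 mul1g. Qed.

Lemma lmul_bij s : bijective (fun t : G => (s^-1 * t)%g).
Proof. by exists (fun t => (s * t)%g) => t; rewrite ?mulgA ?mulgV ?mulVg ?mul1g// mulKg. Qed.

Lemma rmul_bij s : bijective (fun t : G => (t * s)%g).
Proof. by exists (fun t => (t * s^-1)%g) => t; rewrite -mulgA ?mulgV ?mulVg mulg1. Qed.

Lemma l2norm_eq_sqsum (I I' : choiceType) (f : l2space R I) (g : l2space R I') :
  sqsum f = sqsum g -> l2norm f = l2norm g.
Proof.
move=> e; apply/eqP; rewrite -(@eqrXn2 _ 2)// ?l2norm_ge0//; apply/eqP/EFin_inj.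
by rewrite !sqr_l2norm.
Qed.

Lemma l2norm_lreg s f : N (lreg s f) = N f.
Proof. by apply: l2norm_eq_sqsum; rewrite /sqsum [RHS](nsum_reindex _ (lmul_bij s)). Qed.

Lemma l2dot_lreg s f g : l2dot (lreg s f) (lreg s g) = l2dot f g.
Proof. by rewrite /l2dot [RHS](csum_reindex _ (lmul_bij s)). Qed.

Lemma l2dot_lregV s f g : l2dot (lreg s f) g = l2dot f (lreg s^-1 g).
Proof. by rewrite -(l2dot_lreg s^-1) lreg_mul mulVg lreg_id. Qed.

Fact rreg_fin s f : (sqsum (fun t => f (t * s)%g) < +oo)%E.
Proof. by rewrite /sqsum -(nsum_reindex (fun t => normc (f t) ^+ 2) (rmul_bij s)) l2space_fin. Qed.

Definition rreg s f : L := mkl2 (rreg_fin s f).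

Lemma rregE s f t : rreg s f t = f (t * s)%g. Proof. by []. Qed.

Lemma l2norm_rreg s f : N (rreg s f) = N f.
Proof. by apply: l2norm_eq_sqsum; rewrite /sqsum [RHS](nsum_reindex _ (rmul_bij s)). Qed.

Lemma lreg_bounded s : bounded_op N (lreg s).
Proof.
split; first by move=> a f g; exact: lreg_linear.
by exists 1 => f; rewrite l2norm_lreg mul1r.
Qed.

Lemma rreg_commutant s : commutant N (range (@lreg R G)) (rreg s).
Proof.
split.
  split; first by move=> a f g; apply: l2space_inj => t; rewrite !l2addE !l2scaleE.
  by exists 1 => f; rewrite l2norm_rreg mul1r.
move=> _ [t _ <-]; apply/funext => f; apply: l2space_inj => r.
by rewrite [LHS]/= [RHS]/= mulgA.
Qed.

Lemma VN_lreg s : VN (@lreg R G s).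
Proof.
split; first exact: lreg_bounded.
by move=> U [_ UC]; rewrite UC//; exists s.
Qed.

Lemma VN_linear T : VN T -> forall a f g, T (a *: f + g) = a *: T f + T g.
Proof. by case=> -[lin _] _ a f g; rewrite lin. Qed.

Lemma VN_bound T : VN T -> exists2 M, 0 <= M & forall f, N (T f) <= M * N f.
Proof.
case=> -[_ [M MP]] _; exists `|M| => // f; apply: le_trans (MP f) _.
by rewrite ler_wpM2r ?l2norm_ge0// ler_norm.
Qed.

Lemma VN_comm T U : VN T -> commutant N (range (@lreg R G)) U -> forall f, T (U f) = U (T f).
Proof. by case=> _ TC UC f; have /(congr1 (fun F => F f)) := TC _ UC. Qed.

Lemma funPE (V W : lmodType R[i]) (F1 F2 : V -> W) a x : (a *: F1 + F2) x = a *: F1 x + F2 x.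
Proof. by []. Qed.

Lemma bounded_opP a T U : bounded_op N T -> bounded_op N U -> bounded_op N (a *: T + U).
Proof.
move=> [Tl [M MP]] [Ul [M' MP']]; split.
  move=> b f g; rewrite !funPE Tl Ul.
  rewrite !scalerDr !scalerA mulrC -!scalerA !addrA; congr (_ + _); rewrite -!addrA; congr (_ + _).
  by rewrite addrC.
exists (normc a * M + M') => f; apply: le_trans (l2normD _ _) _.
rewrite l2normZ mulrDl -mulrA lerD// ler_wpM2l ?normc_ge0//.
Qed.

Lemma VN_P a T U : VN T -> VN U -> VN (a *: T + U).
Proof.
move=> VT VU; have [bT cT] := VT; have [bU cU] := VU.
split; first exact: bounded_opP.
move=> V VC; have [[Vl _] _] := VC; apply/funext => f /=.
by rewrite funPE [in RHS]funPE Vl (VN_comm VT VC) (VN_comm VU VC).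
Qed.

Lemma VN_0 : VN (0 : L -> L).
Proof.
have := VN_P (-1) (VN_lreg 1%g) (VN_lreg 1%g).
by rewrite scaleN1r addNr.
Qed.

Lemma VN_Z a T : VN T -> VN (a *: T).
Proof. by move=> VT; rewrite -[X in VN X]addr0; apply: VN_P => //; exact: VN_0. Qed.

Lemma l2delta_rreg t : l2delta t = rreg t^-1 (l2delta 1%g) :> L.
Proof.
apply: l2space_inj => r; rewrite rregE !l2deltaE; congr (_%:R); congr nat_of_bool.
by rewrite -(inj_eq (mulIg (t^-1)%g)) mulgV.
Qed.

Lemma lreg_delta s t : lreg s (l2delta t) = l2delta (s * t)%g :> L.
Proof.
apply: l2space_inj => r; rewrite lregE !l2deltaE; congr (_%:R); congr nat_of_bool.
by rewrite -(inj_eq (mulgI s)) mulgA mulgV mul1g.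
Qed.

(** [T] commutes with right translations, and [delta_t] is a right translate of [delta_1]. Thus [T]
    is determined on point masses by the single vector [T delta_1]. *)
Lemma VN_delta T s t : VN T -> T (l2delta t) s = T (l2delta 1%g) (s * t^-1)%g.
Proof.
by move=> VT; rewrite l2delta_rreg (VN_comm VT (rreg_commutant _)).
Qed.

Definition l2seq (xi : nat -> L) := (nsum (fun n => (N (xi n) ^+ 2)%R) < +oo)%E.

Definition vecstate (xi eta : nat -> L) T : R[i] := csum (fun n => l2dot (T (xi n)) (eta n)).

Lemma abssum_vecstate xi eta T : l2seq xi -> l2seq eta -> bounded_op N T ->
  abssum (fun n => l2dot (T (xi n)) (eta n)).
Proof.
move=> xo eo [_ [M MP]]; apply: (@le_abssum _ _ _ (fun n => `|M| * (N (xi n) ^+ 2 + N (eta n) ^+ 2))).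
  move=> n; apply: le_trans (l2CauchySchwarz _ _) _.
  apply: (@le_trans _ _ (`|M| * (N (xi n) * N (eta n)))).
    rewrite mulrA ler_wpM2r ?l2norm_ge0//; apply: le_trans (MP _) _.
    by rewrite ler_wpM2r ?l2norm_ge0// ler_norm.
  rewrite ler_wpM2l//; have := sqr_ge0 (N (xi n) - N (eta n)).
  have := sqr_ge0 (N (xi n)); have := sqr_ge0 (N (eta n)).
  rewrite sqrrB; set a := N _; set b := N _; rewrite mulr2n => *; lra.
rewrite nsumZ//; last by move=> n; rewrite addr_ge0 ?sqr_ge0.
by rewrite nsumD ?lte_mul_pinfty ?adde_ge0 ?nsum_ge0 ?lte_add_pinfty// => n; rewrite sqr_ge0.
Qed.

Definition amp_fun s (A : l2space R (nat * G)%type) (p : nat * G) : R[i] := A (p.1, s^-1 * p.2)%g.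

Lemma amp_bij s : bijective (fun p : nat * G => (p.1, s^-1 * p.2)%g).
Proof.
have [d d1 d2] := lmul_bij s; exists (fun p => (p.1, d p.2)) => -[n g] /=.
  by rewrite d1.
by rewrite d2.
Qed.

Fact amp_fin s A : (sqsum (amp_fun s A) < +oo)%E.
Proof.
by rewrite /sqsum -(nsum_reindex (fun p => normc (A p) ^+ 2) (amp_bij s)) l2space_fin.
Qed.

Definition amp s A : l2space R (nat * G)%type := mkl2 (amp_fin s A).

Lemma slice_amp s A n : slice (amp s A) n = lreg s (slice A n).
Proof. exact: l2space_inj. Qed.

Lemma ampP s a A B : amp s (a *: A + B) = a *: amp s A + amp s B.
Proof. by apply: slice_inj => n; rewrite sliceP !slice_amp sliceP lreg_linear. Qed.

Lemma amp_mul s t A : amp s (amp t A) = amp (s * t)%g A.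
Proof. by apply: slice_inj => n; rewrite !slice_amp lreg_mul. Qed.

Lemma amp1 A : amp 1%g A = A.
Proof. by apply: slice_inj => n; rewrite slice_amp lreg_id. Qed.

Lemma l2dot_ampV s A B : l2dot (amp s A) B = l2dot A (amp s^-1 B).
Proof.
rewrite !l2dot_slices; apply: eq_csum => n.
by rewrite !slice_amp l2dot_lregV.
Qed.

(* Double commutant argument in [l2 (nat * G)]: the projection [P] onto the
   orthogonal complement of the orbit of [xi] commutes with the amplified
   regular representation, so its matrix entries commute with [T]. *)
Lemma vecstate_VN0 xi eta : l2seq xi -> l2seq eta ->
  (forall s, vecstate xi eta (lreg s) = 0) -> forall T, VN T -> vecstate xi eta T = 0.
Proof.
move=> xo eo v0 T VT; pose X := stack xo; pose Y := stack eo.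
pose H := @l2hilbert R (nat * G)%type.
pose M : set H := [set B | forall s, l2dot (amp s X) B = 0].
have MY : M Y.
  move=> s; rewrite l2dot_slices -[RHS](v0 s); apply: eq_csum => n.
  by rewrite slice_amp !slice_stack.
have Mc : closed_subspace M.
  split.
  - by move=> s; rewrite l2dot0r.
  - by move=> a A B MA MB s; rewrite l2dotDr l2dotZr MA MB mulr0 addr0.
  move=> A AP s; apply/eqP; rewrite -normc_eq0; apply/eqP/le_anti; rewrite normc_ge0 andbT.
  apply/ler_addgt0Pr => e e0; rewrite add0r.
  have c0 : 0 < l2norm X + 1 by rewrite ltr_wpDl ?l2norm_ge0.
  have [B MB lt] := AP (e / (l2norm X + 1)) ltac:(by rewrite divr_gt0).
  rewrite -[A](subrK B) l2dotDr MB addr0; apply: le_trans (l2CauchySchwarz _ _) _.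
  have -> : l2norm (amp s X) = l2norm X.
    by apply: l2norm_eq_sqsum; rewrite /sqsum [RHS](nsum_reindex _ (amp_bij s)).
  rewrite hnorm_l2 ltr_pdivlMr// in lt.
  apply: ltW; apply: le_lt_trans lt; rewrite mulrC ler_wpM2l ?l2norm_ge0//.
  by rewrite lerDl.
have [P [PM PK Plin Psa [Pcon P0 Puniq]]] := hprojector Mc.
have PX : P X = 0.
  apply: P0 => B MB; have := MB 1%g; by rewrite amp1.
have MA s B : M B -> M (amp s B).
  by move=> MB t; rewrite -[s]invgK -l2dot_ampV amp_mul MB.
have Pamp s A : P (amp s A) = amp s (P A).
  apply: Puniq; first exact: MA.
  move=> B MB; have -> : amp s A - amp s (P A) = amp s (A - P A).
    by rewrite [in RHS]addrC -scaleN1r ampP scaleN1r addrC.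
  have := l2dot_ampV s (A - P A) B => /= ->.
  have Q : P (A - P A) = 0.
    by rewrite addrC -scaleN1r Plin scaleN1r PK// addNr.
  have := Psa (A - P A) (amp s^-1 B); rewrite Q hdot0l (PK _ (MA (s^-1)%g B MB)).
  exact: esym.
pose p m n f := slice (P (embed n f)) m.
have pC m n : commutant N (range (@lreg R G)) (p m n).
  split.
    split; first by move=> a f g; rewrite /p embedP Plin sliceP.
    exists 1 => f; rewrite mul1r; apply: le_trans (l2norm_slice _ _) _.
    by have := Pcon (embed n f); rewrite !hnorm_l2 l2norm_embed.
  move=> _ [s _ <-]; apply/funext => f /=; rewrite /p.
  have -> : embed n (lreg s f) = amp s (embed n f).
    apply: slice_inj => k; rewrite slice_amp !slice_embed; case: ifP => // _.
    by apply: l2space_inj => t; rewrite lregE !l2zeroE.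
  by rewrite Pamp slice_amp.
have [C C0 CP] := VN_bound VT.
have Tsum := @linear_map_sum _ _ _ T (VN_linear VT).
have Psum := @linear_map_sum _ _ _ P Plin.
(* Truncation keeps the amplification of [T] a finite sum, so that only its linearity is needed to
   move it past the entries of [P]. *)
pose S n : l2space R (nat * G)%type := \sum_(k < n) embed (k : nat) (T (xi k)).
pose X_ n : l2space R (nat * G)%type := \sum_(k < n) embed (k : nat) (xi k).
have PS n m : slice (P (S n)) m = T (slice (P (X_ n)) m).
  rewrite !Psum !slice_sum Tsum; apply: eq_bigr => k _.
  by rewrite -/(p m k _) -/(p m k _) (VN_comm VT (pC m k)).
(* Here [P X = 0] enters: [P (X_ n) = P (X_ n - X)], which tends to 0. *)
have PSb n : l2norm (P (S n)) <= C * l2norm (X_ n - X).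
  apply: (@le_trans _ _ (C * l2norm (P (X_ n)))); last first.
    rewrite ler_wpM2l//; have -> : P (X_ n) = P (X_ n - X).
      by rewrite [in RHS]addrC -scaleN1r Plin PX scaler0 add0r.
    by have := Pcon (X_ n - X); rewrite !hnorm_l2.
  apply: l2norm_le; first by rewrite mulr_ge0 ?l2norm_ge0.
  rewrite -sqr_l2norm sqr_l2norm_slices exprMn EFinM sqr_l2norm_slices.
  rewrite -nsumZ ?sqr_ge0//; last by move=> k; rewrite sqr_ge0.
  by apply: le_nsum => k; rewrite PS -exprMn ler_pXn2r// nnegrE ?mulr_ge0 ?l2norm_ge0.
have dS n : \sum_(k < n) l2dot (T (xi k)) (eta k) = l2dot (P (S n)) Y.
  have e := Psa (S n) Y; rewrite (PK _ MY) in e.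
  transitivity (l2dot (S n) Y); last exact: esym e.
  by rewrite l2dot_suml; apply: eq_bigr => k _; rewrite l2dot_embed slice_stack.
have tail n : (l2norm (X_ n - X) ^+ 2)%:E = nsum (fun k => if (n <= k)%N then N (xi k) ^+ 2 else 0).
  rewrite sqr_l2norm_slices; apply: eq_nsum => k.
  have -> : slice (X_ n - X) k = if (n <= k)%N then - xi k else 0.
    rewrite addrC -scaleN1r sliceP slice_stack scaleN1r slice_sum.
    case: ltnP => [kn|nk].
      rewrite (bigD1 (Ordinal kn))//= slice_embed eqxx big1 ?addr0 ?addNr//.
      by move=> j jn; rewrite slice_embed ifF//; apply: contra_neqF jn => /eqP e; exact: val_inj.
    rewrite big1 ?addr0// => j _; rewrite slice_embed ifF//.
    by apply/negbTE; rewrite neq_ltn (leq_trans (ltn_ord j) nk) orbT.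
  by case: ifP => _; rewrite ?l2normN// l2norm0 expr0n.
apply/eqP; rewrite -normc_eq0; apply/eqP/le_anti; rewrite normc_ge0 andbT.
apply/ler_addgt0Pr => e e0; rewrite add0r.
have e2 : 0 < e / 2 by rewrite divr_gt0.
have [n1 n1P] := csum_nat_tail (abssum_vecstate xo eo VT.1) e2.
have D0 : 0 < C * l2norm Y + 1 by rewrite ltr_wpDl ?mulr_ge0 ?l2norm_ge0.
have d0 : 0 < (e / 2 / (C * l2norm Y + 1)) ^+ 2 by rewrite exprn_gt0 ?divr_gt0.
have [n2 n2P] := nsum_tail (fun k => sqr_ge0 (N (xi k))) xo d0.
pose n := maxn n1 n2.
have h1 := n1P n (leq_maxl _ _); have := n2P n (leq_maxr _ _).
have q0 : 0 <= e / 2 / (C * l2norm Y + 1) by rewrite divr_ge0// ltW.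
rewrite -tail lte_fin ltr_pXn2r ?nnegrE ?l2norm_ge0// => h2.
rewrite dS in h1.
rewrite -[vecstate _ _ _](subrK (l2dot (P (S n)) Y)).
apply: le_trans (le_normcD _ _) _; rewrite [X in _ <= X](splitr e) lerD ?ltW//.
apply: le_lt_trans (l2CauchySchwarz _ _) _.
apply: (@le_lt_trans _ _ (l2norm (X_ n - X) * (C * l2norm Y))).
  by rewrite mulrCA mulrA ler_wpM2r ?l2norm_ge0.
rewrite ltr_pdivlMr// in h2; apply: le_lt_trans h2.
by rewrite ler_wpM2l ?l2norm_ge0// lerDl.
Qed.

End GroupVN.

(** * The Hahn-Banach theorem for a sublinear functional on a subspace *)

Section HahnBanach.
Context {R : realType} {V : lmodType R[i]}.
Variables (W : set V) (p : V -> R).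
Hypothesis WP : forall a x y, W x -> W y -> W (a *: x + y).
Hypothesis p_sub : forall x y, W x -> W y -> p (x + y) <= p x + p y.
Hypothesis p_hom : forall (r : R) x, 0 < r -> W x -> p (r%:C *: x) = r * p x.

Let W0 x : W x -> W 0.
Proof. by move=> Wx; have := WP (-1) Wx Wx; rewrite scaleN1r addNr. Qed.

Let WZ a x : W x -> W (a *: x).
Proof. by move=> Wx; rewrite -[_ *: _]addr0; apply: WP => //; exact: W0 Wx. Qed.

Let WD x y : W x -> W y -> W (x + y).
Proof. by move=> Wx Wy; rewrite -[x]scale1r; exact: WP. Qed.

Let p0 x : W x -> p 0 = 0.
Proof.
move=> Wx; have := @p_hom 2 0 ltac:(by []) (W0 Wx); rewrite scaler0.
by move=> ?; lra.
Qed.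

(** Partial real-linear functionals below [p] are represented by their graphs, so that a chain has
    its union as upper bound. Single-valuedness is not imposed, as it follows from domination. *)
Let dominated (g : set (V * R)) : Prop :=
  (forall x a, g (x, a) -> W x /\ a <= p x) /\
  (forall (r : R) x a y b, g (x, a) -> g (y, b) -> g (r%:C *: x + y, r * a + b)).

Let dominated0 g x a : dominated g -> g (x, a) -> g (0, 0).
Proof.
move=> [_ gl] gx; have := gl (-1) _ _ _ _ gx gx.
by rewrite rmorphN rmorph1 scaleN1r addNr mulN1r addNr.
Qed.

(** Two values at [x] put their difference and its opposite over 0 in the graph, and [p 0 = 0]. *)
Let dominated_fun g x a b : dominated g -> g (x, a) -> g (x, b) -> a = b.
Proof.
move=> [gd gl] ga gb.
have := gl (-1) _ _ _ _ ga gb; have := gl (-1) _ _ _ _ gb ga.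
rewrite rmorphN rmorph1 scaleN1r addNr !mulN1r => /gd[W00 h1] /gd[_ h2].
by move: h1 h2; rewrite (p0 W00) => ? ?; lra.
Qed.

(** The value at [v] is the supremum [c] of the lower bounds [b - p (x - v)]; sublinearity places
    all of them below every upper bound [p (y + v) - b]. Scaling reduces domination at [x + r v] to
    these two bounds, according to the sign of [r]. *)
Let extension g u a v : dominated g -> g (u, a) -> W v ->
  exists g' c, [/\ dominated g', g `<=` g' & g' (v, c)].
Proof.
move=> gD gu Wv; have [gd gl] := gD; have g00 := dominated0 gD gu.
have gZ (r : R) x b : g (x, b) -> g (r%:C *: x, r * b).
  by move=> gx; have := gl r _ _ _ _ gx g00; rewrite !addr0.
pose A := [set d | exists x b, g (x, b) /\ d = b - p (x - v)].
have AB y b : g (y, b) -> forall d, A d -> d <= p (y + v) - b.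
  move=> gy d [x [b' [gx ->]]]; have [Wx _] := gd _ _ gx; have [Wy _] := gd _ _ gy.
  have := gl 1 _ _ _ _ gx gy; rewrite rmorph1 scale1r mul1r => /gd[_ le].
  have WvN : W (x - v) by rewrite -scaleN1r; apply: WD => //; exact: WZ.
  have := p_sub WvN (WD Wy Wv); rewrite [X in p X](_ : _ = x + y).
    by move=> ?; lra.
  by rewrite addrACA [- v + v]addrC subrr addr0.
have As : has_sup A.
  split; first by exists (a - p (u - v)), u, a.
  by exists (p (u + v) - a) => d; exact: AB.
pose c := sup A.
have c1 x b : g (x, b) -> b - c <= p (x - v).
  move=> gx; have : b - p (x - v) <= c by apply: ub_le_sup; [case: As|exists x, b].
  by move=> ?; lra.
have c2 x b : g (x, b) -> b + c <= p (x + v).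
  move=> gx; have : c <= p (x + v) - b by apply: ge_sup; [case: As|exact: AB].
  by move=> ?; lra.
pose g' := [set zd : V * R | exists (r : R) x b, [/\ g (x, b), zd.1 = x + r%:C *: v & zd.2 = b + r * c]].
exists g', c; split.
- split; last first.
    move=> r x b y d [r1 [x1 [b1 [g1 /= -> ->]]]] [r2 [x2 [b2 [g2 /= -> ->]]]].
    exists (r * r1 + r2), (r%:C *: x1 + x2), (r * b1 + b2); split; first exact: gl.
      by rewrite /= scalerDr scalerA addrACA -scalerDl rmorphD rmorphM.
    by rewrite /=; ring.
  move=> x b [r [y [d [gy /= -> ->]]]]; have [Wy le] := gd _ _ gy.
  split; first by apply: WD => //; exact: WZ.
  have [r0|r0|->] := ltgtP r 0; last by rewrite mul0r !addr0 rmorph0 scale0r addr0.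
    have s0 : 0 < - r by rewrite oppr_gt0.
    have := c1 _ _ (gZ (- r)^-1 _ _ gy); rewrite -(ler_pM2l s0) -p_hom//; last first.
      by rewrite -scaleN1r; apply: WD; apply: WZ.
    rewrite scalerBr scalerA -rmorphM divff ?gt_eqF// rmorph1 scale1r.
    rewrite rmorphN scaleNr opprK mulrBr mulrA divff ?gt_eqF// mul1r.
    by rewrite mulNr opprK.
  have := c2 _ _ (gZ r^-1 _ _ gy); rewrite -(ler_pM2l r0) -p_hom//; last first.
    by apply: WD => //; apply: WZ.
  rewrite scalerDr scalerA -rmorphM divff ?gt_eqF// rmorph1 scale1r.
  by rewrite mulrDr mulrA divff ?gt_eqF// mul1r.
- by move=> [x b] gx; exists 0, x, b; rewrite rmorph0 scale0r mul0r !addr0.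
- by exists 1, 0, 0; rewrite rmorph1 scale1r mul1r !add0r.
Qed.

Lemma hahn_banach u : W u -> exists F : V -> R,
  [/\ forall (r : R) x y, W x -> W y -> F (r%:C *: x + y) = r * F x + F y,
      forall x, W x -> F x <= p x & F u = p u].
Proof.
move=> Wu; pose P g := g = set0 \/ (dominated g /\ g (u, p u)).
have [F FP Ftot|g [Pg gmax]] := @Zorn_bigcup _ P.
  have [[g [Fg gN]]|/forallNP none] := pselect (exists g, F g /\ g !=set0); last first.
    left; apply/seteqP; split => // x [g Fg gx]; case: (none g); split => //.
    by exists x.
  have dg h : F h -> h !=set0 -> dominated h /\ h (u, p u).
    by move=> Fh hN; case: (FP _ Fh) => // e; move: hN; rewrite e => -[].
  right; split; last by exists g => //; case: (dg g Fg gN).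
  split.
    move=> x a [h Fh hx]; have [[hd _] _] := dg h Fh ltac:(by exists (x, a)).
    exact: hd.
  move=> r x a y b [h1 F1 g1] [h2 F2 g2].
  have [s|s] := Ftot _ _ F1 F2.
    exists h2 => //; have [[_ hl] _] := dg h2 F2 ltac:(by exists (y, b)).
    by apply: hl => //; exact: s.
  exists h1 => //; have [[_ hl] _] := dg h1 F1 ltac:(by exists (x, a)).
  by apply: hl => //; exact: s.
(* The starting functional sends [r u] to [r * p u]. For negative [r] it is dominated because
   [0 = p 0 <= p (r u) + p (- r u)]. *)
have base : dominated [set xa : V * R | exists r : R, xa.1 = r%:C *: u /\ xa.2 = r * p u].
  split; last first.
    move=> r x a y b [r1 [/= -> ->]] [r2 [/= -> ->]]; exists (r * r1 + r2).
    by rewrite /= scalerA -scalerDl rmorphD rmorphM mulrDl mulrA.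
  move=> x a [r [/= -> ->]]; split; first exact: WZ.
  have [r0|r0|->] := ltgtP r 0.
  - have s0 : 0 < - r by rewrite oppr_gt0.
    have := p_sub (WZ (r%:C) Wu) (WZ (- r)%:C Wu).
    rewrite -scalerDl -rmorphD subrr rmorph0 scale0r (p0 Wu) (p_hom s0 Wu) mulNr.
    by move=> ?; lra.
  - by rewrite p_hom.
  - by rewrite mul0r rmorph0 scale0r (p0 Wu).
have [gD gu] : dominated g /\ g (u, p u).
  case: Pg => // g0; exfalso; apply: (gmax _ _ (or_intror (conj base _))).
    rewrite g0; split => //.
    by move=> /(_ (u, p u)); apply; exists 1; rewrite rmorph1 scale1r mul1r.
  by exists 1; rewrite rmorph1 scale1r mul1r.
have tot v : W v -> exists a, g (v, a).
  move=> Wv; have [g' [c [gD' gg' gv]]] := extension gD gu Wv; exists c.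
  apply: contrapT => ng; apply: (gmax g').
    by split => // gg; apply: ng; exact: gg.
  by right; split => //; exact: gg'.
pose F v := xget 0 [set a | g (v, a)].
have FP v : W v -> g (v, F v).
  by move=> /tot[a ga]; rewrite /F; case: xgetP => [b _ //|] /(_ a).
have [gd gl] := gD.
exists F; split.
- move=> r x y Wx Wy; apply: (dominated_fun gD (FP _ _)); first exact: WP.
  by apply: gl; exact: FP.
- by move=> x Wx; case: (gd _ _ (FP x Wx)).
- by apply: (dominated_fun gD (FP u Wu)).
Qed.

End HahnBanach.

(** * The norm of an operator matrix as an inequality for all vectors *)

Section OpNorm.
Context {R : realType} {V : lmodType R[i]}.
Variable N : V -> R.
Hypothesis N0 : forall x, 0 <= N x.
Hypothesis NZ : forall a x, N (a *: x) = normc a * N x.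

Lemma opnorm_le (I : finType) (T : I -> I -> V -> V) (M : R) : 0 <= M ->
  (forall x : I -> V, \sum_i N (\sum_j T i j (x j)) ^+ 2 <= M ^+ 2 * \sum_j N (x j) ^+ 2) ->
  (opnorm N T <= M%:E)%E.
Proof.
move=> M0 TM; apply: ge_ereal_sup => _ [x /= x1 <-]; rewrite lee_fin.
rewrite -[leRHS](ger0_norm M0) -sqrtr_sqr ler_sqrt ?sqr_ge0//.
by apply: le_trans (TM x) _; rewrite ler_piMr ?sqr_ge0.
Qed.

Lemma opnormP (I : finType) (T : I -> I -> V -> V) (M : R) : 0 <= M ->
  (forall i j a x, T i j (a *: x) = a *: T i j x) -> (opnorm N T <= M%:E)%E ->
  forall x : I -> V, \sum_i N (\sum_j T i j (x j)) ^+ 2 <= M ^+ 2 * \sum_j N (x j) ^+ 2.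
Proof.
move=> M0 TZ TM x; set A := \sum_i _; set s := \sum_j _.
have s0 : 0 <= s by apply: sumr_ge0 => j _; rewrite sqr_ge0.
have A0 : 0 <= A by apply: sumr_ge0 => j _; rewrite sqr_ge0.
have key (t : R) : t ^+ 2 * s <= 1 -> t ^+ 2 * A <= M ^+ 2.
  move=> ts; have xE : \sum_j N (t%:C *: x j) ^+ 2 = t ^+ 2 * s.
    rewrite mulr_sumr; apply: eq_bigr => j _.
    by rewrite NZ normc_real exprMn real_normK ?num_real.
  have yE : \sum_i N (\sum_j T i j (t%:C *: x j)) ^+ 2 = t ^+ 2 * A.
    rewrite mulr_sumr; apply: eq_bigr => i _.
    under eq_bigr do rewrite TZ.
    by rewrite -scaler_sumr NZ normc_real exprMn real_normK ?num_real.
  have : ((Num.sqrt (t ^+ 2 * A))%:E <= M%:E)%E.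
    apply: le_trans TM; apply: ereal_sup_ubound; exists (fun j => t%:C *: x j).
      by rewrite /= xE.
    by rewrite yE.
  rewrite lee_fin => le; have tA0 : 0 <= t ^+ 2 * A by rewrite mulr_ge0 ?sqr_ge0.
  by rewrite -(sqr_sqrtr tA0) ler_pXn2r// ?nnegrE ?sqrtr_ge0.
(* [N] is not assumed definite, so [s = 0] does not make [x] vanish. In this case every multiple of
   [x] stays in the unit ball, and scaling [A] up to [M^2 + 1] contradicts the bound. *)
have [s00|sn] := eqVneq s 0.
  rewrite s00 mulr0; apply/ler_addgt0Pr => e e0; rewrite add0r leNgt; apply/negP => eA.
  have A1 : 0 < A by apply: lt_trans eA.
  pose t := Num.sqrt ((M ^+ 2 + 1) / A).
  have := key t; rewrite s00 mulr0 => /(_ ler01).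
  rewrite sqr_sqrtr ?divr_ge0 ?addr_ge0 ?sqr_ge0 ?ler01//.
  by rewrite divfK ?gt_eqF// => ?; lra.
have sp : 0 < s by rewrite lt_def sn.
have := key (Num.sqrt s^-1); rewrite sqr_sqrtr ?invr_ge0// mulVf// => /(_ (lexx _)).
by rewrite mulrC ler_pdivrMr.
Qed.

End OpNorm.

(** * The duality between the Fourier algebra and [VN] *)

Section Pairing.
Context {R : realType} {G : groupType}.
Local Notation L := (l2space R G).
Local Notation N := (@l2norm R G).
Implicit Types (u v : G -> R[i]) (T : L -> L) (xi eta : nat -> L).

Lemma nat_prod_bij : exists b : nat -> nat * nat, bijective b.
Proof.
have /card_set_bijP[f] := card_nat2.
by rewrite setTT_bijective => -[b fb bf]; exists b, f.
Qed.

(** A bijection of [nat] with [nat * nat] merges a sequence of pairs of vector sequences into one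
    pair, so countable sums of vector functionals are again vector functionals. *)
Lemma vecstate_concat (x e : nat -> nat -> L) :
  (nsum (fun p : nat * nat => (N (x p.1 p.2) ^+ 2)%R) < +oo)%E ->
  (nsum (fun p : nat * nat => (N (e p.1 p.2) ^+ 2)%R) < +oo)%E ->
  exists xi eta, [/\ nsum (fun n => N (xi n) ^+ 2) = nsum (fun p : nat * nat => N (x p.1 p.2) ^+ 2),
    nsum (fun n => N (eta n) ^+ 2) = nsum (fun p : nat * nat => N (e p.1 p.2) ^+ 2) &
    forall T, bounded_op N T ->
      abssum (fun k => vecstate (x k) (e k) T) /\
      vecstate xi eta T = csum (fun k => vecstate (x k) (e k) T)].
Proof.
move=> xo eo; have [b bb] := nat_prod_bij.
exists (fun n => x (b n).1 (b n).2), (fun n => e (b n).1 (b n).2).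
have E1 := nsum_reindex (fun p : nat * nat => N (x p.1 p.2) ^+ 2) bb.
have E2 := nsum_reindex (fun p : nat * nat => N (e p.1 p.2) ^+ 2) bb.
split; [by rewrite E1|by rewrite E2|] => T bT.
have x'o : l2seq (fun n => x (b n).1 (b n).2) by rewrite E1 in xo.
have e'o : l2seq (fun n => e (b n).1 (b n).2) by rewrite E2 in eo.
pose F (p : nat * nat) := l2dot (T (x p.1 p.2)) (e p.1 p.2).
have Fo : abssum F.
  by rewrite /abssum (nsum_reindex _ bb); exact: abssum_vecstate x'o e'o bT.
have [Fk FE] := nsum_prod_fin (fun p => normc_ge0 (F p)) Fo.
split; last by rewrite -[RHS](csum_prod Fo) (csum_reindex _ bb).
apply: (@le_abssum _ _ _ (fun k => fine (nsum (fun n => normc (F (k, n)))))); last by rewrite -FE; exact: Fo.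
by move=> k; apply: csum_le; exact: Fk.
Qed.

Lemma nsum_two (a b : R) : 0 <= a -> 0 <= b ->
  nsum (fun k : nat => if k is 0%N then a else if k is 1%N then b else 0) = (a + b)%:E.
Proof.
move=> a0 b0; rewrite (eq_nsum (g := fun k : nat => (if k == 0%N then a else 0) + (if k == 1%N then b else 0))).
  rewrite nsumD; try by move=> k; case: ifP.
  by rewrite (nsum_supp1 (i0 := 0%N)) ?(nsum_supp1 (i0 := 1%N))//= => k /negPf ->.
by move=> [|[|k]] /=; rewrite ?addr0 ?add0r.
Qed.

Lemma csum_two (a : nat -> R[i]) : (forall k, (1 < k)%N -> a k = 0) -> csum a = a 0%N + a 1%N.
Proof.
move=> a2; have ao : abssum a.
  rewrite /abssum (eq_nsum (g := fun k : nat => if k is 0%N then normc (a 0%N) else if k is 1%N then normc (a 1%N) else 0)).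
    by rewrite nsum_two ?normc_ge0// ltry.
  by move=> [|[|k]] //; rewrite a2// normc0.
rewrite (csum_nat_split 2 ao) csum0 ?addr0 ?big_ord_recl ?big_ord0 ?addr0//.
by move=> k; case: ifP => // /a2.
Qed.

(* [rep u c]: [u] is the restriction to the group of a vector functional of
   trace norm at most [c]. *)
Definition rep_by xi eta (c : R) : Prop :=
  (nsum (fun n => (N (xi n) ^+ 2)%R) <= c%:E)%E /\ (nsum (fun n => (N (eta n) ^+ 2)%R) <= c%:E)%E.

Definition rep u (c : R) : Prop := exists xi eta, rep_by xi eta c /\ u = vecstate xi eta \o (@lreg R G).

Lemma rep_by_l2 xi eta c : rep_by xi eta c -> l2seq xi /\ l2seq eta.
Proof. by move=> [h1 h2]; split; [apply: le_lt_trans h1 _|apply: le_lt_trans h2 _]; rewrite ltry. Qed.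

Lemma rep_fourier u c : rep u c -> fourier u.
Proof.
move=> [xi [eta [rb ->]]]; have [h1 h2] := rep_by_l2 rb.
by exists (vecstate xi eta) => //; exists xi, eta.
Qed.

Lemma l2seq_rep_by xi eta : l2seq xi -> l2seq eta -> exists c, rep_by xi eta c.
Proof.
move=> xo eo; have sq (y : nat -> L) n : 0 <= N (y n) ^+ 2 by rewrite sqr_ge0.
exists (Num.max (fine (nsum (fun n => N (xi n) ^+ 2))) (fine (nsum (fun n => N (eta n) ^+ 2)))).
split; first by rewrite (nsum_fin (sq xi) xo) lee_fin le_max lexx.
by rewrite (nsum_fin (sq eta) eo) lee_fin le_max lexx orbT.
Qed.

Lemma fourier_rep u : fourier u -> exists c, rep u c.
Proof.
move=> [phi [xi [eta [xo eo ->]]] ->].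
by have [c rc] := l2seq_rep_by xo eo; exists c, xi, eta.
Qed.

Lemma rep_by_ge0 xi eta c : rep_by xi eta c -> 0 <= c.
Proof.
move=> [h _]; rewrite -lee_fin; apply: le_trans h; apply: nsum_ge0 => n.
by rewrite sqr_ge0.
Qed.

Lemma rep_ge0 u c : rep u c -> 0 <= c.
Proof. by move=> [xi [eta [/rep_by_ge0]]]. Qed.

Lemma rep_le u c d : c <= d -> rep u c -> rep u d.
Proof.
move=> cd [xi [eta [[h1 h2] ->]]]; exists xi, eta; split => //.
by split; [apply: le_trans h1 _|apply: le_trans h2 _]; rewrite lee_fin.
Qed.

Lemma vecstate_sum (x e : nat -> nat -> L) (c : nat -> R) (C : R) :
  (forall k, rep_by (x k) (e k) (c k)) -> (nsum c <= C%:E)%E ->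
  exists xi eta, rep_by xi eta C /\
    forall T, bounded_op N T ->
      abssum (fun k => vecstate (x k) (e k) T) /\
      vecstate xi eta T = csum (fun k => vecstate (x k) (e k) T).
Proof.
move=> rb cC.
have H (y : nat -> nat -> L) : (forall k, (nsum (fun n => (N (y k n) ^+ 2)%R) <= (c k)%:E)%E) ->
    (nsum (fun p : nat * nat => (N (y p.1 p.2) ^+ 2)%R) <= C%:E)%E.
  move=> yc; apply: le_trans cC; rewrite nsum_prod; last by move=> k; rewrite sqr_ge0.
  by apply: le_esum => k _; exact: yc.
have xC := H x (fun k => (rb k).1); have eC := H e (fun k => (rb k).2).
have [||xi [eta [E1 E2 E3]]] := @vecstate_concat x e.
- by apply: le_lt_trans xC _; rewrite ltry.
- by apply: le_lt_trans eC _; rewrite ltry.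
by exists xi, eta; split => //; split; rewrite ?E1 ?E2.
Qed.

Lemma rep_by0 : rep_by (fun=> 0) (fun=> 0) 0.
Proof. by split; rewrite /nsum esum1// => n _; rewrite l2norm0 expr0n. Qed.

Lemma vecstate00 T : vecstate (fun=> 0) (fun=> 0) T = 0.
Proof. by apply: csum0 => n; rewrite l2dot0r. Qed.

Lemma vecstateD xi eta xi' eta' c c' : rep_by xi eta c -> rep_by xi' eta' c' ->
  exists x e : nat -> L, rep_by x e (c + c') /\ forall T, bounded_op N T ->
    vecstate x e T = vecstate xi eta T + vecstate xi' eta' T.
Proof.
move=> r1 r2.
pose f (y y' : nat -> L) k := if k is 0%N then y else if k is 1%N then y' else (fun=> 0).
have [||x [e [re eT]]] := @vecstate_sum (f xi xi') (f eta eta')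
    (fun k : nat => if k is 0%N then c else if k is 1%N then c' else 0) (c + c').
- by move=> [|[|k]] //=; exact: rep_by0.
- by rewrite nsum_two ?(rep_by_ge0 r1) ?(rep_by_ge0 r2).
exists x, e; split => // T /eT[_ ->]; rewrite csum_two//.
by move=> [|[|k]] // _; rewrite vecstate00.
Qed.

(** The modulus of [a] is shared equally: [xi] is scaled by [a / sqrt |a|] and [eta] by [sqrt |a|],
    so that both sums of squares grow by the factor [|a|] only. *)
Lemma vecstateZ a xi eta c : rep_by xi eta c ->
  exists x e : nat -> L, rep_by x e (normc a * c) /\ forall T, bounded_op N T ->
    vecstate x e T = a * vecstate xi eta T.
Proof.
move=> [r1 r2]; have c0 := rep_by_ge0 (conj r1 r2).
have [->|a0] := eqVneq a 0.
  exists (fun=> 0), (fun=> 0); split; first by rewrite normc0 mul0r; exact: rep_by0.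
  by move=> T _; rewrite vecstate00 mul0r.
pose t := Num.sqrt (normc a).
have t2 : t ^+ 2 = normc a by rewrite sqr_sqrtr// normc_ge0.
have t0 : 0 < t by rewrite sqrtr_gt0 normc_gt0.
exists (fun n => (a / t%:C) *: xi n), (fun n => t%:C *: eta n); split.
  have aux (b : R[i]) (y : nat -> L) : normc b ^+ 2 = normc a ->
      (nsum (fun n => (N (y n) ^+ 2)%R) <= c%:E)%E ->
      (nsum (fun n => (N (b *: y n) ^+ 2)%R) <= (normc a * c)%:E)%E.
    move=> b2 yc; rewrite (eq_nsum (g := fun n => normc a * N (y n) ^+ 2)); last first.
      by move=> n; rewrite l2normZ exprMn b2.
    rewrite nsumZ ?normc_ge0//; last by move=> n; rewrite sqr_ge0.
    by rewrite EFinM lee_wpmul2l ?lee_fin ?normc_ge0.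
  split; apply: aux => //; last by rewrite normc_real ger0_norm// ltW.
  rewrite normcM normcV normc_real ger0_norm ?ltW// expr_div_n t2 expr2.
  by rewrite mulfK// normc_eq0.
move=> T bT; rewrite /vecstate -csumZ.
  apply: eq_csum => n; have [Tl _] := bT.
  rewrite (linear_mapZ Tl).
  have tc : t%:C != 0 :> R[i] by rewrite (inj_eq (@complexI R) t 0) gt_eqF.
  by rewrite l2dotZl l2dotZr conjcE conjc_real; field.
have [h1 h2] := rep_by_l2 (conj r1 r2); exact: abssum_vecstate.
Qed.

(** The vectors representing the terms are concatenated. This is the summability principle from
    which completeness of [A(G)] is derived. *)
Lemma rep_sum (u_ : nat -> G -> R[i]) (c : nat -> R) (C : R) :
  (forall k, rep (u_ k) (c k)) -> (nsum c <= C%:E)%E ->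
  (forall s, abssum (u_^~ s)) /\ rep (fun s => csum (u_^~ s)) C.
Proof.
move=> ru cC; have [x xP] := choice ru; have [e eP] := choice xP.
have [|xi [eta [rb H]]] := @vecstate_sum x e c C _ cC; first by move=> k; case: (eP k).
have E k s : vecstate (x k) (e k) (lreg s) = u_ k s by case: (eP k) => _ ->.
have HE s : abssum (u_^~ s) /\ vecstate xi eta (lreg s) = csum (u_^~ s).
  have [h1 h2] := H _ (lreg_bounded s); split.
    by apply: eq_abssum h1 => k; rewrite E.
  by rewrite h2; apply: eq_csum => k; rewrite E.
split; first by move=> s; case: (HE s).
by exists xi, eta; split => //; apply/funext => s /=; case: (HE s).
Qed.

Lemma repD u v c d : rep u c -> rep v d -> rep (u + v) (c + d).
Proof.
move=> [xi [eta [r1 ->]]] [xi' [eta' [r2 ->]]].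
have [x [e [r3 H]]] := vecstateD r1 r2; exists x, e; split => //.
by apply/funext => s /=; rewrite H//; exact: lreg_bounded.
Qed.

Lemma repZ a u c : rep u c -> rep (a *: u) (normc a * c).
Proof.
move=> [xi [eta [r1 ->]]]; have [x [e [r3 H]]] := vecstateZ a r1; exists x, e; split => //.
by apply/funext => s /=; rewrite H//; exact: lreg_bounded.
Qed.

Lemma fourierP a u v : fourier u -> fourier v -> fourier (a *: u + v).
Proof.
move=> /fourier_rep[c uc] /fourier_rep[d vd].
exact: rep_fourier (repD (repZ a uc) vd).
Qed.

Lemma fourierZ a u : fourier u -> fourier (a *: u).
Proof. by move=> /fourier_rep[c uc]; exact: rep_fourier (repZ a uc). Qed.

Lemma rep0 : rep 0 0.
Proof.
exists (fun=> 0), (fun=> 0); split; first exact: rep_by0.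
by apply/funext => s /=; rewrite vecstate00.
Qed.

Lemma fourier0 : fourier (0 : G -> R[i]).
Proof. exact: rep_fourier rep0. Qed.

(** [fourier_pairing] chooses some representing functional. Its difference with the given one is a
    vector functional vanishing on translations, hence on all of [VN] by [vecstate_VN0]. *)
Lemma pairing_vecstate xi eta u : l2seq xi -> l2seq eta -> u = vecstate xi eta \o (@lreg R G) ->
  forall T, VN T -> fourier_pairing u T = vecstate xi eta T.
Proof.
move=> xo eo uE T VT; rewrite /fourier_pairing; case: xgetP => [phi _|]; last first.
  by move=> /(_ (vecstate xi eta)); case; split => //; exists xi, eta.
move=> [[x [e [x1 e1 ->]]] uE']; rewrite -/(l2seq x) -/(l2seq e) in x1 e1.
change (vecstate x e T = vecstate xi eta T).
have [c rc] := l2seq_rep_by x1 e1; have [d rd] := l2seq_rep_by xo eo.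
have [x2 [e2 [r2 H2]]] := vecstateZ (-1) rd.
have [x3 [e3 [r3 H3]]] := vecstateD rc r2.
have [l1 l2'] := rep_by_l2 r3.
have := @vecstate_VN0 R G x3 e3 l1 l2' _ T VT.
rewrite H3 ?H2; try exact: VT.1.
rewrite mulN1r => h; apply/eqP; rewrite -subr_eq0; apply/eqP; apply: h => s.
rewrite H3 ?H2; try exact: lreg_bounded.
rewrite mulN1r; apply/eqP; rewrite subr_eq0; apply/eqP.
by move: uE'; rewrite uE => /(congr1 (fun F => F s)) /= ->.
Qed.

End Pairing.

Section PairingTheory.
Context {R : realType} {G : groupType}.
Local Notation L := (l2space R G).
Local Notation N := (@l2norm R G).
Implicit Types (u v : G -> R[i]) (T : L -> L) (xi eta : nat -> L).

Lemma fourier_vecstate u : fourier u -> exists xi eta, [/\ l2seq xi, l2seq eta &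
  u = vecstate xi eta \o (@lreg R G)].
Proof. by move=> [phi [xi [eta [xo eo ->]]] ->]; exists xi, eta. Qed.

Lemma pairingPl a u v T : fourier u -> fourier v -> VN T ->
  fourier_pairing (a *: u + v) T = a * fourier_pairing u T + fourier_pairing v T.
Proof.
move=> /fourier_rep[c [xi [eta [r1 uE]]]] /fourier_rep[d [xi' [eta' [r2 vE]]]] VT.
have [xo eo] := rep_by_l2 r1; have [xo' eo'] := rep_by_l2 r2.
rewrite (pairing_vecstate xo eo uE VT) (pairing_vecstate xo' eo' vE VT).
have [x [e [r3 H3]]] := vecstateZ a r1; have [x4 [e4 [r4 H4]]] := vecstateD r3 r2.
have [x4o e4o] := rep_by_l2 r4.
rewrite (pairing_vecstate x4o e4o _ VT); first by rewrite H4 ?H3//; exact: VT.1.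
apply/funext => s /=; rewrite H4 ?H3; try exact: lreg_bounded.
by rewrite -[RHS]/(a * (vecstate xi eta \o @lreg R G) s + (vecstate xi' eta' \o @lreg R G) s) -uE -vE.
Qed.

Lemma VN_sum (I : Type) (r : seq I) (P : pred I) (a : I -> R[i]) (T : I -> L -> L) :
  (forall i, VN (T i)) -> VN (\sum_(i <- r | P i) a i *: T i).
Proof.
move=> VT; elim/big_rec: _ => [|i S _ VS]; first exact: VN_0.
exact: VN_P.
Qed.

Lemma pairingPr u a T T' : fourier u -> VN T -> VN T' ->
  fourier_pairing u (a *: T + T') = a * fourier_pairing u T + fourier_pairing u T'.
Proof.
move=> /fourier_vecstate[xi [eta [xo eo uE]]] VT VT'.
rewrite !(pairing_vecstate xo eo uE)//; last exact: VN_P.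
rewrite /vecstate -csumZ; last exact: abssum_vecstate xo eo VT.1.
rewrite -csumD; last 2 first.
- exact: abssumZ (abssum_vecstate xo eo VT.1).
- exact: abssum_vecstate xo eo VT'.1.
by apply: eq_csum => n; rewrite funPE l2dotDl l2dotZl.
Qed.

Lemma pairingZr u a T : fourier u -> VN T ->
  fourier_pairing u (a *: T) = a * fourier_pairing u T.
Proof.
move=> Fu VT; have h1 := pairingPr 1 Fu VN_0 VN_0; have := pairingPr a Fu VT VN_0.
rewrite !addr0 => ->; rewrite scaler0 addr0 in h1.
by move: h1; rewrite mul1r => /eqP; rewrite -subr_eq0 opprD addrA subrr sub0r oppr_eq0 => /eqP ->; rewrite addr0.
Qed.

Lemma pairing_lreg u s : fourier u -> fourier_pairing u (lreg s) = u s.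
Proof.
move=> /fourier_vecstate[xi [eta [xo eo uE]]].
by rewrite (pairing_vecstate xo eo uE (VN_lreg s)) uE.
Qed.

Lemma fourier_mxnormP n (u : 'M[G -> R[i]]_n) (M : R) : 0 <= M ->
  (fourier_mxnorm u <= M%:E)%E -> forall m (X : 'M[L -> L]_m),
  (forall k l, VN (X k l)) -> (op_mxnorm N X <= 1)%E -> forall z : 'I_m * 'I_n -> R[i],
  \sum_p normc (\sum_q fourier_pairing (u p.2 q.2) (X p.1 q.1) * z q) ^+ 2 <=
    M ^+ 2 * \sum_q normc (z q) ^+ 2.
Proof.
move=> M0 uM m X VX X1 z.
pose a (p q : 'I_m * 'I_n) := fourier_pairing (u p.2 q.2) (X p.1 q.1).
apply: (@opnormP R R[i] (@normc R) (@normcM R) _ (fun p q y => a p q * y) M M0).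
  by move=> p q b y; rewrite mulrCA.
apply: le_trans uM; apply: ereal_sup_ubound.
exists m, X; split => //; congr (scalar_opnorm _).
by apply/funext => p; apply/funext => q; rewrite !mxE.
Qed.

Lemma fourier_mxnorm_le n (u : 'M[G -> R[i]]_n) (M : R) : 0 <= M ->
  (forall m (X : 'M[L -> L]_m), (forall k l, VN (X k l)) -> (op_mxnorm N X <= 1)%E ->
   forall z : 'I_m * 'I_n -> R[i],
  \sum_p normc (\sum_q fourier_pairing (u p.2 q.2) (X p.1 q.1) * z q) ^+ 2 <=
    M ^+ 2 * \sum_q normc (z q) ^+ 2) ->
  (fourier_mxnorm u <= M%:E)%E.
Proof.
move=> M0 H; apply: ge_ereal_sup => _ [m [X [VX X1 ->]]].
apply: opnorm_le => // z; have := H m X VX X1 z.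
apply: le_trans; apply: le_of_eq.
apply: eq_bigr => p _; congr (normc _ ^+ 2); apply: eq_bigr => q _.
by rewrite !mxE.
Qed.

Lemma sum_prod_ord1 (V : zmodType) m (F : 'I_m * 'I_1 -> V) :
  \sum_p F p = \sum_k F (k, ord0).
Proof.
rewrite (eq_bigr (fun p => F (p.1, p.2))); last by case.
by rewrite -(pair_bigA _ (fun k i => F (k, i)))/=; apply: eq_bigr => k _; rewrite big_ord1.
Qed.

Lemma mxnormP m (X : 'M[L -> L]_m) : (forall k l, VN (X k l)) -> (op_mxnorm N X <= 1)%E ->
  forall x : 'I_m -> L, \sum_k N (\sum_l X k l (x l)) ^+ 2 <= \sum_l N (x l) ^+ 2.
Proof.
move=> VX X1 x; rewrite -[leRHS]mul1r -[X in X * _](expr1n _ 2).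
apply: (@opnormP R L N (@l2normZ R G)) => // k l a y.
exact: linear_mapZ (VN_linear (VX k l)) _ _.
Qed.

(* The functional tested against is [A] itself, and each term is split by AM-GM with weight [c]. *)
Lemma rep_fourier_norm u (c : R) : 0 < c -> rep u c -> (fourier_norm u <= c%:E)%E.
Proof.
move=> c0 [xi [eta [rb uE]]]; have [xo eo] := rep_by_l2 rb.
have Fu : fourier u by apply: (@rep_fourier _ _ u c); exists xi, eta.
apply: fourier_mxnorm_le; first exact: ltW.
move=> m X VX X1 z; pose A k := \sum_l fourier_pairing u (X k l) * z (l, ord0).
rewrite !sum_prod_ord1; under eq_bigr => k _ do rewrite sum_prod_ord1.
rewrite (eq_bigr (fun k => normc (A k) ^+ 2)); last first.
  by move=> k _; congr (normc _ ^+ 2); apply: eq_bigr => l _; rewrite mxE.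
set S := \sum_k normc (A k) ^+ 2; set Z := \sum_i _.
pose P k n := \sum_l X k l (z (l, ord0) *: xi n).
have XZ k l a y : X k l (a *: y) = a *: X k l y := linear_mapZ (VN_linear (VX k l)) a y.
have pe k l : fourier_pairing u (X k l) * z (l, ord0) =
    csum (fun n => l2dot (X k l (z (l, ord0) *: xi n)) (eta n)).
  rewrite (pairing_vecstate xo eo uE (VX k l)) mulrC -csumZ.
    by apply: eq_csum => n; rewrite XZ l2dotZl.
  exact: abssum_vecstate xo eo (VX k l).1.
have pa k l : abssum (fun n => l2dot (X k l (z (l, ord0) *: xi n)) (eta n)).
  apply: eq_abssum (abssumZ (z (l, ord0)) (abssum_vecstate xo eo (VX k l).1)) => n.
  by rewrite XZ l2dotZl.
have AE k : A k = csum (fun n => l2dot (P k n) (eta n)) /\ abssum (fun n => l2dot (P k n) (eta n)).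
  have E n : l2dot (P k n) (eta n) = \sum_l l2dot (X k l (z (l, ord0) *: xi n)) (eta n).
    exact: l2dot_suml.
  split; last first.
    apply: eq_abssum (fun n => esym (E n)) _.
    by apply: abssum_sum => l _; exact: pa.
  rewrite (eq_csum E) csum_sum; last by move=> l _; exact: pa.
  by apply: eq_bigr => l _; rewrite pe.
pose B n := \sum_k Num.conj (A k) * l2dot (P k n) (eta n).
have Bo : abssum B.
  by apply: abssum_sum => k _; apply: abssumZ; case: (AE k).
have SE : csum B = S%:C.
  rewrite csum_sum; last by move=> k _; apply: abssumZ; case: (AE k).
  rewrite rmorph_sum; apply: eq_bigr => k _; rewrite csumZ; last by case: (AE k).
  by rewrite -(AE k).1 mulrC mulc_conj.
have S0 : 0 <= S by apply: sumr_ge0 => k _; rewrite sqr_ge0.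
have Z0 : 0 <= Z by apply: sumr_ge0 => k _; rewrite sqr_ge0.
have Bn n : normc (B n) <= c * Z / 2 * N (xi n) ^+ 2 + S / c / 2 * N (eta n) ^+ 2.
  have Pn : \sum_k N (P k n) ^+ 2 <= Z * N (xi n) ^+ 2.
    apply: le_trans (mxnormP VX X1 _) _; rewrite mulr_suml; apply: ler_sum => l _.
    by rewrite l2normZ exprMn.
  have : normc (B n) <= \sum_k (c / 2 * N (P k n) ^+ 2 + normc (A k) ^+ 2 * (N (eta n) ^+ 2 / c / 2)).
    apply: le_trans (normc_sum _ _ _) _; apply: ler_sum => k _.
    rewrite normcM normc_conj; set a := normc (A k).
    apply: (@le_trans _ _ (a * (N (P k n) * N (eta n)))).
      by rewrite ler_wpM2l ?normc_ge0// l2CauchySchwarz.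
    set q := N (P k n); set r := N (eta n).
    have := sqr_ge0 (c * q - a * r) => h.
    have -> : c / 2 * q ^+ 2 + a ^+ 2 * (r ^+ 2 / c / 2) =
        a * (q * r) + (c * q - a * r) ^+ 2 / (2 * c).
      by field; rewrite gt_eqF.
    by rewrite lerDl divr_ge0// mulr_ge0// ltW.
  rewrite big_split/= -mulr_sumr -mulr_suml -/S => h; apply: le_trans h _.
  have -> : S * (N (eta n) ^+ 2 / c / 2) = S / c / 2 * N (eta n) ^+ 2 by ring.
  rewrite lerD2r.
  have -> : c * Z / 2 * N (xi n) ^+ 2 = c / 2 * (Z * N (xi n) ^+ 2) by ring.
  by rewrite ler_wpM2l ?divr_ge0 ?(ltW c0).
have p1 : 0 <= c * Z / 2 by rewrite divr_ge0// mulr_ge0// ltW.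
have p2 : 0 <= S / c / 2 by rewrite divr_ge0// divr_ge0// ltW.
have : S <= c * Z / 2 * c + S / c / 2 * c.
  have -> : S = normc (csum B) by rewrite SE normc_real ger0_norm.
  apply: le_trans (csum_le Bo) _; rewrite SE normc_real ger0_norm//.
  rewrite -lee_fin -nsum_fin//; last by move=> n; exact: normc_ge0.
  apply: le_trans (le_nsum Bn) _; rewrite nsumD; last 2 first.
  - by move=> n; rewrite mulr_ge0 ?sqr_ge0.
  - by move=> n; rewrite mulr_ge0 ?sqr_ge0.
  rewrite (nsumZ p1); last by move=> n; rewrite sqr_ge0.
  rewrite (nsumZ p2); last by move=> n; rewrite sqr_ge0.
  by rewrite EFinD [in leRHS]EFinM [X in (_ <= _ + X)%E]EFinM leeD// lee_wpmul2l ?lee_fin//; case: rb.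
have -> : c * Z / 2 * c + S / c / 2 * c = c ^+ 2 * Z / 2 + S / 2.
  by field; rewrite gt_eqF.
by set q := c ^+ 2 * Z => ?; lra.
Qed.

Lemma pairing_bound u T (K M : R) : fourier u -> VN T -> 0 <= K -> 0 <= M ->
  (forall f, N (T f) <= K * N f) -> (fourier_norm u <= M%:E)%E ->
  normc (fourier_pairing u T) <= K * M.
Proof.
move=> Fu VT K0 M0 TK uM; apply/ler_addgt0Pr => e e0.
have e1 : 0 < e / (M + 1) by rewrite divr_gt0// ltr_wpDl.
(* [K] may be 0, so [T] is normalised by a slightly larger constant; the increment is chosen so that
   it costs at most [e] after multiplication by [M]. *)
pose K' := K + e / (M + 1); have K'0 : 0 < K' by rewrite ltr_wpDl.
pose X : 'M[L -> L]_1 := const_mx ((K'^-1)%:C *: T).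
have VX k l : VN (X k l) by rewrite mxE; exact: VN_Z.
have X1 : (op_mxnorm N X <= 1)%E.
  apply: opnorm_le => // x; rewrite !big_ord1 mxE expr1n mul1r.
  rewrite ler_pXn2r ?nnegrE ?l2norm_ge0// l2normZ normc_real ger0_norm ?invr_ge0 ?(ltW K'0)//.
  rewrite ler_pdivrMl//; apply: le_trans (TK _) _; rewrite ler_wpM2r ?l2norm_ge0//.
  by rewrite lerDl ltW.
have := fourier_mxnormP M0 uM VX X1 (fun=> 1).
rewrite !sum_prod_ord1 !big_ord1 sum_prod_ord1 big_ord1 !mxE normc1 expr1n mulr1 mulr1.
rewrite ler_pXn2r ?nnegrE ?normc_ge0// pairingZr// normcM normc_real.
rewrite ger0_norm ?invr_ge0 ?(ltW K'0)// ler_pdivrMl// => h; apply: le_trans h _.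
rewrite mulrDl lerD2l -mulrA ler_piMr// ?(ltW e0)//.
by rewrite mulrC ler_pdivrMr ?mul1r ?lerDl// ltr_wpDl.
Qed.

End PairingTheory.

(** * The trace norm and completeness of the Fourier algebra *)

Section TraceNorm.
Context {R : realType} {G : groupType}.
Local Notation L := (l2space R G).
Local Notation N := (@l2norm R G).
Implicit Types (u v : G -> R[i]) (T : L -> L) (xi eta : nat -> L) (f g : L).

(** The quotient of the trace norm by the functionals vanishing on translations. It is equivalent to
    [fourier_norm]: see [rep_fourier_norm] and [trnorm_fourier_norm]. *)
Definition trnorm u : R := inf [set c | rep u c].

Lemma trnorm_has_inf u : fourier u -> has_inf [set c | rep u c].
Proof.
move=> /fourier_rep[c rc]; split; first by exists c.
by exists 0 => d /rep_ge0.
Qed.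

Lemma trnorm_le u c : rep u c -> trnorm u <= c.
Proof.
move=> rc; apply: ge_inf => //; by have [] := trnorm_has_inf (rep_fourier rc).
Qed.

Lemma trnorm_ge0 u : fourier u -> 0 <= trnorm u.
Proof. by move=> /trnorm_has_inf[ne _]; apply: lb_le_inf => // c /rep_ge0. Qed.

Lemma trnorm_lt u c : fourier u -> trnorm u < c -> rep u c.
Proof.
move=> Fu lt; have e0 : 0 < c - trnorm u by rewrite subr_gt0.
have [d rd dc] := inf_adherent e0 (trnorm_has_inf Fu).
by apply: rep_le rd; rewrite -/(trnorm u) addrC subrK in dc; exact: ltW.
Qed.

Lemma fourierD u v : fourier u -> fourier v -> fourier (u + v).
Proof. by move=> Fu Fv; rewrite -[u]scale1r; exact: fourierP. Qed.

Lemma trnormD u v : fourier u -> fourier v -> trnorm (u + v) <= trnorm u + trnorm v.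
Proof.
move=> Fu Fv; apply/ler_addgt0Pr => e e0; have e2 : 0 < e / 2 by rewrite divr_gt0.
have ru := trnorm_lt Fu (ltr_pwDr e2 (lexx _)); have rv := trnorm_lt Fv (ltr_pwDr e2 (lexx _)).
by rewrite [e]splitr addrACA; exact: trnorm_le (repD ru rv).
Qed.

Lemma trnormZ_le a u : fourier u -> trnorm (a *: u) <= normc a * trnorm u.
Proof.
move=> Fu; apply/ler_addgt0Pr => e e0.
have a1 : 0 < normc a + 1 by rewrite ltr_wpDl ?normc_ge0.
have e2 : 0 < e / (normc a + 1) by rewrite divr_gt0.
apply: le_trans (trnorm_le (repZ a (trnorm_lt Fu (ltr_pwDr e2 (lexx _))))) _.
rewrite mulrDr lerD2l mulrCA ler_piMr ?(ltW e0)//.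
by rewrite ler_pdivrMr// mul1r lerDl.
Qed.

Lemma trnormZ a u : fourier u -> trnorm (a *: u) = normc a * trnorm u.
Proof.
move=> Fu; apply/le_anti; rewrite trnormZ_le//=.
have [->|a0] := eqVneq a 0; first by rewrite normc0 mul0r trnorm_ge0// scale0r; exact: fourier0.
have := trnormZ_le a^-1 (fourierZ a Fu); rewrite scalerA mulVf// scale1r normcV.
by rewrite ler_pdivlMl ?normc_gt0.
Qed.

(** A coefficient of the left regular representation, conjugate linear in [g]. *)
Definition vec f g : G -> R[i] := fun s => l2dot (lreg s f) g.

Lemma rep_vec_max f g (c : R) : N f ^+ 2 <= c -> N g ^+ 2 <= c -> rep (vec f g) c.
Proof.
move=> fc gc; pose y h (n : nat) : L := if n is 0%N then h else 0.
have H h : N h ^+ 2 <= c -> (nsum (fun n => (N (y h n) ^+ 2)%R) <= c%:E)%E.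
  move=> hc; rewrite (nsum_supp1 (i0 := 0%N)) ?sqr_ge0 ?lee_fin// => -[//|n] _.
  by rewrite l2norm0 expr0n.
exists (y f), (y g); split; first by split; exact: H.
apply/funext => s; rewrite /= /vecstate (csum1 (i0 := 0%N))// => -[//|n] _.
by rewrite l2dot0r.
Qed.

Lemma vecPl a f f' g : vec (a *: f + f') g = a *: vec f g + vec f' g.
Proof. by apply/funext => s; rewrite /vec lreg_linear l2dotDl l2dotZl. Qed.

Lemma vecPr a f g g' : vec f (a *: g + g') = Num.conj a *: vec f g + vec f g'.
Proof. by apply/funext => s; rewrite /vec l2dotDr l2dotZr. Qed.

Lemma vec0l g : vec 0 g = 0.
Proof. by have := vecPl (-1) 0 0 g; rewrite scaler0 addr0 scaleN1r addNr. Qed.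

Lemma vec0r f : vec f 0 = 0.
Proof. by apply/funext => s; rewrite /vec l2dot0r. Qed.

(** [rep] controls each sum of squares separately, so the vectors are first normalised and the
    product of the norms is put back as a scalar. *)
Lemma rep_vec f g : rep (vec f g) (N f * N g).
Proof.
have [->|f0] := eqVneq f 0; first by rewrite vec0l l2norm0 mul0r; exact: rep0.
have [->|g0] := eqVneq g 0; first by rewrite vec0r l2norm0 mulr0; exact: rep0.
have np h : h != 0 -> 0 < N h.
  by move=> h0; rewrite lt_def l2norm_ge0 andbT; apply: contra h0 => /eqP/l2norm_eq0 ->.
have nf := np _ f0; have ng := np _ g0.
pose f' := (N f)^-1%:C *: f; pose g' := (N g)^-1%:C *: g.
have n1 h : h != 0 -> N ((N h)^-1%:C *: h) ^+ 2 <= 1.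
  move=> /np nh; rewrite l2normZ normc_real ger0_norm ?invr_ge0 ?l2norm_ge0//.
  by rewrite mulVf ?gt_eqF// expr1n.
have -> : vec f g = (N f * N g)%:C *: vec f' g'.
  have := vecPl (N f)^-1%:C f 0 g'; rewrite vec0l !addr0 => ->.
  have := vecPr (N g)^-1%:C f g 0; rewrite vec0r !addr0 => ->.
  rewrite conjcE conjc_real !scalerA -!rmorphM.
  have -> : N f * N g / N f / N g = 1 by field; rewrite !gt_eqF.
  by rewrite rmorph1 scale1r.
have := repZ (N f * N g)%:C (rep_vec_max (n1 f f0) (n1 g g0)).
by rewrite normc_real ger0_norm ?mulr_ge0 ?l2norm_ge0// mulr1.
Qed.

Lemma fourier_vec f g : fourier (vec f g).
Proof. exact: rep_fourier (rep_vec f g). Qed.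

(** The complex functional [F v - i F (i v)] has the real one as real part. Its bound simply adds
    those of the real and imaginary parts, whence the factor 2; equivalence of norms is all that is
    wanted of it. *)
Lemma complex_hahn_banach u : fourier u -> exists F : (G -> R[i]) -> R[i],
  [/\ forall a v v', fourier v -> fourier v' -> F (a *: v + v') = a * F v + F v',
      forall v, fourier v -> normc (F v) <= 2 * trnorm v & complex.Re (F u) = trnorm u].
Proof.
move=> Fu; have hom (r : R) v : 0 < r -> fourier v -> trnorm (r%:C *: v) = r * trnorm v.
  by move=> r0 Fv; rewrite trnormZ// normc_real ger0_norm// ltW.
have [F [Fl Fb Fe]] := hahn_banach fourierP trnormD hom Fu.
have F0 : F 0 = 0.
  have Z : fourier (0 : G -> R[i]) by exact: fourier0.
  by have := Fl (-1) _ _ Z Z; rewrite scaler0 addr0 mulN1r addNr.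
have Fi v : fourier v -> fourier ('i *: v) by exact: fourierZ.
have ni : normc ('i : R[i]) = 1 by rewrite /= expr0n expr1n add0r sqrtr1.
have Fabs v : fourier v -> `|F v| <= trnorm v.
  move=> Fv; rewrite ler_norml Fb// andbT.
  have Z : fourier (0 : G -> R[i]) by exact: fourier0.
  have := Fl (-1) v 0 Fv Z; rewrite F0 !addr0 mulN1r => e.
  have := Fb _ (fourierZ (-1)%:C Fv); rewrite e trnormZ//.
  by rewrite normc_real normrN1 mul1r lerNl.
exists (fun v => F v +i* - F ('i *: v)); split => //.
- move=> a v v' Fv Fv'; case: a => x y.
  have E1 : (x +i* y) *: v + v' = x%:C *: v + (y%:C *: ('i *: v) + v').
    rewrite addrA; congr (_ + _); rewrite scalerA -scalerDl; congr (_ *: _).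
    by apply/eqP; rewrite eq_complex /=; apply/andP; split; apply/eqP; ring.
  have E2 : 'i *: ((x +i* y) *: v + v') = x%:C *: ('i *: v) + ((- y)%:C *: v + 'i *: v').
    rewrite addrA scalerDr; congr (_ + _); rewrite !scalerA -scalerDl; congr (_ *: _).
    by apply/eqP; rewrite eq_complex /=; apply/andP; split; apply/eqP; ring.
  have G1 := fourierP y%:C (Fi v Fv) Fv'; have G2 := fourierP (- y)%:C Fv (Fi v' Fv').
  rewrite E2 E1 (Fl _ _ _ Fv G1) (Fl _ _ _ (Fi v Fv) Fv') (Fl _ _ _ (Fi v Fv) G2) (Fl _ _ _ Fv (Fi v' Fv')).
  by apply/eqP; rewrite eq_complex /=; apply/andP; split; apply/eqP; ring.
- move=> v Fv; have -> : F v +i* - F ('i *: v) = (F v)%:C + (- 'i) * (F ('i *: v))%:C.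
    by apply/eqP; rewrite eq_complex /=; apply/andP; split; apply/eqP; ring.
  apply: le_trans (le_normcD _ _) _; rewrite normcM normcN ni mul1r !normc_real.
  rewrite mulr_natl mulr2n lerD ?Fabs//; apply: le_trans (Fabs _ (Fi _ Fv)) _.
  by rewrite trnormZ// ni mul1r.
Qed.

(* The functional given by Hahn-Banach is evaluation at an operator [T], which
   lies in the bicommutant because it only sees the coefficients of [lreg]. *)
Lemma trnorm_dual u : fourier u -> exists T, [/\ VN T, forall f, N (T f) <= 2 * N f &
  complex.Re (fourier_pairing u T) = trnorm u].
Proof.
move=> Fu; have [F [Fl Fb Fe]] := complex_hahn_banach Fu.
have F0 : F 0 = 0.
  have Z : fourier (0 : G -> R[i]) by exact: fourier0.
  by have := Fl (-1) _ _ Z Z; rewrite scaler0 addr0 mulN1r addNr.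
have Fvec f g : normc (F (vec f g)) <= 2 * (N f * N g).
  apply: le_trans (Fb _ (fourier_vec f g)) _.
  by rewrite ler_pM2l//; exact: trnorm_le (rep_vec f g).
have ex f : exists t : L, forall g, F (vec f g) = l2dot t g.
  (* [F (vec f g)] is conjugate linear in [g], so Riesz is applied to its conjugate. *)
  have [|t tP] := @riesz R (l2hilbert) (fun g : L => Num.conj (F (vec f g))).
    split.
      move=> a g g'; rewrite vecPr Fl; [|exact: fourier_vec..].
      by rewrite rmorphD rmorphM /= conjK.
    exists (2 * N f) => [|g]; first by rewrite mulr_ge0 ?l2norm_ge0.
    by rewrite normc_conj -mulrA hnorm_l2.
  exists t => g; rewrite -[LHS]conjK; have := tP g => /= ->.
  by rewrite [RHS]l2dotC.
have [T TP] := choice ex.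
have Tlin a f f' : T (a *: f + f') = a *: T f + T f'.
  apply: l2dot_inj => g; rewrite -TP vecPl Fl; [|exact: fourier_vec..].
  by rewrite l2dotDl l2dotZl -!TP.
have Tb f : N (T f) <= 2 * N f.
  have [->|t0] := eqVneq (N (T f)) 0; first by rewrite mulr_ge0 ?l2norm_ge0.
  have tp : 0 < N (T f) by rewrite lt_def t0 l2norm_ge0.
  rewrite -(ler_pM2r tp) -expr2 -mulrA; apply: le_trans (Fvec f (T f)).
  by rewrite TP l2dotE normc_real ger0_norm// sqr_ge0.
have VT : VN T.
  split; first by split => //; exists 2.
  move=> U [bU UC]; apply/funext => f /=; apply: l2dot_inj => g.
  have bU' : bounded_op (@hnorm R (l2hilbert)) U by rewrite hnorm_l2.
  have [U' U'P] := adjoint_exists bU'.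
  have adj x y : l2dot (U x) y = l2dot x (U' y) by exact: U'P.
  (* Since [U] commutes with translations, moving it to the other side by its adjoint leaves the
     coefficient unchanged: [vec (U f) g = vec f (U' g)]. *)
  rewrite adj -!TP; congr (F _); apply/funext => s; rewrite /vec -adj.
  by have /(congr1 (fun h => h f)) /= := UC (lreg s) ltac:(by exists s); move=> <-.
exists T; split => //; rewrite -Fe; congr complex.Re.
have [c [xi [eta [rb uE]]]] := fourier_rep Fu; have [xo eo] := rep_by_l2 rb.
rewrite (pairing_vecstate xo eo uE VT); apply/eqP; rewrite -subr_eq0 -normc_eq0.
apply/eqP/le_anti; rewrite normc_ge0 andbT; apply/ler_addgt0Pr => e e0; rewrite add0r.
have e2 : 0 < e / 4 by rewrite divr_gt0.
have [n1 P1] := csum_nat_tail (abssum_vecstate xo eo VT.1) e2.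
have sq (y : nat -> L) n : 0 <= N (y n) ^+ 2 by rewrite sqr_ge0.
have [n2 P2] := nsum_tail (sq xi) xo e2; have [n3 P3] := nsum_tail (sq eta) eo e2.
(* [F] is known on finite sums of [vec]. Beyond [n] the rest of [u] has trace norm at most [e / 4],
   hence contributes at most [2 * (e / 4)] to [F u], and the rest of the pairing is below
   [e / 4]. *)
pose n := maxn n1 (maxn n2 n3).
have h1 : normc (vecstate xi eta T - \sum_(k < n) l2dot (T (xi k)) (eta k)) < e / 4.
  by apply: P1; rewrite leq_maxl.
have h2 := P2 n ltac:(by rewrite /n (leq_trans _ (leq_maxr _ _)) ?leq_maxl).
have h3 := P3 n ltac:(by rewrite /n (leq_trans _ (leq_maxr _ _)) ?leq_maxr).
pose tl (y : nat -> L) k : L := if (n <= k)%N then y k else 0.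
have tlE y : nsum (fun k => N (tl y k) ^+ 2) = nsum (fun k => if (n <= k)%N then N (y k) ^+ 2 else 0).
  by apply: eq_nsum => k; rewrite /tl; case: ifP => // _; rewrite l2norm0 expr0n.
have Fsum (m : nat) : fourier (\sum_(k < m) vec (xi k) (eta k)) /\
    F (\sum_(k < m) vec (xi k) (eta k)) = \sum_(k < m) l2dot (T (xi k)) (eta k).
  elim: m => [|m [IH1 IH2]]; first by rewrite !big_ord0; split => //; exact: fourier0.
  rewrite !big_ord_recr/=; split; first by apply: fourierD => //; exact: fourier_vec.
  by rewrite -[X in F (X + _)]scale1r Fl ?mul1r ?IH2 -?TP//; exact: fourier_vec.
have [Fs FsE] := Fsum n.
have rt : rep (u - \sum_(k < n) vec (xi k) (eta k)) (e / 4).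
  exists (tl xi), (tl eta); split; first by split; rewrite tlE ltW.
  apply/funext => s.
  have -> : (u - \sum_(k < n) vec (xi k) (eta k)) s = u s - \sum_(k < n) vec (xi k) (eta k) s.
    congr (_ - _); elim/big_rec2: _ => // k y1 y2 _ <-; by [].
  have ab := abssum_vecstate xo eo (lreg_bounded s).
  have -> : u s = vecstate xi eta (lreg s) by rewrite uE.
  rewrite /vecstate (csum_nat_split n ab) addrC addrA [X in X + _]addNr add0r.
  by apply: eq_csum => k; rewrite /tl; case: ifP => // _; rewrite l2dot0r.
have FuE : F u = F (u - \sum_(k < n) vec (xi k) (eta k)) + \sum_(k < n) l2dot (T (xi k)) (eta k).
  rewrite -FsE -[X in X + _]mul1r -Fl ?scale1r ?subrK//; exact: rep_fourier rt.
rewrite FuE opprD addrCA addrC; apply: le_trans (le_normcD _ _) _.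
have := Fb _ (rep_fourier rt); have := trnorm_le rt; rewrite normcN.
move: h1; set p := normc _; set q := normc _; set r := trnorm _ => ? ? ?; lra.
Qed.

(** The operator of [trnorm_dual] has bound 2 and pairs with [u] to real part [trnorm u]. *)
Lemma trnorm_fourier_norm u (M : R) : fourier u -> 0 <= M -> (fourier_norm u <= M%:E)%E ->
  trnorm u <= 2 * M.
Proof.
move=> Fu M0 uM; have [T [VT TB <-]] := trnorm_dual Fu.
apply: le_trans (ler_norm _) _; apply: le_trans (ler_Re_normc _) _.
exact: pairing_bound.
Qed.

Lemma nsum_nat_le (c : nat -> R) (C : R) : (forall n, 0 <= c n) ->
  (forall n, \sum_(k < n) c k <= C) -> (nsum c <= C%:E)%E.
Proof.
move=> c0 cC; apply: nsum_le_seq => r ur; rewrite lee_fin.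
pose n := (\max_(k <- r) k).+1; apply: le_trans (cC n).
rewrite -(big_mkord xpredT c) [leRHS](bigID (mem r))/= -[X in _ <= X + _]big_filter.
have pr : perm_eq [seq k <- index_iota 0 n | k \in r] r; last first.
  by rewrite (perm_big _ pr) lerDl sumr_ge0.
apply: uniq_perm => //; first by rewrite filter_uniq ?iota_uniq.
move=> k; rewrite mem_filter mem_index_iota/=; case kr: (k \in r) => //=.
rewrite ltnS; exact: (@leq_bigmax_seq _ _ xpredT id k kr isT).
Qed.

(** The limit is the telescoping series of the increments, each lifted to vectors of summable size.
    The tail of the same series represents [f - f_ m], which gives convergence in norm. *)
Lemma fourier_complete (f_ : nat -> G -> R[i]) (C : R) : 0 < C -> (forall n, fourier (f_ n)) ->
  (forall n, (fourier_norm (f_ n.+1 - f_ n)%R <= (C / 2 ^+ n)%:E)%E) ->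
  exists2 f, fourier f & forall e : R, 0 < e -> exists n, forall m, (n <= m)%N ->
    (fourier_norm (f - f_ m)%R <= e%:E)%E.
Proof.
move=> C0 Ff fC; pose g k := f_ k.+1 - f_ k.
have Fg k : fourier (g k).
  by rewrite /g addrC -scaleN1r; apply: fourierP.
(* The trace norm of an increment is at most twice its Fourier norm; 3 in place of 2 gives the
   strict inequality under which a representation exists, the infimum perhaps not being attained. *)
pose c k := 3 * (C / 2 ^+ k).
have c0 k : 0 < c k by rewrite mulr_gt0// divr_gt0// exprn_gt0.
have rg k : rep (g k) (c k).
  apply: trnorm_lt => //; have h : 0 < C / 2 ^+ k by rewrite divr_gt0// exprn_gt0.
  have := trnorm_fourier_norm (Fg k) (ltW h) (fC k); rewrite /c => ?; lra.
have co : (nsum c <= (6 * C)%:E)%E.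
  apply: nsum_nat_le => [k|n]; first exact: ltW.
  suff -> : \sum_(k < n) c k = 6 * C - 6 * (C / 2 ^+ n).
    by rewrite gerBl mulr_ge0// divr_ge0 ?(ltW C0)// exprn_ge0.
  elim: n => [|n IH]; first by rewrite big_ord0 expr0 divr1 subrr.
  rewrite big_ord_recr/= IH /c exprS; field.
  by rewrite expf_neq0.
have [ag rf] := rep_sum rg co.
pose f := f_ 0%N + (fun s => csum (g^~ s)).
exists f; first by apply: fourierD => //; exact: rep_fourier rf.
move=> e e0.
have coo : (nsum c < +oo)%E by apply: le_lt_trans co _; rewrite ltry.
have [n nP] := nsum_tail (fun k => ltW (c0 k)) coo e0; exists n => m nm.
apply: rep_fourier_norm => //.
pose t k : G -> R[i] := if (m <= k)%N then g k else 0.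
have rt k : rep (t k) (if (m <= k)%N then c k else 0).
  by rewrite /t; case: ifP => _ //; exact: rep0.
have [_ rft] := rep_sum rt (ltW (nP m nm)).
suff -> : f - f_ m = (fun s => csum (t^~ s)) by [].
apply/funext => s; have -> : (f - f_ m) s = f_ 0%N s + csum (g^~ s) - f_ m s by [].
rewrite (csum_nat_split m (ag s)) addrA.
have -> : \sum_(k < m) g k s = f_ m s - f_ 0%N s.
  elim: (m) => [|j IH]; first by rewrite big_ord0 subrr.
  rewrite big_ord_recr/= IH; have -> : g j s = f_ j.+1 s - f_ j s by [].
  by rewrite addrC addrA subrK.
rewrite [f_ 0%N s + _]addrC subrK addrAC subrr add0r.
by apply: eq_csum => k; rewrite /t; case: ifP.
Qed.

End TraceNorm.

(** * Square summable functions and multiplication by bounded functions *)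

Section L2Tools.
Context {R : realType}.

Lemma esum_nat_trunc (a : nat -> \bar R) n : (forall k, (0 <= a k)%E) ->
  (forall k, (n <= k)%N -> a k = 0%E) -> (\esum_(k in [set: nat]) a k = \sum_(k < n) a k)%E.
Proof.
move=> a0 an; transitivity (\esum_(k in `I_n) a k)%E.
  rewrite [RHS]esum_mkcond; apply: eq_esum => k _; case: ifPn => //.
  by rewrite notin_setE/= => /negP; rewrite -leqNgt => /an.
by rewrite esum_fset//; symmetry; exact: fsbig_ord.
Qed.

Lemma nsum_option (I : choiceType) (a : option I -> R) : (forall o, 0 <= a o) ->
  nsum a = ((a None)%:E + nsum (fun i => a (Some i)))%E.
Proof.
move=> a0; rewrite /nsum (esumID [set None]); last by move=> *; rewrite lee_fin.
rewrite setTI esum_set1 ?lee_fin//; congr (_ + _)%E; rewrite setTI.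
have -> : ~` [set None] = Some @` [set: I].
  apply/seteqP; split => [[i|] //=|_ [i _ <-] //]; by exists i.
by rewrite esum_image//; move=> i j _ _ [].
Qed.

Lemma nsum_lin2 (I : choiceType) (f : I -> R) (c : R) : 0 <= c -> (forall i, 0 <= f i) ->
  (nsum f < +oo)%E -> (nsum (fun i => (c * f i)%R) < +oo)%E.
Proof. by move=> c0 f0 fo; rewrite nsumZ// lte_mul_pinfty// lee_fin. Qed.

Section ToL2.
Context {I : choiceType}.
Implicit Types (u h : I -> R[i]) (v : l2space R I).

(** The value is 0 when [u] is not square summable, so that operators can be defined as total
    functions before their boundedness is proved. *)
Definition to_l2 : (I -> R[i]) -> l2space R I := locked (fun u => insubd 0 u).

Lemma to_l2E u i : (sqsum u < +oo)%E -> to_l2 u i = u i.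
Proof. by move=> uo; rewrite /to_l2 -lock insubdK//; exact: l2_pred_fin. Qed.

Lemma sqsum_to_l2 u : (sqsum u < +oo)%E -> sqsum (to_l2 u) = sqsum u.
Proof. by move=> uo; apply: eq_nsum => i; rewrite to_l2E. Qed.

Definition bounded_fun h := exists c : R, forall i, normc (h i) <= c.

Lemma bounded_funM h h' : bounded_fun h -> bounded_fun h' -> bounded_fun (h * h').
Proof.
move=> [c hc] [c' hc']; exists (c * c') => i; rewrite [normc _]normcM.
by apply: ler_pM; rewrite ?normc_ge0.
Qed.

Lemma bounded_funP a h h' : bounded_fun h -> bounded_fun h' -> bounded_fun (a *: h + h').
Proof.
move=> [c hc] [c' hc']; exists (normc a * c + c') => i.
apply: le_trans (le_normcD _ _) _; apply: lerD => //.
by rewrite [normc _]normcM ler_wpM2l ?normc_ge0.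
Qed.

Lemma bounded_mul_fin h u : bounded_fun h -> (sqsum u < +oo)%E -> (sqsum (h * u)%R < +oo)%E.
Proof.
move=> [c hc] uo; apply: (@le_lt_trans _ _ (nsum (fun i => c ^+ 2 * normc (u i) ^+ 2))).
  apply: le_nsum => i; rewrite [normc _]normcM exprMn ler_wpM2r ?sqr_ge0//.
  by rewrite ler_pXn2r ?nnegrE ?normc_ge0// (le_trans (normc_ge0 _) (hc i)).
by apply: nsum_lin2 => //; rewrite ?sqr_ge0// => i; rewrite sqr_ge0.
Qed.

Definition mulL h v : l2space R I := to_l2 (h * v).

Lemma mulLE h v i : bounded_fun h -> mulL h v i = h i * v i.
Proof. by move=> hb; rewrite to_l2E//; apply: bounded_mul_fin => //; exact: l2space_fin. Qed.

Lemma mulL_linear h a v v' : bounded_fun h -> mulL h (a *: v + v') = a *: mulL h v + mulL h v'.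
Proof.
move=> hb; apply: l2space_inj => i.
by rewrite l2addE l2scaleE !mulLE// l2addE l2scaleE mulrDr mulrCA.
Qed.

Lemma mulLPl h h' a v : bounded_fun h -> bounded_fun h' ->
  mulL (a *: h + h') v = a *: mulL h v + mulL h' v.
Proof.
move=> hb hb'; apply: l2space_inj => i.
rewrite l2addE l2scaleE !mulLE//; last exact: bounded_funP.
by rewrite mulrA -mulrDl.
Qed.

Lemma mulLM h h' h'' v : bounded_fun h -> bounded_fun h' -> bounded_fun h'' ->
  (forall i, h'' i = h i * h' i) -> mulL h (mulL h' v) = mulL h'' v.
Proof. by move=> b b' b'' e; apply: l2space_inj => i; rewrite !mulLE// mulrA e. Qed.

Lemma mulLD h v v' : bounded_fun h -> mulL h (v + v') = mulL h v + mulL h v'.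
Proof. by move=> hb; rewrite -[v]scale1r mulL_linear// !scale1r. Qed.

Lemma mulL0 h : bounded_fun h -> mulL h 0 = 0.
Proof. by move=> hb; apply: l2space_inj => i; rewrite mulLE// mulr0. Qed.

Lemma l2_bounded u : (sqsum u < +oo)%E -> bounded_fun u.
Proof.
move=> uo; exists (l2norm (to_l2 u)) => i.
by rewrite -(to_l2E i uo) ler_l2norm_term.
Qed.

Lemma l2norm_sum_delta (J : finType) (e : J -> I) (a : J -> R[i]) : injective e ->
  l2norm (\sum_j a j *: l2delta (e j)) ^+ 2 = \sum_j normc (a j) ^+ 2.
Proof.
move=> ei; apply: (@complexI R); rewrite -l2dotE l2dot_suml rmorph_sum; apply: eq_bigr => j _.
transitivity (a j * Num.conj (a j)); last by rewrite mulc_conj.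
rewrite l2dotZl l2dotC l2dot_delta; congr (_ * Num.conj _).
rewrite l2sumE (bigD1 j)//= big1 => [|k kj].
  by rewrite addr0 -[LHS]/(a j * (e j == e j)%:R) eqxx mulr1.
by rewrite -[LHS]/(a k * (e j == e k)%:R) (inj_eq ei) eq_sym (negPf kj) mulr0.
Qed.

End ToL2.

End L2Tools.

(** * The operator algebra attached to a square summable [w] *)

Section Ball.
Context {R : realType} {G : groupType}.
Local Notation L := (l2space R G).
Local Notation N := (@l2norm R G).

(** Contractive matrices over [VN] of all sizes at once: the matrix norms of [A(G)] are suprema over
    exactly this family, so a direct sum indexed by it can recover them. *)
Definition ball : Type := {n : nat & {X : 'M[L -> L]_n |
  (forall k l, VN (X k l)) /\ (op_mxnorm N X <= 1)%E}}.
Definition bsz (X : {classic ball}) : nat := projT1 (X : ball).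
Definition bmx (X : {classic ball}) : 'M[L -> L]_(bsz X) := proj1_sig (projT2 (X : ball)).

Lemma bmx_VN X k l : VN (bmx X k l).
Proof. by have [] := proj2_sig (projT2 (X : ball)). Qed.

Lemma bmx_norm X : (op_mxnorm N (bmx X) <= 1)%E.
Proof. by have [] := proj2_sig (projT2 (X : ball)). Qed.

(** The row number is a natural number rather than an ordinal of bound [bsz X], so that the index is
    a product and the slicing lemmas apply; the rows from [bsz X] on are idle and the operators
    vanish there. *)
Definition ball_index : choiceType := ({classic ball} * (nat * option (option G)))%type.
Local Notation H := (l2space R ball_index).
Implicit Types (Z : H) (u f g : G -> R[i]).

Lemma pairing_vec (f g : L) (T : L -> L) : VN T -> fourier_pairing (vec f g) T = l2dot (T f) g.
Proof.
move=> VT; pose y h (n : nat) : L := if n is 0%N then h else 0.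
have yo h : l2seq (y h).
  by rewrite /l2seq (nsum_supp1 (i0 := 0%N)) ?ltry ?sqr_ge0// => -[//|n] _; rewrite l2norm0 expr0n.
have vE U : vecstate (y f) (y g) U = l2dot (U f) g.
  by rewrite /vecstate (csum1 (i0 := 0%N))// => -[//|n] _; rewrite l2dot0r.
rewrite (pairing_vecstate (yo f) (yo g) _ VT) ?vE//.
by apply/funext => s; rewrite /= vE.
Qed.

Definition conj_l2 u : L := to_l2 (fun s => Num.conj (u s)).

(** [<lambda(s) delta_1, conj u> = u(s)]: a square summable function is a coefficient of the regular
    representation, hence in [A(G)], and its pairing with [T] reads off [T delta_1]. *)
Lemma vec_conj u : (sqsum u < +oo)%E -> vec (l2delta 1%g) (conj_l2 u) = u.
Proof.
move=> uo; apply/funext => s; rewrite /vec lreg_delta mulg1 l2dotC l2dot_delta.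
by rewrite to_l2E ?sqsum_conj// conjK.
Qed.

Lemma l2_fourier u : (sqsum u < +oo)%E -> fourier u.
Proof. by move=> uo; rewrite -(vec_conj uo); exact: fourier_vec. Qed.

Lemma pairing_l2 u (T : L -> L) : (sqsum u < +oo)%E -> VN T ->
  fourier_pairing u T = l2dot (T (l2delta 1%g)) (conj_l2 u).
Proof. by move=> uo VT; rewrite -{1}(vec_conj uo) pairing_vec. Qed.

(** The matrix norm is tested on the single contraction [lreg s], whose pairing with [u i j] is
    evaluation at [s]: evaluations are completely contractive. *)
Lemma fourier_mxnorm_pt n (u : 'M[G -> R[i]]_n) (M : R) s : 0 <= M ->
  (forall i j, fourier (u i j)) -> (fourier_mxnorm u <= M%:E)%E -> forall z : 'I_n -> R[i],
  \sum_i normc (\sum_j u i j s * z j) ^+ 2 <= M ^+ 2 * \sum_j normc (z j) ^+ 2.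
Proof.
move=> M0 Fu uM z; pose X : 'M[L -> L]_1 := const_mx (lreg s).
have VX k l : VN (X k l) by rewrite mxE; exact: VN_lreg.
have X1 : (op_mxnorm N X <= 1)%E.
  by apply: opnorm_le => // x; rewrite !big_ord1 mxE expr1n mul1r l2norm_lreg.
have := fourier_mxnormP M0 uM VX X1 (fun q => z q.2).
have E (V : zmodType) (F : 'I_1 * 'I_n -> V) : \sum_p F p = \sum_j F (ord0, j).
  rewrite (eq_bigr (fun p => F (p.1, p.2))); last by case.
  by rewrite -(pair_bigA _ (fun k i => F (k, i)))/= big_ord1.
rewrite !E; apply: le_trans; apply: le_of_eq.
apply: eq_bigr => i _; congr (normc _ ^+ 2); rewrite E; apply: eq_bigr => j _.
by rewrite mxE pairing_lreg.
Qed.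

Lemma fourier_bounded u : fourier u -> bounded_fun u.
Proof.
move=> Fu; have [c rc] := fourier_rep Fu; have c0 := rep_ge0 rc.
have c1 : 0 < c + 1 by rewrite ltr_wpDl.
have uM := rep_fourier_norm c1 (rep_le (ler_wpDr ler01 (lexx c)) rc).
exists (c + 1) => s; have := @fourier_mxnorm_pt 1 (const_mx u) _ s (ltW c1) _ uM (fun=> 1).
rewrite !big_ord1 mxE mulr1 normc1 expr1n mulr1 => /(_ _).
rewrite ler_pXn2r ?nnegrE ?normc_ge0 ?(ltW c1)//; apply => i j; by rewrite mxE.
Qed.

(** On [l2] a matrix of multiplication operators splits into scalar matrices, one for each point
    [s]; the pointwise bound is summed over [s]. *)
Lemma mulL_mxnorm n (u : 'M[G -> R[i]]_n) (M : R) : 0 <= M ->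
  (forall i j, fourier (u i j)) -> (fourier_mxnorm u <= M%:E)%E -> forall v : 'I_n -> L,
  \sum_i N (\sum_j mulL (u i j) (v j)) ^+ 2 <= M ^+ 2 * \sum_j N (v j) ^+ 2.
Proof.
move=> M0 Fu uM v; rewrite -lee_fin EFinM -!sumEFin.
have E (y : 'I_n -> L) : (\sum_i (N (y i) ^+ 2)%:E = \sum_i sqsum (y i))%E.
  by apply: eq_bigr => i _; rewrite sqr_l2norm.
rewrite !E.
have E2 (y : 'I_n -> L) : (\sum_i sqsum (y i) = nsum (fun s => \sum_i normc (y i s) ^+ 2)%R)%E.
  by rewrite nsum_sum// => j i; rewrite sqr_ge0.
rewrite !E2 -nsumZ ?sqr_ge0//; last first.
  by move=> s; apply: sumr_ge0 => j _; rewrite sqr_ge0.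
apply: le_nsum => s; apply: le_trans (fourier_mxnorm_pt s M0 Fu uM (fun j => v j s)).
apply: le_of_eq; apply: eq_bigr => i _.
rewrite l2sumE; congr (normc _ ^+ 2); apply: eq_bigr => j _.
by rewrite mulLE//; exact: fourier_bounded.
Qed.

Definition zrow Z X k : l2space R (option (option G)) := slice (slice Z X) k.
Definition zbot Z X k : R[i] := Z (X, (k, None)).
Definition zmid Z X k : L := to_l2 (fun s => Z (X, (k, Some (Some s)))).

Lemma sqsum_row (v : option (option G) -> R[i]) :
  sqsum v = ((normc (v None) ^+ 2)%:E + ((normc (v (Some None)) ^+ 2)%:E +
    sqsum (fun s => v (Some (Some s)))))%E.
Proof.
rewrite /sqsum nsum_option; last by move=> o; rewrite sqr_ge0.
by rewrite nsum_option// => o; rewrite sqr_ge0.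
Qed.

Lemma zmid_fin Z X k : (sqsum (fun s => Z (X, (k, Some (Some s)))) < +oo)%E.
Proof.
have := l2space_fin (zrow Z X k); rewrite sqsum_row; apply: le_lt_trans.
by rewrite addeA leeDr// adde_ge0// lee_fin sqr_ge0.
Qed.

Lemma zmidE Z X k s : zmid Z X k s = Z (X, (k, Some (Some s))).
Proof. by rewrite to_l2E//; exact: zmid_fin. Qed.

Lemma zbot_linear a Z Z' X k : zbot (a *: Z + Z') X k = a * zbot Z X k + zbot Z' X k.
Proof. by []. Qed.

Lemma zmid_linear a Z Z' X k : zmid (a *: Z + Z') X k = a *: zmid Z X k + zmid Z' X k.
Proof. by apply: l2space_inj => s; rewrite l2addE l2scaleE !zmidE. Qed.

Lemma zblock_le Z X n :
  \sum_(k < n) (normc (zbot Z X k) ^+ 2 + N (zmid Z X k) ^+ 2) <= l2norm (slice Z X) ^+ 2.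
Proof.
rewrite -lee_fin sqr_l2norm_slices -sumEFin.
have H (f : nat -> R) : (forall k, 0 <= f k) -> ((\sum_(k < n) (f k)%:E) <= nsum f)%E.
  move=> f0; rewrite sumEFin -(big_mkord xpredT f) -/(index_iota 0 n).
  by apply: nsum_ge_seq => //; exact: iota_uniq.
apply: le_trans (H (fun k => l2norm (slice (slice Z X) k) ^+ 2) _); last by move=> k; rewrite sqr_ge0.
apply: lee_sum => k _; rewrite sqr_l2norm sqsum_row EFinD leeD2l// sqr_l2norm.
rewrite /zmid sqsum_to_l2; last exact: zmid_fin.
by rewrite leeDr// lee_fin sqr_ge0.
Qed.

End Ball.

Arguments zbot {R G} Z X k : simpl never.

Section Representation.
Context {R : realType} {G : groupType}.
Local Notation L := (l2space R G).
Local Notation N := (@l2norm R G).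
Local Notation H := (l2space R (@ball_index R G)).
Variable w : G -> R[i].
Hypothesis wo : (sqsum w < +oo)%E.
Implicit Types (Z : H) (u f g : G -> R[i]).

Let W : R := fine (sqsum w).

Let wb : bounded_fun w := l2_bounded wo.

Let W0 : 0 <= W.
Proof. exact: fine_ge0 (sqsum_ge0 w). Qed.

Let nw : N (conj_l2 w) ^+ 2 = W.
Proof.
apply: EFin_inj; rewrite sqr_l2norm sqsum_to_l2 sqsum_conj//.
by rewrite (sqsum_fin wo).
Qed.

Let w_le s : normc (w s) ^+ 2 <= W.
Proof.
rewrite -lee_fin /W -(sqsum_fin wo).
by apply: (nsum_ge_term (f := fun s => normc (w s) ^+ 2)) => t; rewrite sqr_ge0.
Qed.

(** The vector [X (z delta_1)] for the bottom component [z] of the block. Multiplied by [f] it is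
    the column entry [f X] of the block, and it is no longer than [z] because [X] is contractive and
    [delta_1] a unit vector. *)
Definition zconv Z (X : {classic ball}) (k : 'I_(bsz X)) : L :=
  \sum_l bmx X k l (zbot Z X l *: l2delta 1%g).

(* The block at [X] is the upper triangular matrix [[0, row(w f), <f, X>],
   [0, diag(w f), col(f X)], [0, 0, 0]] on C^n + l2(G)^n + C^n; the coordinates
   of the three summands are labelled [Some None], [Some (Some _)], [None]. *)
Definition rep_fun f Z (x : @ball_index R G) : R[i] :=
  let: (X, (k, o)) := x in
  if insub k is Some k' then
    match o with
    | None => 0
    | Some None => l2dot (mulL f (zmid Z X k)) (conj_l2 w) +
        \sum_l fourier_pairing f (bmx X k' l) * zbot Z X l
    | Some (Some s) => (mulL w (mulL f (zmid Z X k)) + mulL f (zconv Z k')) s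
    end
  else 0.

Lemma rep_funE f Z X (k : 'I_(bsz X)) o : rep_fun f Z (X, (k : nat, o)) =
    match o with
    | None => 0
    | Some None => l2dot (mulL f (zmid Z X k)) (conj_l2 w) +
        \sum_l fourier_pairing f (bmx X k l) * zbot Z X l
    | Some (Some s) => (mulL w (mulL f (zmid Z X k)) + mulL f (zconv Z k)) s
    end.
Proof. by rewrite /rep_fun valK. Qed.

Lemma rep_fun_out f Z X k o : (bsz X <= k)%N -> rep_fun f Z (X, (k, o)) = 0.
Proof. by move=> le; rewrite /rep_fun insubF// ltnNge le. Qed.

Lemma rep_fun_bot f Z X k : rep_fun f Z (X, (k, None)) = 0.
Proof. by rewrite /rep_fun; case: insub. Qed.

Lemma zconv_linear a Z Z' X (k : 'I_(bsz X)) :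
  zconv (a *: Z + Z') k = a *: zconv Z k + zconv Z' k.
Proof.
rewrite /zconv scaler_sumr -big_split/=; apply: eq_bigr => l _.
by rewrite zbot_linear scalerDl -scalerA (VN_linear (bmx_VN k l)).
Qed.

Lemma rep_fun_linear f a Z Z' x : fourier f ->
  rep_fun f (a *: Z + Z') x = a * rep_fun f Z x + rep_fun f Z' x.
Proof.
move=> Ff; have fb := fourier_bounded Ff; case: x => X [k o].
have [le|lt] := leqP (bsz X) k; first by rewrite !rep_fun_out// mulr0 addr0.
rewrite -[k]/(nat_of_ord (Ordinal lt)) !rep_funE; move: (Ordinal lt) => {lt}k'.
case: o => [[s|]|]; last by rewrite mulr0 addr0.
  rewrite zmid_linear mulL_linear// zconv_linear !mulL_linear// !l2addE !l2scaleE.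
  by rewrite mulrDr addrACA.
rewrite zmid_linear mulL_linear// l2dotDl l2dotZl mulrDr addrACA; congr (_ + _).
rewrite mulr_sumr -big_split/=; apply: eq_bigr => l _.
by rewrite zbot_linear mulrDr mulrCA.
Qed.

Lemma rep_funPl f g a Z x : fourier f -> fourier g ->
  rep_fun (a *: f + g) Z x = a * rep_fun f Z x + rep_fun g Z x.
Proof.
move=> Ff Fg; have fb := fourier_bounded Ff; have gb := fourier_bounded Fg; case: x => X [k o].
have [le|lt] := leqP (bsz X) k; first by rewrite !rep_fun_out// mulr0 addr0.
rewrite -[k]/(nat_of_ord (Ordinal lt)) !rep_funE; move: (Ordinal lt) => {lt}k'.
case: o => [[s|]|]; last by rewrite mulr0 addr0.
  rewrite !mulLPl// mulL_linear// !l2addE !l2scaleE.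
  by rewrite mulrDr addrACA.
rewrite mulLPl// l2dotDl l2dotZl mulrDr addrACA; congr (_ + _).
rewrite mulr_sumr -big_split/=; apply: eq_bigr => l _.
by rewrite pairingPl//; [rewrite mulrDl mulrA|exact: bmx_VN].
Qed.

Let normc_sqD (x y : R[i]) : normc (x + y) ^+ 2 <= 2 * normc x ^+ 2 + 2 * normc y ^+ 2.
Proof.
apply: (@le_trans _ _ ((normc x + normc y) ^+ 2)).
  by rewrite ler_pXn2r ?nnegrE ?addr_ge0 ?normc_ge0// le_normcD.
have := sqr_ge0 (normc x - normc y); rewrite sqrrB sqrrD.
by set a := normc x; set b := normc y; rewrite !mulr2n => ?; lra.
Qed.

Let l2norm_sqD (x y : L) : N (x + y) ^+ 2 <= 2 * N x ^+ 2 + 2 * N y ^+ 2.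
Proof.
apply: (@le_trans _ _ ((N x + N y) ^+ 2)).
  by rewrite ler_pXn2r ?nnegrE ?addr_ge0 ?l2norm_ge0// l2normD.
have := sqr_ge0 (N x - N y); rewrite sqrrB sqrrD.
by set a := N x; set b := N y; rewrite !mulr2n => ?; lra.
Qed.

Let mulw_le v : N (mulL w v) ^+ 2 <= W * N v ^+ 2.
Proof.
rewrite -lee_fin sqr_l2norm EFinM sqr_l2norm /sqsum -nsumZ//; last by move=> s; rewrite sqr_ge0.
apply: le_nsum => s; rewrite mulLE// normcM exprMn ler_wpM2r ?sqr_ge0//.
Qed.

Lemma zconv_le Z X : \sum_k N (@zconv Z X k) ^+ 2 <= \sum_(l < bsz X) normc (zbot Z X l) ^+ 2.
Proof.
apply: le_trans (mxnormP (@bmx_VN _ _ X) (bmx_norm X) _) _.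
apply: ler_sum => l _; rewrite l2normZ l2norm_delta mulr1 //.
Qed.

Section Family.
Variables (n : nat) (F : 'M[G -> R[i]]_n) (M : R) (Z : 'I_n -> H).
Hypotheses (M0 : 0 <= M) (FF : forall i j, fourier (F i j)).
Hypothesis FM : (fourier_mxnorm F <= M%:E)%E.

Let Y i X k : L := \sum_j mulL (F i j) (zmid (Z j) X k).

(** The [i]-th component of the amplification of the representation to the matrix [F], applied to
    the vectors [Z]. Estimating it for all [n] at once is what complete boundedness requires. *)
Let out i x := \sum_j rep_fun (F i j) (Z j) x.

Let outE i X (k : 'I_(bsz X)) o : out i (X, (k : nat, o)) =
  match o with
  | None => 0
  | Some None => l2dot (Y i X k) (conj_l2 w) +
     \sum_j \sum_l fourier_pairing (F i j) (bmx X k l) * zbot (Z j) X l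
  | Some (Some s) => (mulL w (Y i X k) + \sum_j mulL (F i j) (zconv (Z j) k)) s
  end.
Proof.
rewrite /out; under eq_bigr do rewrite rep_funE; case: o => [[s|]|]; last by rewrite big1.
  rewrite l2addE /Y.
  have -> : mulL w (\sum_j mulL (F i j) (zmid (Z j) X k)) =
      \sum_j mulL w (mulL (F i j) (zmid (Z j) X k)).
    elim/big_rec2: _ => [|j y1 y2 _ <-]; first by rewrite mulL0.
    by rewrite -[X in mulL w (X + _)]scale1r mulL_linear// scale1r.
  rewrite !l2sumE -big_split; apply: eq_bigr => j _; by rewrite l2addE.
by rewrite big_split/= /Y l2dot_suml.
Qed.

(** The top component is a sum of the row term and the corner term, the middle one of the diagonal
    and the column term; each sum costs a factor 2. The row and the diagonal are both bounded by
    [W], giving [4 W] on the middle input, while the corner and the column are bounded by [M] alone,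
    giving 4 on the bottom input. The constant [4 (W + 1)] covers both. *)
Lemma block_le X : (\sum_i sqsum (fun p => out i (X, p)) <=
  (4 * (W + 1) * M ^+ 2 * \sum_j l2norm (slice (Z j) X) ^+ 2)%:E)%E.
Proof.
pose t i k := l2dot (Y i X k) (conj_l2 w).
pose c i (k : 'I_(bsz X)) := \sum_j \sum_l fourier_pairing (F i j) (bmx X k l) * zbot (Z j) X l.
pose v i (k : 'I_(bsz X)) : L := mulL w (Y i X k) + \sum_j mulL (F i j) (zconv (Z j) k).
have E i : sqsum (fun p => out i (X, p)) = (\sum_(k < bsz X) (normc (t i k + c i k) ^+ 2 + N (v i k) ^+ 2))%:E.
  rewrite sqsum_prod (@esum_nat_trunc _ _ (bsz X)).
  - rewrite -sumEFin; apply: eq_bigr => k _; rewrite sqsum_row !outE normc0 expr0n add0e.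
    rewrite EFinD sqr_l2norm; congr (_ + _)%E; apply: eq_nsum => s; by rewrite outE.
  - by move=> k; exact: sqsum_ge0.
  - move=> k le; rewrite /sqsum /nsum esum1// => o _.
    by rewrite /out big1 ?normc0 ?expr0n// => j _; rewrite rep_fun_out.
under eq_bigr do rewrite E.
rewrite sumEFin lee_fin.
have step1 : \sum_i \sum_(k < bsz X) (normc (t i k + c i k) ^+ 2 + N (v i k) ^+ 2) <=
  \sum_i \sum_(k < bsz X) (4 * W * N (Y i X k) ^+ 2 + 2 * normc (c i k) ^+ 2 +
     2 * N (\sum_j mulL (F i j) (zconv (Z j) k)) ^+ 2).
  apply: ler_sum => i _; apply: ler_sum => k _.
  have h1 := normc_sqD (t i k) (c i k).
  have h2 := l2norm_sqD (mulL w (Y i X k)) (\sum_j mulL (F i j) (zconv (Z j) k)).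
  have h3 := mulw_le (Y i X k).
  have h4 : normc (t i k) ^+ 2 <= W * N (Y i X k) ^+ 2.
    rewrite mulrC -nw -exprMn ler_pXn2r ?nnegrE ?normc_ge0 ?mulr_ge0 ?l2norm_ge0//.
    exact: l2CauchySchwarz.
  rewrite -/(v i k) in h2.
  move: h1 h2 h3 h4; set a1 := normc _ ^+ 2; set a2 := normc _ ^+ 2; set a3 := normc _ ^+ 2.
  set a4 := N _ ^+ 2; set a5 := N _ ^+ 2; set a6 := N _ ^+ 2; set a7 := N _ ^+ 2 => *; lra.
apply: le_trans step1 _.
under eq_bigr do rewrite !big_split/=.
rewrite !big_split/=.
pose B0 := \sum_j \sum_(l < bsz X) normc (zbot (Z j) X l) ^+ 2.
pose M1 := \sum_j \sum_(k < bsz X) N (zmid (Z j) X k) ^+ 2.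
have sY : \sum_i \sum_(k < bsz X) 4 * W * N (Y i X k) ^+ 2 <=
    4 * W * (M ^+ 2 * M1).
  rewrite /M1 exchange_big/= [X in _ <= _ * (_ * X)]exchange_big/= mulr_sumr mulr_sumr.
  apply: ler_sum => k _; rewrite -mulr_sumr ler_wpM2l ?mulr_ge0//.
  exact: mulL_mxnorm.
have sD : \sum_i \sum_(k < bsz X) 2 * N (\sum_j mulL (F i j) (zconv (Z j) k)) ^+ 2 <=
    2 * (M ^+ 2 * B0).
  rewrite exchange_big/=.
  apply: (@le_trans _ _ (\sum_(k < bsz X) 2 * (M ^+ 2 * \sum_j N (zconv (Z j) k) ^+ 2))).
    by apply: ler_sum => k _; rewrite -mulr_sumr ler_pM2l//; exact: mulL_mxnorm.
  rewrite -mulr_sumr ler_pM2l// -mulr_sumr ler_wpM2l ?sqr_ge0// exchange_big/=.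
  by apply: ler_sum => j _; exact: zconv_le.
have sc : \sum_i \sum_(k < bsz X) 2 * normc (c i k) ^+ 2 <=
    2 * (M ^+ 2 * B0).
  under eq_bigr do rewrite -mulr_sumr.
  rewrite -mulr_sumr ler_pM2l//.
  (* The corner is the pairing of [F] with the contraction [bmx X], so the definition of the matrix
     norm bounds it directly. *)
  have := fourier_mxnormP M0 FM (@bmx_VN _ _ X) (bmx_norm X) (fun q => zbot (Z q.2) X q.1).
  rewrite -(pair_bigA _ (fun (l : 'I_(bsz X)) (j : 'I_n) => normc (zbot (Z j) X l) ^+ 2))/=.
  rewrite [X in _ <= _ * X -> _]exchange_big/=; apply: le_trans.
  rewrite -(pair_bigA _ (fun (k : 'I_(bsz X)) (i : 'I_n) => normc (\sum_q fourier_pairing (F i q.2) (bmx X k q.1) *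
                 zbot (Z q.2) X q.1) ^+ 2))/= exchange_big/=.
  apply: ler_sum => k _; apply: ler_sum => i _.
  rewrite -(pair_bigA _ (fun (l : 'I_(bsz X)) (j : 'I_n) => fourier_pairing (F i j) (bmx X k l) * zbot (Z j) X l))/=.
  by rewrite exchange_big.
have tot : B0 + M1 <= \sum_j l2norm (slice (Z j) X) ^+ 2.
  rewrite -big_split; apply: ler_sum => j _; rewrite -big_split; exact: zblock_le.
have P1 : 0 <= M ^+ 2 * M1.
  rewrite mulr_ge0 ?sqr_ge0//.
  by apply: sumr_ge0 => j _; apply: sumr_ge0 => k _; rewrite sqr_ge0.
have P2 : 0 <= W * (M ^+ 2 * B0).
  rewrite !mulr_ge0 ?sqr_ge0//.
  by apply: sumr_ge0 => j _; apply: sumr_ge0 => k _; rewrite sqr_ge0.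
have K0 : 0 <= 4 * (W + 1) * M ^+ 2 by rewrite !mulr_ge0 ?sqr_ge0 ?addr_ge0.
apply: le_trans (ler_wpM2l K0 tot).
apply: (@le_trans _ _ (4 * W * (M ^+ 2 * M1) + 2 * (M ^+ 2 * B0) + 2 * (M ^+ 2 * B0))).
  by rewrite !lerD.
rewrite -subr_ge0.
have -> : 4 * (W + 1) * M ^+ 2 * (B0 + M1) -
    (4 * W * (M ^+ 2 * M1) + 2 * (M ^+ 2 * B0) + 2 * (M ^+ 2 * B0)) =
    4 * (M ^+ 2 * M1) + 4 * (W * (M ^+ 2 * B0)) by ring.
by rewrite addr_ge0// mulr_ge0.
Qed.

Lemma rep_fun_le : (\sum_i sqsum (out i) <=
  (4 * (W + 1) * M ^+ 2 * \sum_j l2norm (Z j) ^+ 2)%:E)%E.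
Proof.
have K0 : 0 <= 4 * (W + 1) * M ^+ 2 by rewrite !mulr_ge0 ?sqr_ge0 ?addr_ge0.
have -> : (\sum_i sqsum (out i) = \esum_(X in [set: {classic ball}]) \sum_i sqsum (fun p => out i (X, p)))%E.
  rewrite esum_sum; last by move=> *; exact: sqsum_ge0.
  by apply: eq_bigr => i _; rewrite sqsum_prod.
have -> : (4 * (W + 1) * M ^+ 2 * \sum_j l2norm (Z j) ^+ 2)%:E =
    nsum (fun X : {classic ball} => 4 * (W + 1) * M ^+ 2 * \sum_j l2norm (slice (Z j) X) ^+ 2).
  rewrite nsumZ//; last by move=> X; apply: sumr_ge0 => j _; rewrite sqr_ge0.
  rewrite nsum_sum; last by move=> j X; rewrite sqr_ge0.
  rewrite EFinM -sumEFin; congr (_ * _)%E; apply: eq_bigr => j _.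
  exact: sqr_l2norm_slices.
by apply: le_esum => X _; exact: block_le.
Qed.

End Family.

End Representation.

(** * The representing operators: product, lower bound and closed range *)

Section Sufficiency.
Context {R : realType} {G : groupType}.
Local Notation L := (l2space R G).
Local Notation N := (@l2norm R G).
Local Notation H := (l2space R (@ball_index R G)).
Local Notation NH := (@l2norm R (@ball_index R G)).
Variable w : G -> R[i].
Hypothesis wo : (sqsum w < +oo)%E.
Implicit Types (Z : H) (u f g : G -> R[i]).

Let W : R := fine (sqsum w).
Let K : R := Num.sqrt (4 * (W + 1)).
Let W0 : 0 <= W. Proof. exact: fine_ge0 (sqsum_ge0 w). Qed.
Let K0 : 0 <= K. Proof. exact: sqrtr_ge0. Qed.
Let KE : K ^+ 2 = 4 * (W + 1).
Proof. by rewrite sqr_sqrtr// mulr_ge0// addr_ge0. Qed.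

Definition repop : (G -> R[i]) -> H -> H := locked (fun f Z => to_l2 (rep_fun w f Z)).

Lemma fourier_norm_fin f : fourier f -> exists2 M : R, 0 <= M & (fourier_norm f <= M%:E)%E.
Proof.
move=> Ff; have [c rc] := fourier_rep Ff; have c0 := rep_ge0 rc.
exists (c + 1); first by rewrite addr_ge0.
by apply: rep_fourier_norm; [rewrite ltr_wpDl|apply: rep_le rc; rewrite lerDl].
Qed.

Lemma rep_fun_fin f Z : fourier f -> (sqsum (rep_fun w f Z) < +oo)%E.
Proof.
move=> Ff; have [M M0 fM] := fourier_norm_fin Ff.
have := @rep_fun_le R G w wo 1 (const_mx f) M (fun=> Z) M0 _ fM.
rewrite !big_ord1 => /(_ _); set q := (_ * _)%:E => h.
apply: (@le_lt_trans _ _ q); last by rewrite ltry.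
apply: le_trans (h _); last by move=> i j; rewrite mxE.
apply: le_of_eq; apply: eq_nsum => x.
by rewrite big_ord1 mxE.
Qed.

Lemma repopE f Z x : fourier f -> repop f Z x = rep_fun w f Z x.
Proof. by move=> Ff; rewrite /repop -lock to_l2E//; exact: rep_fun_fin. Qed.

Lemma repop_linear f a Z Z' : fourier f -> repop f (a *: Z + Z') = a *: repop f Z + repop f Z'.
Proof.
move=> Ff; apply: l2space_inj => x.
by rewrite l2addE l2scaleE !(repopE _ _ Ff) rep_fun_linear.
Qed.

Lemma repopP f g a : fourier f -> fourier g -> repop (a *: f + g) = a *: repop f + repop g.
Proof.
move=> Ff Fg; apply/funext => Z; rewrite funPE; apply: l2space_inj => x.
by rewrite l2addE l2scaleE (repopE _ _ Ff) (repopE _ _ Fg) (repopE _ _ (fourierP a Ff Fg)) rep_funPl.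
Qed.

Lemma repop_mxnorm n (F : 'M[G -> R[i]]_n) (M : R) : 0 <= M -> (forall i j, fourier (F i j)) ->
  (fourier_mxnorm F <= M%:E)%E -> (op_mxnorm NH (map_mx repop F) <= (K * M)%:E)%E.
Proof.
move=> M0 FF FM; apply: opnorm_le; first by rewrite mulr_ge0.
move=> Z; rewrite exprMn KE -lee_fin; apply: le_trans (rep_fun_le wo Z M0 FF FM).
rewrite -sumEFin le_eqVlt; apply/orP; left; apply/eqP; apply: eq_bigr => i _.
rewrite sqr_l2norm; apply: eq_nsum => x; rewrite l2sumE; congr (normc _ ^+ 2).
by apply: eq_bigr => j _; rewrite mxE repopE.
Qed.

Lemma op_mxnorm1P (V : lmodType R[i]) (NV : V -> R) (T : V -> V) (M : R) : 0 <= M ->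
  (forall x, 0 <= NV x) -> (forall a x, NV (a *: x) = normc a * NV x) ->
  (forall a x, T (a *: x) = a *: T x) ->
  (opnorm NV (fun _ _ : 'I_1 => T) <= M%:E)%E <-> forall x, NV (T x) <= M * NV x.
Proof.
move=> M0 N0 NZ TZ; split => [le x|le]; last first.
  apply: opnorm_le => // x; rewrite !big_ord1 -exprMn.
  by rewrite ler_pXn2r ?nnegrE ?mulr_ge0.
have := opnormP NZ M0 (fun _ _ => TZ) le (fun=> x).
by rewrite !big_ord1 -exprMn ler_pXn2r ?nnegrE ?mulr_ge0.
Qed.

Lemma repopZ f a Z : fourier f -> repop f (a *: Z) = a *: repop f Z.
Proof.
by move=> Ff; apply: linear_mapZ => b x y; exact: repop_linear.
Qed.

Lemma repop_bound f (M : R) : 0 <= M -> fourier f -> (fourier_norm f <= M%:E)%E ->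
  forall Z, NH (repop f Z) <= K * M * NH Z.
Proof.
move=> M0 Ff fM; have KM : 0 <= K * M by rewrite mulr_ge0.
apply/(op_mxnorm1P KM (@l2norm_ge0 _ _) (@l2normZ _ _) (fun a Z => repopZ a Z Ff)).
have Fc (i j : 'I_1) : fourier ((const_mx f : 'M_1) i j) by rewrite mxE.
apply: le_trans (repop_mxnorm M0 Fc fM).
apply: le_of_eq; congr opnorm.
by apply/funext => i; apply/funext => j; rewrite !mxE.
Qed.

Lemma repop_bounded f : fourier f -> bounded_op NH (repop f).
Proof.
move=> Ff; split; first by move=> a Z Z'; exact: repop_linear.
by have [M M0 fM] := fourier_norm_fin Ff; exists (K * M); exact: repop_bound.
Qed.

Lemma l2_mul_fourier f g : fourier f -> fourier g -> (sqsum (w * f * g)%R < +oo)%E.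
Proof.
move=> /fourier_bounded fb /fourier_bounded gb.
rewrite (_ : w * f * g = (f * g) * w); first by apply: bounded_mul_fin => //; exact: bounded_funM.
by rewrite -mulrA mulrC.
Qed.

(** Diagonal against diagonal or column, and row against diagonal, only rearrange pointwise products
    of [w], [f] and [g]; row against column gives the corner. *)
Lemma repopM f g : fourier f -> fourier g -> repop f \o repop g = repop (w * f * g).
Proof.
move=> Ff Fg; have wfg := l2_mul_fourier Ff Fg; have Fh := l2_fourier wfg.
have fb := fourier_bounded Ff; have gb := fourier_bounded Fg; have hb := fourier_bounded Fh.
have wb := l2_bounded wo.
apply/funext => Z; apply: l2space_inj => -[X [k o]].
rewrite [LHS]/= (repopE _ _ Ff) (repopE _ _ Fh).
have [le|lt] := leqP (bsz X) k; first by rewrite !rep_fun_out.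
rewrite -[k]/(nat_of_ord (Ordinal lt)) !rep_funE; move: (Ordinal lt) => {lt}k'.
(* The output of [repop g] has no bottom component, so the column and corner of [repop f] do not act
   on it. *)
have bot0 l : zbot (repop g Z) X l = 0 by rewrite /zbot repopE// rep_fun_bot.
have conv0 : zconv (repop g Z) k' = 0.
  rewrite /zconv big1// => l _; rewrite bot0 scale0r.
  exact: linear_map0 (VN_linear (bmx_VN k' l)).
have midE : zmid (repop g Z) X k' = mulL w (mulL g (zmid Z X k')) + mulL g (zconv Z k').
  by apply: l2space_inj => s; rewrite zmidE repopE// rep_funE.
have hE t : (w * f * g) t = f t * (w * g) t by rewrite -![(_ * _) t]/(_ t * _ t); ring.
have hE' t : (w * f * g) t = w t * (f * g) t by rewrite -![(_ * _) t]/(_ t * _ t); ring.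
have wgb := bounded_funM wb gb; have fgb := bounded_funM fb gb.
case: o => [[s|]|]; last by [].
  rewrite conv0 (mulL0 fb) addr0 midE (mulLD _ _ fb) (mulLD _ _ wb).
  rewrite (mulLM _ wb gb wgb (fun=> erefl)) (mulLM _ fb wgb hb hE).
  by rewrite (mulLM _ fb gb fgb (fun=> erefl)) (mulLM _ wb fgb hb hE').
rewrite midE [X in _ + X]big1 ?addr0; last by move=> l _; rewrite bot0 mulr0.
rewrite (mulLD _ _ fb) l2dotDl (mulLM _ wb gb wgb (fun=> erefl)) (mulLM _ fb wgb hb hE).
congr (_ + _).
rewrite /zconv.
have -> : mulL f (mulL g (\sum_(l < bsz X) bmx X k' l (zbot Z X l *: l2delta 1%g))) =
    \sum_(l < bsz X) zbot Z X l *: mulL f (mulL g (bmx X k' l (l2delta 1%g))).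
  apply: l2space_inj => s; rewrite !mulLE// !l2sumE !mulr_sumr; apply: eq_bigr => l _.
  rewrite l2scaleE !mulLE//.
  by rewrite (linear_mapZ (VN_linear (bmx_VN k' l))) l2scaleE; ring.
rewrite l2dot_suml; apply: eq_bigr => l _; rewrite l2dotZl mulrC; congr (_ * _).
(* [w f g] is square summable, so its pairing with [X] is the explicit sum over [s] of
   [w(s) f(s) g(s) (X delta_1)(s)], matching the product of row and column. *)
rewrite pairing_l2//; last exact: bmx_VN.
apply: eq_csum => s; rewrite !mulLE// /conj_l2 !to_l2E ?sqsum_conj// !conjK.
by rewrite -![(_ * _) s]/(_ s * _ s); ring.
Qed.

(** For a contraction [X], the vectors supported on the bottom components of the block of [X] are
    sent by the corner to the pairing of [F] with [X]. Keeping only the top components of the output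
    therefore bounds that pairing, with constant 1. *)
Lemma repop_mxnorm_ge n (F : 'M[G -> R[i]]_n) (M : R) : 0 <= M -> (forall i j, fourier (F i j)) ->
  (op_mxnorm NH (map_mx repop F) <= M%:E)%E -> (fourier_mxnorm F <= M%:E)%E.
Proof.
move=> M0 FF FM; apply: fourier_mxnorm_le => // m X VX X1 z.
pose B : {classic ball} := existT _ m (exist _ X (conj VX X1)).
pose e (l : 'I_m) : @ball_index R G := (B, (l : nat, None)).
pose Z j : H := \sum_l z (l, j) *: l2delta (e l).
have ei : injective e by move=> l l' [] /val_inj.
have ZN j : NH (Z j) ^+ 2 = \sum_l normc (z (l, j)) ^+ 2 by exact: l2norm_sum_delta.
have Zbot j (l : 'I_m) : zbot (Z j) B l = z (l, j).
  rewrite /zbot l2sumE (bigD1 l)//= big1 => [|l' ll'].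
    by rewrite addr0 -[LHS]/(z (l, j) * (e l == e l)%:R) eqxx mulr1.
  by rewrite -[LHS]/(z (l', j) * (e l == e l')%:R) (inj_eq ei) eq_sym (negPf ll') mulr0.
have Zmid j (l : 'I_m) : zmid (Z j) B l = 0.
  apply: l2space_inj => s; rewrite zmidE l2sumE big1// => l' _.
  by rewrite -[LHS]/(z (l', j) * ((B, (l : nat, Some (Some s))) == e l')%:R) /e !xpair_eqE !andbF mulr0.
have TZ i j a x : map_mx repop F i j (a *: x) = a *: map_mx repop F i j x.
  by rewrite mxE repopZ.
have := opnormP (@l2normZ _ _) M0 TZ FM Z.
have -> : \sum_j NH (Z j) ^+ 2 = \sum_q normc (z q) ^+ 2.
  rewrite (eq_bigr _ (fun j _ => ZN j)) exchange_big/=.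
  rewrite (pair_bigA _ (fun l j => normc (z (l, j)) ^+ 2))/=.
  by apply: eq_bigr => -[l j].
apply: le_trans.
have lowS (y : H) : \sum_(k < m) normc (y (B, (k : nat, Some None))) ^+ 2 <= NH y ^+ 2.
  rewrite -lee_fin sqr_l2norm.
  have := @nsum_ge_seq R (@ball_index R G) (fun x => normc (y x) ^+ 2)
     [seq (B, (nat_of_ord k, Some None)) | k <- enum 'I_m].
  rewrite big_map big_enum/=; apply; last by move=> x; rewrite sqr_ge0.
  by rewrite map_inj_uniq ?enum_uniq// => k k' [] /val_inj.
apply: le_trans (ler_sum _ (fun i _ => lowS (\sum_j map_mx repop F i j (Z j)))).
rewrite exchange_big/= (pair_bigA _ (fun k i => normc ((\sum_j map_mx repop F i j (Z j)) (B, (nat_of_ord k, Some None))) ^+ 2))/=.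
apply: le_of_eq; apply: eq_bigr => -[k i] _ /=.
congr (normc _ ^+ 2); rewrite l2sumE.
rewrite (eq_bigr (fun q => fourier_pairing (F i q.2) (X k q.1) * z (q.1, q.2))); last by case.
rewrite -(pair_bigA _ (fun l j => fourier_pairing (F i j) (X k l) * z (l, j)))/= exchange_big/=.
apply: eq_bigr => j _; rewrite mxE repopE//.
have := @rep_funE R G w (F i j) (Z j) B k (Some None) => /= ->.
rewrite Zmid mulL0 ?l2dot0l ?add0r; last exact: fourier_bounded.
by apply: eq_bigr => l _; rewrite Zbot.
Qed.

Lemma repop_norm_ge f (M : R) : 0 <= M -> fourier f ->
  (forall Z, NH (repop f Z) <= M * NH Z) -> (fourier_norm f <= M%:E)%E.
Proof.
move=> M0 Ff le; apply: repop_mxnorm_ge => //; first by move=> i j; rewrite mxE.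
have := (op_mxnorm1P M0 (@l2norm_ge0 _ _) (@l2normZ _ _) (fun a Z => repopZ a Z Ff)).2 le.
apply: le_trans; apply: le_of_eq; congr opnorm.
by apply/funext => i; apply/funext => j; rewrite !mxE.
Qed.

Lemma repop_inj f g : fourier f -> fourier g -> repop f = repop g -> f = g.
Proof.
move=> Ff Fg e; have Fd : fourier (f - g) by rewrite addrC -scaleN1r; exact: fourierP.
have d0 : repop (f - g) = 0.
  by rewrite addrC -scaleN1r (repopP _ Fg Ff) e scaleN1r addNr.
have dM : (fourier_norm (f - g)%R <= 0%:E)%E.
  by apply: repop_norm_ge => // Z; rewrite d0 l2norm0 mul0r.
apply/eqP; rewrite -subr_eq0; apply/eqP/funext => s.
have Fc (i j : 'I_1) : fourier ((const_mx (f - g) : 'M_1) i j) by rewrite mxE.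
have := fourier_mxnorm_pt s (lexx 0) Fc dM (fun=> 1).
rewrite !big_ord1 mxE mulr1 expr0n mul0r => h.
apply: eq0_normc; apply/eqP; rewrite -sqrf_eq0; apply/eqP/le_anti.
by rewrite h sqr_ge0.
Qed.

Lemma deformed_mxnormE n (F : 'M[G -> R[i]]_n) :
  (forall f g, fourier f -> fourier g -> multiplier w f = multiplier w g -> f = g) ->
  (forall i j, fourier (F i j)) ->
  deformed_mxnorm w (map_mx (multiplier w) F) = fourier_mxnorm F.
Proof.
move=> inj FF; rewrite /deformed_mxnorm [X in ereal_inf X](_ : _ = [set fourier_mxnorm F]) ?ereal_inf1//.
apply/seteqP; split => [_ [u [Fu uE] <-]|_ ->]; last by exists F.
congr fourier_mxnorm; apply/matrixP => i j; apply: inj => //.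
by have /matrixP/(_ i j) := uE; rewrite !mxE.
Qed.

Definition repalg : set (H -> H) := [set S | exists2 f, fourier f & S = repop f].

Lemma norm_eq0_of_small (x : R) (C : R) : 0 <= C -> 0 <= x ->
  (forall e, 0 < e -> x <= e * C) -> x = 0.
Proof.
move=> C0 x0 xe; apply/le_anti; rewrite x0 andbT; apply/ler_addgt0Pr => e e0; rewrite add0r.
have C1 : 0 < C + 1 by rewrite ltr_wpDl.
apply: le_trans (xe (e / (C + 1)) _) _; first by rewrite divr_gt0.
by rewrite mulrAC ler_pdivrMr// ler_pM2l// lerDl.
Qed.

Lemma repalg_closed : closed_subalgebra NH repalg.
Proof.
have F0 : fourier (0 : G -> R[i]) by exact: fourier0.
split.
- by move=> _ [f Ff ->]; exact: repop_bounded.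
- exists 0 => //; have := repopP (-1) F0 F0; rewrite scaler0 addr0 => ->.
  by rewrite scaleN1r addNr.
- by move=> a _ _ [f Ff ->] [g Fg ->]; exists (a *: f + g); [exact: fourierP|rewrite repopP].
- move=> _ _ [f Ff ->] [g Fg ->]; exists (w * f * g); last exact: repopM.
  by apply: l2_fourier; exact: l2_mul_fourier.
move=> T [Tl [MT MTP]] Tapp.
have TZ a x : T (a *: x) = a *: T x := linear_mapZ Tl a x.
have app (n : nat) : exists f, fourier f /\ forall Z, NH (T Z - repop f Z) <= 2^-1 ^+ n * NH Z.
  have e0 : (0 : R) < 2^-1 ^+ n by rewrite exprn_gt0// invr_gt0.
  have [_ [f Ff ->] le] := Tapp _ e0; exists f; split => //.
  have DZ a Z : (T - repop f) (a *: Z) = a *: (T - repop f) Z.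
    rewrite -![(T - repop f) _]/(T _ - repop f _) TZ repopZ// scalerBr //.
  exact: (op_mxnorm1P (ltW e0) (@l2norm_ge0 _ _) (@l2normZ _ _) DZ).1 le.
have [f_ fP] := choice app; have Ff n : fourier (f_ n) by case: (fP n).
have fB n : fourier (f_ n.+1 - f_ n) by rewrite addrC -scaleN1r; exact: fourierP.
have repB f g Z : fourier f -> fourier g -> repop (f - g) Z = repop f Z - repop g Z.
  by move=> Hf Hg; rewrite addrC -scaleN1r repopP// funPE scaleN1r addrC.
(* Consecutive approximants differ by at most [2^-n + 2^-(n+1) <= 2 / 2^n] as operators, and by
   [repop_norm_ge] the same holds in [A(G)]. *)
have [||f Fl lim] := @fourier_complete R G f_ 2 _ Ff; first by [].
  move=> n; have q0 : (0 : R) <= 2 / 2 ^+ n by rewrite divr_ge0// exprn_ge0.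
  apply: (repop_norm_ge q0 (fB n)) => Z; rewrite repB//.
  have h1 := (fP n).2 Z; have h2 := (fP n.+1).2 Z.
  have -> : repop (f_ n.+1) Z - repop (f_ n) Z = (T Z - repop (f_ n) Z) - (T Z - repop (f_ n.+1) Z).
    by rewrite opprB [RHS]addrC addrA subrK.
  apply: le_trans (l2normD _ _) _; rewrite l2normN.
  apply: le_trans (lerD h1 h2) _; rewrite -mulrDl ler_wpM2r ?l2norm_ge0// exprVn.
  rewrite exprVn exprS invfM.
  have := (ltW (_ : (0 : R) < (2 ^+ n)^-1)) => /(_ ltac:(by rewrite invr_gt0 exprn_gt0)).
  by set q := (2 ^+ n)^-1 => ?; lra.
exists f => //; apply/funext => Z; apply/eqP; rewrite -subr_eq0; apply/eqP; apply: l2norm_eq0.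
apply: (@norm_eq0_of_small _ ((1 + K) * NH Z)); rewrite ?mulr_ge0 ?addr_ge0 ?l2norm_ge0// => e e0.
have [n1 P1] := lim _ e0.
have [n2 P2] : exists n, forall m, (n <= m)%N -> (2^-1 : R) ^+ m <= e.
  exists (Num.bound e^-1) => m le; rewrite exprVn.
  rewrite -[e]invrK lef_pV2 ?posrE ?exprn_gt0 ?invr_gt0//.
  apply: (@le_trans _ _ m%:R); last by rewrite -natrX ler_nat ltnW// ltn_expl.
  apply: ltW; apply: lt_le_trans (archi_boundP _) _; first by rewrite invr_ge0 ltW.
  by rewrite ler_nat.
pose m := maxn n1 n2; have h1 := P1 m (leq_maxl _ _); have h2 := P2 m (leq_maxr _ _).
have h3 := (fP m).2 Z.
have FB : fourier (f - f_ m) by rewrite addrC -scaleN1r; exact: fourierP.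
have h4 := repop_bound (ltW e0) FB h1 Z.
have -> : T Z - repop f Z = (T Z - repop (f_ m) Z) - repop (f - f_ m) Z.
  by rewrite repB// opprB addrA subrK.
apply: le_trans (l2normD _ _) _; rewrite l2normN.
have h5 : 2^-1 ^+ m * NH Z <= e * NH Z by rewrite ler_wpM2r ?l2norm_ge0.
apply: le_trans (lerD (le_trans h3 h5) h4) _.
by apply: le_of_eq; ring.
Qed.

End Sufficiency.

(** * Choice of signs *)

Section Khintchine.
Context {R : realType} {G : groupType}.
Local Notation L := (l2space R G).
Local Notation N := (@l2norm R G).
Implicit Types (r : seq G) (c h : G -> R[i]) (f g : L) (s t : G).

(** The coefficients are conjugated so that [conv r c delta_1] is the conjugate of [c] on [r];
    pairing [sum c_s delta_s] with this operator then gives [sum |c_s|^2]. *)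
Definition conv r c f : L := \sum_(s <- r) Num.conj (c s) *: lreg s f.
Definition conv_adj r c f : L := \sum_(s <- r) c s *: lreg s^-1%g f.

Lemma sum_funE (I : Type) (q : seq I) (F : I -> L -> L) f :
  (\sum_(i <- q) F i) f = \sum_(i <- q) F i f.
Proof. by elim/big_rec2: _ => // i y1 y2 _ <-. Qed.

Lemma conv_VN r c : VN (conv r c).
Proof.
have -> : conv r c = \sum_(s <- r) Num.conj (c s) *: @lreg R G s.
  by apply/funext => f; rewrite sum_funE.
by apply: VN_sum => s; exact: VN_lreg.
Qed.

Lemma conv_adj_VN r c : VN (conv_adj r c).
Proof.
have -> : conv_adj r c = \sum_(s <- r) c s *: @lreg R G s^-1%g.
  by apply/funext => f; rewrite sum_funE.
by apply: (VN_sum _ _ _ (T := fun s => lreg s^-1%g)) => s; exact: VN_lreg.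
Qed.

Lemma conv_adjoint r c f g : l2dot (conv r c f) g = l2dot f (conv_adj r c g).
Proof.
rewrite l2dot_suml [RHS]l2dotC l2dot_suml rmorph_sum; apply: eq_bigr => s _.
by rewrite !l2dotZl rmorphM /= -l2dotC l2dot_lregV.
Qed.

Lemma sqr_l2norm_comb r (e : G -> G) (a : G -> R[i]) : uniq r -> injective e ->
  N (\sum_(s <- r) a s *: l2delta (e s)) ^+ 2 = \sum_(s <- r) normc (a s) ^+ 2.
Proof.
move=> ur ei; case: r ur => [|x r'] ur; first by rewrite !big_nil l2norm0 expr0n.
set r := x :: r' in ur *; rewrite !(big_nth x) !big_mkord.
have inj : injective (fun j : 'I_(size r) => e (nth x r j)).
  by move=> j k /ei/eqP; rewrite nth_uniq// => /eqP/val_inj.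
exact: (l2norm_sum_delta (fun j : 'I_(size r) => a (nth x r j)) inj).
Qed.

Lemma conv_delta r c : conv r c (l2delta 1%g) = \sum_(s <- r) Num.conj (c s) *: l2delta s.
Proof. by apply: eq_bigr => s _; rewrite lreg_delta mulg1. Qed.

Lemma conv_norm r c : uniq r ->
  N (conv r c (l2delta 1%g)) ^+ 2 = \sum_(s <- r) normc (c s) ^+ 2.
Proof.
move=> ur; rewrite conv_delta (@sqr_l2norm_comb r id)//.
by apply: eq_bigr => s _; rewrite normc_conj.
Qed.

Lemma conv_adj_norm r c t : uniq r ->
  N (conv_adj r c (l2delta t)) ^+ 2 = \sum_(s <- r) normc (c s) ^+ 2.
Proof.
move=> ur; rewrite -(@sqr_l2norm_comb r (fun s => s^-1 * t)%g)//; last first.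
  by move=> s s' /mulIg/invg_inj.
by congr (N _ ^+ 2); apply: eq_bigr => s _; rewrite lreg_delta.
Qed.

(* Averaging over the last sign, the parallelogram law bounds the fourth moment. *)
Lemma exists_signs r h : uniq r -> exists eps : G -> R,
  (forall s, eps s = 1 \/ eps s = -1) /\
  let c s := (eps s)%:C * h s in
  N (conv_adj r c (conv r c (l2delta 1%g))) ^+ 2 <= 3 * (\sum_(s <- r) normc (h s) ^+ 2) ^+ 2.
Proof.
elim: r => [_|s r IH /= /andP[sr ur]].
  exists (fun=> 1); split; first by left.
  by rewrite /conv_adj !big_nil l2norm0 expr0n mulr0.
have [eps [epsP]] := IH ur; set c := fun s => _ => /= Q.
pose S := \sum_(t <- r) normc (h t) ^+ 2; rewrite -/S in Q.
have cn t : normc (c t) = normc (h t).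
  by rewrite /c normcM normc_real; case: (epsP t) => ->; rewrite ?normrN normr1 mul1r.
have SE : \sum_(t <- r) normc (c t) ^+ 2 = S by apply: eq_bigr => t _; rewrite cn.
pose d := l2delta 1%g : L.
(* Adding [s] with sign [e] yields the vector [A + e B]: [A] gathers the terms free of [e] and the
   square term, where [e^2 = 1]; [B] gathers the two cross terms. *)
pose y := conv r c d; pose A := conv_adj r c y + (normc (h s) ^+ 2)%:C *: d.
pose B := Num.conj (h s) *: conv_adj r c (l2delta s) + h s *: lreg s^-1%g y.
have yS : N y ^+ 2 = S by rewrite conv_norm.
have zS : N (conv_adj r c (l2delta s)) ^+ 2 = S by rewrite conv_adj_norm.
have NyS : N (conv_adj r c (l2delta s)) = N y.
  by apply/eqP; rewrite -(@eqrXn2 _ 2)// ?l2norm_ge0// zS yS.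
have step (e : R) : (e = 1 \/ e = -1) ->
    let eps' t := if t == s then e else eps t in
    let c' t := (eps' t)%:C * h t in
    conv_adj (s :: r) c' (conv (s :: r) c' d) = A + e%:C *: B.
  move=> e1 eps' c'.
  have cc t : t \in r -> c' t = c t.
    by move=> tr; rewrite /c' /eps' ifF//; apply/negbTE; apply: contraNneq sr => <-.
  have cs : c' s = e%:C * h s by rewrite /c' /eps' eqxx.
  have E1 f : conv (s :: r) c' f = Num.conj (c' s) *: lreg s f + conv r c f.
    rewrite /conv big_cons; congr (_ + _); rewrite big_seq [RHS]big_seq.
    by apply: eq_bigr => t tr; rewrite cc.
  have E2 f : conv_adj (s :: r) c' f = c' s *: lreg s^-1%g f + conv_adj r c f.
    rewrite /conv_adj big_cons; congr (_ + _); rewrite big_seq [RHS]big_seq.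
    by apply: eq_bigr => t tr; rewrite cc.
  have ce : Num.conj (c' s) = e%:C * Num.conj (h s).
    by rewrite cs rmorphM /= conjcE conjc_real.
  have ee : e%:C * e%:C = 1 :> R[i].
    by case: e1 => ->; rewrite -rmorphM ?mulrNN mul1r rmorph1.
  rewrite E1 E2 (VN_linear (conv_adj_VN r c)) lreg_linear lreg_mul mulVg lreg_id.
  rewrite lreg_delta mulg1 ce cs -/y scalerDr !scalerA /A /B scalerDr !scalerA.
  have -> : e%:C * h s * (e%:C * Num.conj (h s)) = (normc (h s) ^+ 2)%:C.
    by rewrite mulrACA ee mul1r mulc_conj.
  rewrite -!addrA; have AC (p q v u : L) : p + (q + (v + u)) = u + (p + (v + q)).
    by apply: l2space_inj => t; rewrite !l2addE; ring.
  exact: AC.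
(* With [a = |h s|^2], [||A||^2 <= 3 S^2 + a^2 + 2 a S] and [||B||^2 <= 4 a S]. The total [6 a S] of
   mixed terms is the one in [3 (a + S)^2], which is where the constant 3 comes from. *)
have bound : N A ^+ 2 + N B ^+ 2 <= 3 * (normc (h s) ^+ 2 + S) ^+ 2.
  have AE : N A ^+ 2 = N (conv_adj r c y) ^+ 2 + normc (h s) ^+ 4 + 2 * normc (h s) ^+ 2 * S.
    rewrite !l2normE (@sqr_hnormD R (l2hilbert)) -!l2normE.
    have -> : @hdot R (l2hilbert) (conv_adj r c y) ((normc (h s) ^+ 2)%:C *: d) =
        (normc (h s) ^+ 2 * S)%:C.
      rewrite -[LHS]/(l2dot _ _) l2dotZr conjcE conjc_real l2dotC -conv_adjoint -/y.
      by rewrite (l2dotE y) yS conjcE conjc_real -rmorphM.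
    rewrite Re_real l2normZ normc_real ger0_norm ?sqr_ge0// l2norm_delta mulr1.
    by rewrite -exprM mulrA.
  have BE : N B ^+ 2 <= 4 * normc (h s) ^+ 2 * S.
    have : N B <= 2 * normc (h s) * N y.
      apply: le_trans (l2normD _ _) _; rewrite !l2normZ normc_conj l2norm_lreg NyS.
      by rewrite -mulrA mulr_natl mulr2n.
    rewrite -(ler_pXn2r (n := 2)) ?nnegrE ?mulr_ge0 ?l2norm_ge0 ?normc_ge0//.
    by rewrite !exprMn yS -natrX.
  rewrite AE; apply: le_trans (lerD (lerD (lerD Q (lexx _)) (lexx _)) BE) _.
  have n0 : 0 <= normc (h s) ^+ 2 by rewrite sqr_ge0.
  have -> : normc (h s) ^+ 4 = (normc (h s) ^+ 2) ^+ 2 by rewrite -exprM.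
  set a := normc (h s) ^+ 2 in n0 *.
  have : 0 <= a ^+ 2 by rewrite sqr_ge0.
  by rewrite !expr2 => ?; lra.
have par : N (A + B) ^+ 2 + N (A - B) ^+ 2 = 2 * (N A ^+ 2 + N B ^+ 2).
  by rewrite !l2normE; exact: (@hparallelogram R (l2hilbert)).
have [le|le] := leP (N (A + B) ^+ 2) (N A ^+ 2 + N B ^+ 2).
  exists (fun t => if t == s then 1 else eps t); split.
    by move=> t; case: ifP => _; [left|exact: epsP].
  have -> := step 1 (or_introl erefl); rewrite rmorph1 scale1r big_cons.
  exact: le_trans le bound.
exists (fun t => if t == s then -1 else eps t); split.
  by move=> t; case: ifP => _; [right|exact: epsP].
have -> := step (-1) (or_intror erefl); rewrite rmorphN rmorph1 scaleN1r big_cons.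
apply: le_trans bound; move: par le; set a := N (A + B) ^+ 2; set b := N (A - B) ^+ 2.
by move=> ? ?; lra.
Qed.

(* The test operator is [y (1 + t y^* y)^-1], a bounded substitute for the polar part of [y]. *)
Lemma exists_test_op r c (t : R) : uniq r -> 0 < t -> exists T : L -> L,
  [/\ VN T, forall f, N (T f) <= Num.sqrt t^-1 * N f &
  \sum_(s <- r) normc (c s) ^+ 2 - t * N (conv_adj r c (conv r c (l2delta 1%g))) ^+ 2 <=
    normc (\sum_(s <- r) c s * T (l2delta 1%g) s)].
Proof.
move=> ur t0; pose Y := conv r c; pose Y' := conv_adj r c; pose k f := t%:C *: Y' (Y f).
have adj f g : l2dot (Y f) g = l2dot f (Y' g) by exact: conv_adjoint.
have adj' f g : l2dot (Y' f) g = l2dot f (Y g) by rewrite l2dotC -adj -l2dotC.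
have Yl := VN_linear (conv_VN r c); have Y'l := VN_linear (conv_adj_VN r c).
have kl a f g : k (a *: f + g) = a *: k f + k g.
  by rewrite /k /Y /Y' Yl Y'l scalerDr !scalerA mulrC.
have [C1 C10 C1P] := VN_bound (conv_VN r c); have [C2 C20 C2P] := VN_bound (conv_adj_VN r c).
have kb f : N (k f) <= t * C2 * C1 * N f.
  rewrite l2normZ normc_real (ger0_norm (ltW t0)) -!mulrA ler_wpM2l ?(ltW t0)//.
  by apply: le_trans (C2P _) _; rewrite ler_wpM2l.
have ks f g : l2dot (k f) g = l2dot f (k g).
  by rewrite l2dotZl l2dotZr conjcE conjc_real adj' adj.
have kp f : l2dot (k f) f = (t * N (Y f) ^+ 2)%:C.
  by rewrite l2dotZl adj' l2dotE -rmorphM.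
have ex b : exists x : L, x + k x = b.
  apply: (@posop_resolvent R (l2hilbert) k (t * C2 * C1)) => //.
  - by move=> f; rewrite hnorm_l2; exact: kb.
  - by move=> f; rewrite -[hdot _ _ _]/(l2dot _ _) kp Re_real mulr_ge0 ?sqr_ge0// ltW.
have [J JP] := choice ex.
have inj f g : f + k f = g + k g -> f = g.
  move=> e; have kB : k (f - g) = k f - k g by rewrite addrC -scaleN1r kl scaleN1r addrC.
  have z : (f - g) + k (f - g) = 0 by rewrite kB addrACA -opprD e subrr.
  have := congr1 (fun x => complex.Re (l2dot x (f - g))) z.
  rewrite l2dotDl kp l2dotE l2dot0l ReD !Re_real => /eqP.
  rewrite paddr_eq0 ?sqr_ge0//; last by rewrite mulr_ge0 ?sqr_ge0// ltW.
  move=> /andP[/eqP h _].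
  apply/eqP; rewrite -subr_eq0; apply/eqP/l2norm_eq0/eqP; by rewrite -sqrf_eq0 h.
have Jl a f g : J (a *: f + g) = a *: J f + J g.
  by apply: inj; rewrite JP kl addrACA -scalerDr !JP.
(* For [z = J f], [||f||^2 = ||z + k z||^2] contains the cross term [2 <z, k z> = 2 t ||Y z||^2],
   and the other terms are nonnegative. *)
have Jb f : N (Y (J f)) <= Num.sqrt t^-1 * N f.
  have ti : 0 <= t^-1 by rewrite invr_ge0 ltW.
  rewrite -(ler_pXn2r (n := 2)) ?nnegrE ?mulr_ge0 ?l2norm_ge0 ?sqrtr_ge0//.
  rewrite exprMn (sqr_sqrtr ti) ler_pdivlMl// -{2}(JP f).
  rewrite [in leRHS]l2normE (@sqr_hnormD R (l2hilbert)) -!l2normE.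
  have -> : @hdot R (l2hilbert) (J f) (k (J f)) = (t * N (Y (J f)) ^+ 2)%:C.
    by rewrite -[LHS]/(l2dot _ _) -ks kp.
  rewrite Re_real; have := sqr_ge0 (N (J f)); have := sqr_ge0 (N (k (J f))).
  have : 0 <= t * N (Y (J f)) ^+ 2 by rewrite mulr_ge0 ?sqr_ge0// ltW.
  by set a := t * _; set b := N _ ^+ 2; set d := N _ ^+ 2 => *; lra.
have VT : VN (fun f => Y (J f)).
  split.
    split; first by move=> a f g; rewrite Jl /Y Yl.
    by exists (Num.sqrt t^-1).
  (* [U] commutes with [1 + k], hence with its inverse [J] by injectivity. *)
  move=> U UC; have [[Ul _] _] := UC; apply/funext => f /=.
  rewrite -(VN_comm (conv_VN r c) UC); congr (Y _); apply: inj.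
  rewrite JP -{1}(JP f) (linear_mapD Ul); congr (_ + _).
  by rewrite /k (linear_mapZ Ul) /Y /Y' (VN_comm (conv_VN r c) UC) (VN_comm (conv_adj_VN r c) UC).
exists (fun f => Y (J f)); split => //.
pose d := l2delta 1%g : L; pose z := J d.
have -> : \sum_(s <- r) c s * Y (J (l2delta 1%g)) s = l2dot (Y z) (Y d).
  rewrite l2dotC /Y conv_delta l2dot_suml rmorph_sum; apply: eq_bigr => s _.
  by rewrite l2dotZl rmorphM /= conjK -l2dotC l2dot_delta.
have zE : z + k z = d by exact: JP.
have YD x y : Y (x + y) = Y x + Y y := linear_mapD Yl x y.
have YZ a x : Y (a *: x) = a *: Y x := linear_mapZ Yl a x.
have Y'D x y : Y' (x + y) = Y' x + Y' y := linear_mapD Y'l x y.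
have Y'Z a x : Y' (a *: x) = a *: Y' x := linear_mapZ Y'l a x.
have Yd : N (Y d) ^+ 2 = \sum_(s <- r) normc (c s) ^+ 2 by exact: conv_norm.
have Yz : Y z = Y d - t%:C *: Y (Y' (Y z)).
  by rewrite -zE YD YZ addrK.
(* [v = Y' Y z] satisfies [v + k v = Y' Y d], and [1 + k] does not decrease norms. The error term
   [t <v, Y' Y d>] is then at most [t ||Y' Y d||^2]. *)
have kz : N (Y' (Y z)) <= N (Y' (Y d)).
  pose v := Y' (Y z).
  have vE : v + k v = Y' (Y d).
    by rewrite -zE YD Y'D YZ Y'Z.
  have [v0|v0] := eqVneq (N v) 0; first by rewrite -/v v0 l2norm_ge0.
  have vp : 0 < N v by rewrite lt_def v0 l2norm_ge0.
  rewrite -/v -(ler_pM2r vp) -expr2.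
  apply: le_trans (le_trans (ler_Re_normc _) (l2CauchySchwarz (Y' (Y d)) v)).
  apply: le_trans (ler_norm _).
  by rewrite -vE l2dotDl kp l2dotE ReD !Re_real lerDl mulr_ge0 ?sqr_ge0 ?(ltW t0).
apply: le_trans (ler_Re_normc _); apply: le_trans (ler_norm _).
rewrite Yz l2dotBl l2dotZl (adj (Y' _)) (l2dotE (Y d)) ReB ReZ Re_real Yd lerD2l lerN2 ler_pM2l//.
apply: le_trans (ler_norm _) _; apply: le_trans (ler_Re_normc _) _.
apply: le_trans (l2CauchySchwarz _ _) _.
by rewrite expr2 ler_wpM2r ?l2norm_ge0.
Qed.

End Khintchine.

(** * Contractive rows and columns of point masses *)

Section Necessity.
Context {R : realType} {G : groupType}.
Local Notation L := (l2space R G).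
Local Notation N := (@l2norm R G).

Lemma conj_delta (s : G) : conj_l2 (@delta_fun R G s) = l2delta s.
Proof.
apply: l2space_inj => t; rewrite to_l2E ?sqsum_conj ?sqsum_delta ?ltry//.
by rewrite l2deltaE /delta_fun rmorph_nat.
Qed.

Lemma fourier_delta (s : G) : fourier (@delta_fun R G s).
Proof. by apply: l2_fourier; rewrite sqsum_delta ltry. Qed.

Lemma pairing_delta (s : G) (T : L -> L) : VN T ->
  fourier_pairing (delta_fun s) T = T (l2delta 1%g) s.
Proof.
by move=> VT; rewrite pairing_l2 ?sqsum_delta ?ltry// conj_delta l2dot_delta.
Qed.

Lemma pairingZ_l (a : R[i]) (u : G -> R[i]) (T : L -> L) : fourier u -> VN T ->
  fourier_pairing (a *: u) T = a * fourier_pairing u T.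
Proof.
move=> Fu VT; have F0 : fourier (0 : G -> R[i]) by exact: fourier0.
have h0 : fourier_pairing 0 T = 0.
  have := pairingPl (-1) F0 F0 VT.
  by rewrite scaler0 addr0 => ->; rewrite mulN1r addNr.
by have := pairingPl a Fu F0 VT; rewrite h0 !addr0.
Qed.

Section DeltaMatrices.
Variables (n : nat) (s : 'I_n.+1 -> G) (a : 'I_n.+1 -> R[i]).
Hypotheses (s_inj : injective s) (a1 : forall j, normc (a j) <= 1).

(** Matrix norms are only given for square matrices, so the row is completed by zeros; the size
    [n.+1] provides the index [ord0]. *)
Definition delta_row : 'M[G -> R[i]]_n.+1 :=
  \matrix_(i, j) (if i == ord0 then a j *: delta_fun (s j) else 0).

Definition delta_col : 'M[G -> R[i]]_n.+1 :=
  \matrix_(i, j) (if j == ord0 then delta_fun (s i) else 0).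

Let F0 : fourier (0 : G -> R[i]).
Proof. exact: fourier0. Qed.

Lemma pairing0 (T : L -> L) : VN T -> fourier_pairing 0 T = 0.
Proof.
move=> VT; have := pairingPl (-1) F0 F0 VT.
by rewrite scaler0 addr0 => ->; rewrite mulN1r addNr.
Qed.

(** Since [(X delta_1)(s) = (X delta_(s^-1))(1)], the whole row is the value at 1 of [X] applied to
    the vectors [zeta l]. The point masses at the [s_j^-1] are orthonormal, so these are no longer
    than the input, and evaluation at 1 is contractive. *)
Lemma delta_row_norm : (fourier_mxnorm delta_row <= 1)%E.
Proof.
apply: fourier_mxnorm_le => // m X VX X1 z; rewrite expr1n mul1r.
pose zeta l : L := \sum_j (a j * z (l, j)) *: l2delta (s j)^-1%g.
have zN l : N (zeta l) ^+ 2 <= \sum_j normc (z (l, j)) ^+ 2.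
  rewrite (l2norm_sum_delta (fun j => a j * z (l, j)) (e := fun j => (s j)^-1%g)); last first.
    by move=> j k /invg_inj/s_inj.
  apply: ler_sum => j _; rewrite normcM exprMn ler_piMl ?sqr_ge0//.
  by rewrite expr_le1// normc_ge0.
have -> : \sum_q normc (z q) ^+ 2 = \sum_l \sum_j normc (z (l, j)) ^+ 2.
  by rewrite pair_bigA; apply: eq_bigr => -[].
apply: (@le_trans _ _ (\sum_k N (\sum_l X k l (zeta l)) ^+ 2)); last first.
  by apply: le_trans (mxnormP VX X1 zeta) (ler_sum _ (fun l _ => zN l)).
rewrite (eq_bigr (fun p => normc (\sum_q fourier_pairing (delta_row p.2 q.2) (X p.1 q.1) * z q) ^+ 2))//.
rewrite -(pair_bigA _ (fun k i => normc (\sum_q fourier_pairing (delta_row i q.2) (X k q.1) * z q) ^+ 2))/=.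
apply: ler_sum => k _; rewrite (bigD1 ord0)//= [X in _ + X]big1 ?addr0; last first.
  move=> i i0; rewrite big1 ?normc0 ?expr0n// => q _.
  by rewrite mxE (negPf i0) pairing0 ?mul0r.
apply: (@le_trans _ _ (normc ((\sum_l X k l (zeta l)) 1%g) ^+ 2)); last first.
  by rewrite ler_pXn2r ?nnegrE ?normc_ge0 ?l2norm_ge0// ler_l2norm_term.
apply: le_of_eq; congr (normc _ ^+ 2).
rewrite (eq_bigr (fun q => fourier_pairing (delta_row ord0 q.2) (X k q.1) * z (q.1, q.2))); last by case.
rewrite -(pair_bigA _ (fun l j => fourier_pairing (delta_row ord0 j) (X k l) * z (l, j)))/=.
rewrite l2sumE; apply: eq_bigr => l _; rewrite (linear_map_sum (VN_linear (VX k l))) l2sumE; apply: eq_bigr => j _.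
rewrite mxE eqxx pairingZ_l//; last exact: fourier_delta.
rewrite pairing_delta// (linear_mapZ (VN_linear (VX k l))) l2scaleE [in RHS](VN_delta _ _ (VX k l)).
rewrite mul1g invgK; ring.
Qed.

(** The column lists the values at the distinct points [s i] of one vector, obtained by applying [X]
    to multiples of [delta_1]. *)
Lemma delta_col_norm : (fourier_mxnorm delta_col <= 1)%E.
Proof.
apply: fourier_mxnorm_le => // m X VX X1 z; rewrite expr1n mul1r.
pose zeta l : L := z (l, ord0) *: l2delta 1%g.
have zN l : N (zeta l) ^+ 2 <= \sum_j normc (z (l, j)) ^+ 2.
  rewrite l2normZ l2norm_delta mulr1 (bigD1 ord0)//= lerDl sumr_ge0// => j _.
  exact: sqr_ge0.
have -> : \sum_q normc (z q) ^+ 2 = \sum_l \sum_j normc (z (l, j)) ^+ 2.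
  by rewrite pair_bigA; apply: eq_bigr => -[].
apply: (@le_trans _ _ (\sum_k N (\sum_l X k l (zeta l)) ^+ 2)); last first.
  by apply: le_trans (mxnormP VX X1 zeta) (ler_sum _ (fun l _ => zN l)).
rewrite (eq_bigr (fun p => normc (\sum_q fourier_pairing (delta_col p.2 q.2) (X p.1 q.1) * z q) ^+ 2))//.
rewrite -(pair_bigA _ (fun k i => normc (\sum_q fourier_pairing (delta_col i q.2) (X k q.1) * z q) ^+ 2))/=.
apply: ler_sum => k _; set y := \sum_l X k l (zeta l).
apply: (@le_trans _ _ (\sum_i normc (y (s i)) ^+ 2)); last first.
  rewrite -lee_fin sqr_l2norm.
  have := @nsum_ge_seq R G (fun x => normc (y x) ^+ 2) [seq s i | i <- enum 'I_n.+1].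
  rewrite big_map big_enum/=; apply; last by move=> x; rewrite sqr_ge0.
  by rewrite map_inj_uniq ?enum_uniq.
apply: le_of_eq; apply: eq_bigr => i _; congr (normc _ ^+ 2).
rewrite (eq_bigr (fun q => fourier_pairing (delta_col i q.2) (X k q.1) * z (q.1, q.2))); last by case.
rewrite -(pair_bigA _ (fun l j => fourier_pairing (delta_col i j) (X k l) * z (l, j)))/=.
rewrite l2sumE; apply: eq_bigr => l _; rewrite (bigD1 ord0)//= [X in _ + X]big1 ?addr0; last first.
  by move=> j j0; rewrite mxE (negPf j0) pairing0 ?mul0r.
by rewrite mxE eqxx pairing_delta// (linear_mapZ (VN_linear (VX k l))) l2scaleE mulrC.
Qed.

Lemma delta_row_fourier i j : fourier (delta_row i j).
Proof. by rewrite mxE; case: ifP => // _; exact: fourierZ (fourier_delta _). Qed.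

Lemma delta_col_fourier i j : fourier (delta_col i j).
Proof. by rewrite mxE; case: ifP => // _; exact: fourier_delta. Qed.

End DeltaMatrices.

End Necessity.

(** * Complete bounds, and the two implications of the equivalence *)

Section CbNorm.
Context {R : realType} {V V' : Type}.

(** A constant at least 1 can be divided by later, and it also covers the value [-oo] of a supremum
    over no matrices. *)
Lemma cb_norm_fin (A : set V) (NV : @mxnorms R V) (NV' : @mxnorms R V') (T : V -> V') :
  completely_bounded A NV NV' T ->
  exists2 C : R, 1 <= C & forall n (v : 'M[V]_n), (forall i j, A (v i j)) ->
    (NV n v <= 1)%E -> (NV' n (map_mx T v) <= C%:E)%E.
Proof.
rewrite /completely_bounded => fin.
have [C C1 CE] : exists2 C : R, 1 <= C & (cb_norm A NV NV' T <= C%:E)%E.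
  move: fin; case: cb_norm => [c _||_] //.
    by exists (Num.max 1 c); rewrite ?lee_fin le_max lexx ?orbT.
  by exists 1; rewrite ?leNye.
exists C => // n v Av v1; apply: le_trans CE; apply: ereal_sup_ubound.
by exists n, v.
Qed.

Lemma cb_of_bound (A : set V) (NV : @mxnorms R V) (NV' : @mxnorms R V') (T : V -> V') (C : R) :
  (forall n (v : 'M[V]_n), (forall i j, A (v i j)) -> (NV n v <= 1)%E ->
    (NV' n (map_mx T v) <= C%:E)%E) -> completely_bounded A NV NV' T.
Proof.
move=> le; apply: (@le_lt_trans _ _ C%:E); last by rewrite ltry.
by apply: ge_ereal_sup => _ [n [v [Av v1 ->]]]; exact: le.
Qed.

End CbNorm.

Section FourierLinear.
Context {R : realType} {G : groupType} {V : lmodType R[i]}.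
Variable phi : (G -> R[i]) -> V.
Hypothesis phi_lin : forall a f g, fourier f -> fourier g -> phi (a *: f + g) = a *: phi f + phi g.

(** [phi] is additive on [fourier] only, so membership of the partial sums is carried along the
    induction. *)
Lemma fourier_comb (J : Type) (q : seq J) (b : J -> R[i]) (f : J -> G -> R[i]) :
  (forall j, fourier (f j)) -> fourier (\sum_(j <- q) b j *: f j) /\
  phi (\sum_(j <- q) b j *: f j) = \sum_(j <- q) b j *: phi (f j).
Proof.
move=> Ff; have F0 : fourier (0 : G -> R[i]) by exact: fourier0.
have phi0 : phi 0 = 0.
  by have := phi_lin (-1) F0 F0; rewrite scaler0 addr0 scaleN1r addNr.
elim: q => [|j q [Fq IH]]; first by rewrite !big_nil.
by rewrite !big_cons; split; [exact: fourierP|rewrite phi_lin// IH].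
Qed.

End FourierLinear.

Section Representation.
Context {R : realType} {G : groupType}.
Local Notation L := (l2space R G).
Local Notation N := (@l2norm R G).
Variable w : G -> R[i].
Hypothesis w_inj : forall f g, fourier f -> fourier g -> multiplier w f = multiplier w g -> f = g.

Lemma multiplierP a f g : multiplier w (a *: f + g) = a *: multiplier w f + multiplier w g.
Proof.
have E (p q x y : R[i]) : p * (q * x + y) = q * (p * x) + p * y by ring.
by apply/funext => s; exact: E.
Qed.

(** The isomorphism is [repop w] after the inverse of [multiplier w]. The inverses [pre] and [pre']
    pick preimages, unique by injectivity of [multiplier w] and of [repop w]; the complete bounds
    are [sqrt (4 (W + 1))], with [W] the square sum of [w], and 1. *)
Lemma l2_representable : (sqsum w < +oo)%E ->
  completely_representable (fun f g : G -> R[i] => f * g) (deformed w) (@deformed_mxnorm R G w).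
Proof.
move=> wo.
pose pre v := xget 0 [set f | fourier f /\ multiplier w f = v].
pose pre' (S : l2space R (@ball_index R G) -> l2space R (@ball_index R G)) :=
  xget 0 [set f | fourier f /\ S = repop w f].
have preE f : fourier f -> pre (multiplier w f) = f.
  move=> Ff; rewrite /pre; case: xgetP => [g _ [Fg gE]|/(_ f)[]//].
  exact: w_inj.
have pre'E f : fourier f -> pre' (repop w f) = f.
  move=> Ff; rewrite /pre'; case: xgetP => [g _ [Fg gE]|/(_ f)[]//].
  by apply: (repop_inj wo) => //; rewrite gE.
exists (@l2hilbert R (@ball_index R G)); rewrite hnorm_l2; exists (repalg w), (repop w \o pre), (multiplier w \o pre').
split.
- exact: repalg_closed.
- split; first by move=> _ [f Ff <-]; rewrite /= preE// pre'E//; split => //; exists f.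
  by move=> _ [f Ff ->]; rewrite /= pre'E// preE//; split => //; exists f.
- split.
    move=> a _ _ [f Ff <-] [g Fg <-]; rewrite /= -multiplierP !preE ?repopP//.
    exact: fourierP.
  move=> _ _ [f Ff <-] [g Fg <-]; rewrite /= !preE// repopM//.
  have Fh : fourier (w * f * g) by apply: l2_fourier; exact: l2_mul_fourier.
  rewrite -[in RHS](preE _ Fh); congr (repop w (pre _)).
  by rewrite /multiplier mulrA [w * f * w]mulrAC -!mulrA.
- apply: (@cb_of_bound _ _ _ _ _ _ _ (Num.sqrt (4 * (fine (sqsum w) + 1)))) => n v Av v1.
  pose F := map_mx pre v.
  have FE : v = map_mx (multiplier w) F.
    by apply/matrixP => i j; rewrite !mxE; have [f Ff <-] := Av i j; rewrite preE.
  have FF i j : fourier (F i j) by rewrite mxE; have [f Ff <-] := Av i j; rewrite preE.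
  rewrite FE deformed_mxnormE// in v1.
  have := repop_mxnorm wo ler01 FF v1; rewrite mulr1.
  by move=> h; rewrite map_mx_comp; exact: h.
- apply: (@cb_of_bound _ _ _ _ _ _ _ 1) => n S AS S1.
  pose F := map_mx pre' S.
  have SE : S = map_mx (repop w) F.
    by apply/matrixP => i j; rewrite !mxE; have [f Ff ->] := AS i j; rewrite pre'E.
  have FF i j : fourier (F i j) by rewrite mxE; have [f Ff ->] := AS i j; rewrite pre'E.
  rewrite SE in S1; rewrite map_mx_comp -/F deformed_mxnormE//.
  exact: (repop_mxnorm_ge wo ler01 FF S1).
Qed.

Section Estimate.
Variables (H : hilbert R) (B : set (H -> H)) (T : (G -> R[i]) -> H -> H) (T' : (H -> H) -> G -> R[i]).
Local Notation NH := (@hnorm R H).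
Variables C C' : R.
Hypotheses (C1 : 1 <= C) (C'1 : 1 <= C').
Hypothesis B_bounded : B `<=` bounded_op NH.
Hypothesis TB : forall f, deformed w f -> B (T f) /\ T' (T f) = f.
Hypothesis T_lin : forall (a : R[i]) f g, deformed w f -> deformed w g ->
  T (a *: f + g) = a *: T f + T g.
Hypothesis T_mul : forall f g, deformed w f -> deformed w g -> T (f * g) = T f \o T g.
Hypothesis T_cb : forall n (v : 'M_n), (forall i j, deformed w (v i j)) ->
  (deformed_mxnorm w v <= 1)%E -> (op_mxnorm NH (map_mx T v) <= C%:E)%E.
Hypothesis T'_cb : forall n (S : 'M_n), (forall i j, B (S i j)) ->
  (op_mxnorm NH S <= 1)%E -> (deformed_mxnorm w (map_mx T' S) <= C'%:E)%E.

(** The representation transported to [A(G)]; it satisfies [U f U g = U (w f g)] whenever [w f g]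
    stays in [A(G)]. *)
Let U f := T (multiplier w f).

Let deformedM f : fourier f -> deformed w (multiplier w f).
Proof. by exists f. Qed.

Let U_lin a f g : fourier f -> fourier g -> U (a *: f + g) = a *: U f + U g.
Proof. by move=> Ff Fg; rewrite /U -T_lin ?multiplierP//; exact: deformedM. Qed.

Let UZl a f x : fourier f -> U (a *: f) x = a *: U f x.
Proof.
move=> Ff; have F0 : fourier (0 : G -> R[i]) by exact: fourier0.
have U0 : U 0 = 0 by have := U_lin (-1) F0 F0; rewrite scaler0 addr0 scaleN1r addNr.
by rewrite -[a *: f]addr0 U_lin// U0 addr0.
Qed.

Let UZ f a x : fourier f -> U f (a *: x) = a *: U f x.
Proof.
move=> Ff; have [BU _] := TB (deformedM Ff); have [lin _] := B_bounded BU.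
exact: linear_mapZ lin a x.
Qed.

Let U0 f : fourier f -> U f 0 = 0.
Proof. by move=> Ff; have := UZ 0 0 Ff; rewrite !scale0r. Qed.

Let C0 : 0 <= C. Proof. exact: le_trans C1. Qed.
Let C'0 : 0 <= C'. Proof. exact: le_trans C'1. Qed.

Let U_mx n (F : 'M[G -> R[i]]_n) : (forall i j, fourier (F i j)) -> (fourier_mxnorm F <= 1)%E ->
  forall x : 'I_n -> H,
  \sum_i NH (\sum_j U (F i j) (x j)) ^+ 2 <= C ^+ 2 * \sum_j NH (x j) ^+ 2.
Proof.
move=> FF F1; apply: (opnormP (@hnormZ R H) C0 (T := fun i j => U (F i j))).
  by move=> i j a x; exact: UZ.
have FD i j : deformed w (map_mx (multiplier w) F i j) by rewrite mxE; exact: deformedM.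
have := T_cb FD; rewrite deformed_mxnormE// => /(_ F1).
apply: le_trans; apply: le_of_eq; congr opnorm.
by apply/funext => i; apply/funext => j; rewrite !mxE.
Qed.

Section Deltas.
Variables (n : nat) (s : 'I_n.+1 -> G) (a : 'I_n.+1 -> R[i]).
Hypotheses (s_inj : injective s) (a1 : forall j, normc (a j) <= 1).

Let sum_ord0 (F : 'I_n.+1 -> H) : (forall j, j != ord0 -> F j = 0) -> \sum_j F j = F ord0.
Proof. by move=> F0; rewrite (bigD1 ord0)//= big1 ?addr0. Qed.

Let U_col x : \sum_j NH (U (delta_fun (s j)) x) ^+ 2 <= C ^+ 2 * NH x ^+ 2.
Proof.
have := U_mx (@delta_col_fourier R G n s) (delta_col_norm s_inj)
  (fun j => if j == ord0 then x else 0).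
rewrite [X in _ <= _ * X](bigD1 ord0)//= [X in _ <= _ * (_ + X)]big1 => [|j /negPf ->]; last first.
  by rewrite hnorm0 expr0n.
rewrite addr0; apply: le_trans; apply: ler_sum => i _; rewrite sum_ord0 ?mxE//.
by move=> j /negPf j0; rewrite j0 U0//; exact: delta_col_fourier.
Qed.

Let U_row (x : 'I_n.+1 -> H) :
  NH (\sum_j a j *: U (delta_fun (s j)) (x j)) ^+ 2 <= C ^+ 2 * \sum_j NH (x j) ^+ 2.
Proof.
have := U_mx (delta_row_fourier s a) (delta_row_norm s_inj a1) x.
apply: le_trans; rewrite [leRHS](bigD1 ord0)//= -[leLHS]addr0; apply: lerD; last first.
  by apply: sumr_ge0 => i _; rewrite sqr_ge0.
apply: le_of_eq; congr (NH _ ^+ 2); apply: eq_bigr => j _.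
by rewrite mxE eqxx UZl//; exact: fourier_delta.
Qed.

(** The function whose image is the product of the row and the column. *)
Let h : G -> R[i] := \sum_j (w (s j) * a j) *: delta_fun (s j).

Let Fh : fourier h.
Proof. exact: (fourier_comb U_lin _ _ (fun j => fourier_delta (s j))).1. Qed.

(** A point mass is idempotent, so [U (delta_s)] composed with itself is [w(s) U (delta_s)]: the
    product of row and column brings in exactly one factor [w(s)]. *)
Let U_square x : U h x = \sum_j a j *: U (delta_fun (s j)) (U (delta_fun (s j)) x).
Proof.
rewrite (fourier_comb U_lin _ _ (fun j => fourier_delta (s j))).2.
have -> (F : 'I_n.+1 -> H -> H) : (\sum_j F j) x = \sum_j F j x.
  by elim/big_rec2: _ => // i y1 y2 _ <-.
apply: eq_bigr => j _; have Fd := @fourier_delta R G (s j).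
have -> : U (delta_fun (s j)) (U (delta_fun (s j)) x) =
    T (multiplier w (delta_fun (s j)) * multiplier w (delta_fun (s j))) x.
  by rewrite T_mul//; exact: deformedM.
have -> : multiplier w (delta_fun (s j)) * multiplier w (delta_fun (s j)) =
    multiplier w (w (s j) *: delta_fun (s j)).
  apply/funext => t; rewrite /multiplier -![(_ * _) t]/(_ t * _ t) -![(_ *: _) t]/(_ * _).
  rewrite /delta_fun; case: eqP => [->|_]; first by rewrite !mulr1.
  by rewrite !mulr0.
by rewrite -/(U _) UZl// scalerA mulrC.
Qed.

(** One factor [C] comes from the row and one from the column, uniformly in their length. *)
Let U_bound x : NH (U h x) <= C ^+ 2 * NH x.
Proof.
rewrite -(ler_pXn2r (n := 2)) ?nnegrE ?hnorm_ge0 ?mulr_ge0 ?sqr_ge0 ?hnorm_ge0//.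
rewrite U_square; apply: le_trans (U_row _) _.
by rewrite [leRHS]exprMn [X in X * _]expr2 -[leRHS]mulrA ler_wpM2l ?sqr_ge0// U_col.
Qed.

Lemma delta_estimate (V : L -> L) (K : R) : VN V -> 0 <= K -> (forall f, N (V f) <= K * N f) ->
  normc (\sum_j w (s j) * a j * V (l2delta 1%g) (s j)) <= C ^+ 2 * C' * K.
Proof.
(* The hypothesis on [T'] concerns the unit ball only; [c] scales [U h] to a contraction, and
   [C ^+ 2] is put back at the end. *)
move=> VV K0 VK; pose c : R := (C ^+ 2)^-1.
have Cp : 0 < C ^+ 2 by rewrite exprn_gt0// (lt_le_trans ltr01).
have Fc : fourier (c%:C *: h) by exact: fourierZ.
have cN : (fourier_norm (c%:C *: h) <= C'%:E)%E.
  have Fm (i j : 'I_1) : fourier ((const_mx (c%:C *: h) : 'M_1) i j) by rewrite mxE.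
  have Sb (i j : 'I_1) : B ((const_mx (U (c%:C *: h)) : 'M_1) i j).
    by rewrite mxE; exact: (TB (deformedM Fc)).1.
  rewrite /fourier_norm -(deformed_mxnormE w_inj Fm).
  have -> : map_mx (multiplier w) (const_mx (c%:C *: h)) =
      map_mx T' (const_mx (U (c%:C *: h)) : 'M_1).
    by rewrite !map_const_mx; congr const_mx; rewrite (TB (deformedM Fc)).2.
  apply: (T'_cb Sb).
  have := (op_mxnorm1P ler01 (@hnorm_ge0 R H) (@hnormZ R H) (fun b x => UZ b x Fc)).2.
  have -> : op_mxnorm NH (const_mx (U (c%:C *: h)) : 'M_1) =
      opnorm NH (fun _ _ : 'I_1 => U (c%:C *: h)).
    by congr opnorm; apply/funext => i; apply/funext => j; rewrite mxE.
  apply => x; rewrite UZl// hnormZ normc_real ger0_norm ?invr_ge0 ?sqr_ge0//.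
  by rewrite mul1r ler_pdivrMl// U_bound.
have := pairing_bound Fc VV K0 C'0 VK cN.
rewrite pairingZ_l// normcM normc_real ger0_norm ?invr_ge0 ?sqr_ge0// ler_pdivrMl//.
(* Scalars are viewed as a module over themselves, which lets [fourier_comb] expand the pairing. *)
have pl b f g : fourier f -> fourier g -> fourier_pairing (b *: f + g) V =
    (b *: (fourier_pairing f V : R[i]^o) + fourier_pairing g V : R[i]^o).
  by move=> Ff Fg; rewrite pairingPl.
rewrite /h (fourier_comb (V := R[i]^o) pl _ _ (fun j => fourier_delta (s j))).2.
rewrite [C ^+ 2 * C' * K]mulrAC mulrA; apply: le_trans; apply: le_of_eq.
by congr normc; apply: eq_bigr => j _; rewrite pairing_delta.
Qed.

End Deltas.

Lemma seq_estimate (r : seq G) (a : G -> R[i]) (V : L -> L) (K : R) : uniq r ->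
  (forall t, normc (a t) <= 1) -> VN V -> 0 <= K -> (forall f, N (V f) <= K * N f) ->
  normc (\sum_(t <- r) w t * a t * V (l2delta 1%g) t) <= C ^+ 2 * C' * K.
Proof.
move=> ur a1 VV K0 VK; case: r ur => [|x r'] ur.
  by rewrite big_nil normc0 !mulr_ge0.
set r := x :: r' in ur *; rewrite (big_nth x) big_mkord.
have inj : injective (fun j : 'I_(size r) => nth x r j).
  by move=> j k /eqP; rewrite nth_uniq// => /eqP/val_inj.
exact: (delta_estimate (s := fun j : 'I_(size r) => nth x r j) (a := fun j => a (nth x r j)) inj).
Qed.

(** The signs, and then the test operator, are chosen for each finite set of points; the bound is
    independent of that set, and so passes to the sum over the group. *)
Lemma sqsum_estimate : (sqsum w <= (24 * (C ^+ 2 * C') ^+ 2)%:E)%E.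
Proof.
apply: nsum_le_seq => r ur; rewrite lee_fin; set D := C ^+ 2 * C'.
have D0 : 0 <= D by rewrite mulr_ge0 ?sqr_ge0.
set S := \sum_(i <- r) _.
have S0 : 0 <= S by apply: sumr_ge0 => i _; rewrite sqr_ge0.
have [->|Sn] := eqVneq S 0; first by rewrite mulr_ge0 ?sqr_ge0.
have Sp : 0 < S by rewrite lt_def Sn.
have [eps [epsP]] := exists_signs w ur; set c := fun s => _ => /= Q.
(* [t = 1 / (6 S)] makes the loss [t * 3 S^2] equal to [S / 2], half of the main term. *)
have S6 : 0 < 6 * S by rewrite mulr_gt0.
have t0 : 0 < (6 * S)^-1 by rewrite invr_gt0.
have en t : normc (eps t)%:C = 1.
  by rewrite normc_real; case: (epsP t) => ->; rewrite ?normrN normr1.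
have [V [VV VK le]] := exists_test_op c ur t0; rewrite invrK in VK.
have cS : \sum_(s <- r) normc (c s) ^+ 2 = S.
  by apply: eq_bigr => s _; rewrite /c normcM en mul1r.
have a1 t : normc (eps t)%:C <= 1 by rewrite en.
have := seq_estimate ur a1 VV (sqrtr_ge0 _) VK; rewrite -/D.
have -> : \sum_(t <- r) w t * (eps t)%:C * V (l2delta 1%g) t = \sum_(t <- r) c t * V (l2delta 1%g) t.
  by apply: eq_bigr => t _; rewrite /c [w t * _]mulrC.
rewrite cS in le => /(le_trans le) {le}.
have : (6 * S)^-1 * l2norm (conv_adj r c (conv r c (l2delta 1%g))) ^+ 2 <= S / 2.
  rewrite ler_pdivrMl//; apply: le_trans Q _; rewrite -/S.
  by apply: le_of_eq; field.
set q := Num.sqrt (6 * S); have qE : q ^+ 2 = 6 * S by rewrite sqr_sqrtr// ltW.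
have q0 : 0 < q by rewrite sqrtr_gt0.
(* [S / 2 <= D q] with [q^2 = 6 S] reads [q^2 <= 12 D q]; hence [6 S <= 144 D^2], the constant
   24. *)
move=> h1 h2; have {h1 h2} h : q ^+ 2 <= 12 * D * q by rewrite qE; lra.
have q12 : q <= 12 * D by rewrite -(ler_pM2r q0) -expr2.
have : q ^+ 2 <= (12 * D) ^+ 2 by rewrite ler_pXn2r ?nnegrE ?mulr_ge0// ltW.
by rewrite qE exprMn => ?; lra.
Qed.

End Estimate.

Lemma representable_l2 :
  completely_representable (fun f g : G -> R[i] => f * g) (deformed w) (@deformed_mxnorm R G w) ->
  (sqsum w < +oo)%E.
Proof.
move=> [H [B [T [T' [[Bb _ _ _ _] [TB _] [Tl TM] /cb_norm_fin[C C1 TC] /cb_norm_fin[C' C'1 T'C]]]]]].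
exact: le_lt_trans (sqsum_estimate C1 C'1 Bb TB Tl TM TC T'C) (ltry _).
Qed.

End Representation.

Theorem theorem5p4 (R : realType) (G : groupType) (w : G -> R[i])
    (w_mcb : mcb w)
    (w_norm1 : mcb_norm w = 1%E)
    (w_inj : forall f g, fourier f -> fourier g ->
       multiplier w f = multiplier w g -> f = g)
    (w_dense : dense_range w) :
  completely_representable (fun f g : G -> R[i] => f * g)
    (deformed w) (@deformed_mxnorm R G w)
  <-> l2 w.
Proof. by split; [exact: representable_l2|exact: l2_representable]. Qed.
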